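(* Assume that the following statement (a strengthening of the Segre–Harbourne–Gimigliano–Hirschowitz conjecture) is true: ''For every integer $r'\ge 0$, if $X'$ is the blow up of $\mathbb{P}^2$ at $r'$ very general points, with $H'$ the pull-back of the hyperplane class and $E'_1,\ldots,E'_{r'}$ the exceptional divisors, and if $d\ge1$, $t\ge1$ and $m_1,\ldots,m_{r'}\ge0$ are integers such that $$\binom{d+2}{2}-\sum_{i=1}^{r'}\binom{m_i+1}{2}\le\max\left\{\binom{t+1}{2}-2,\,0\right\},$$ then any curve $C\in|dH'-m_1E'_1-\cdots-m_{r'}E'_{r'}|$ on $X'$ which has a point of multiplicity $t$ is non-reduced.'' Let $r\ge10$ be an integer. Then the submaximality threshold $\mu_0$ for $r$ exists, and $$\mu_0=\begin{cases}\frac{77}{24}&\text{if } r=10,\\ 4-\frac{\sqrt3}{3}&\text{if } r=11,\\ \frac16(26-\sqrt{13})&\text{if } r=13,\\ \sqrt{r+1}&\text{if } r=12\text{ or } r\ge14.\end{cases}$$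
   Context: We work over $\mathbb{C}$. Let $p_1,\ldots,p_r\in\mathbb{P}^2$ be very general points and $X=\mathrm{Bl}_{p_1,\ldots,p_r}\mathbb{P}^2$. Let $E_i$ be the exceptional divisor over $p_i$ and $H$ the pull-back to $X$ of $\mathcal{O}_{\mathbb{P}^2}(1)$. For $\mu\in\mathbb{R}$ let $L(\mu)=\mu H-\sum_{i=1}^rE_i$, an $\mathbb{R}$-divisor with $L(\mu)^2=\mu^2-r$. For an $\mathbb{R}$-divisor $L$ on $X$ with $L^2\ge0$, a weakly submaximal curve for $L$ is an irreducible and reduced curve $C\subset X$ such that, for some point $x\in C$, $\frac{L\cdot C}{\mathrm{mult}_xC}\le\sqrt{L^2}$; $L$ admits a weakly submaximal curve if such a pair $(C,x)$ exists. A real number $\mu_0\ge\sqrt r$ is called the submaximality threshold for $r$ if (1) $L(\mu)$ does not admit a weakly submaximal curve for any real $\mu$ with $\sqrt r\le\mu<\mu_0$, and (2) $L(\mu)$ does admit a weakly submaximal curve for every real $\mu\ge\mu_0$. *)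

(* Defs.v *)
From HB Require Import structures.
From mathcomp Require Import all_boot all_order all_algebra.
From mathcomp Require Import reals.
From mathcomp.real_closed Require Import complex.
From mathcomp.multinomials Require Import mpoly.

Set Implicit Arguments.
Unset Strict Implicit.
Unset Printing Implicit Defensive.

Import Order.TTheory GRing.Theory Num.Theory.
Local Open Scope ring_scope.

(* Points of P^2 are given by nonzero row vectors of homogeneous coordinates,
   and r-tuples of points by r x 3 matrices with nonzero rows. *)

Definition is_config (K : fieldType) (r : nat) (p : 'M[K]_(r, 3)) : Prop :=
  forall i, row i p != 0.

Definition multihomogeneous (K : fieldType) (r : nat)
    (G : {mpoly K[r * 3]}) : Prop :=
  exists e : 'I_r -> nat, forall m, m \in msupp G ->
    forall i, (\sum_(j < 3) m (mxvec_index i j))%N = e i.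

(* The Zariski closed subset of (P^2)^r with equations S. *)
Definition zero_locus (K : fieldType) (r : nat)
    (S : {mpoly K[r * 3]} -> Prop) (p : 'M[K]_(r, 3)) : Prop :=
  forall G, S G -> G.@[fun k => mxvec p 0 k] = 0.

Definition proper_closed (K : fieldType) (r : nat)
    (S : {mpoly K[r * 3]} -> Prop) : Prop :=
  (forall G, S G -> multihomogeneous G) /\
  (exists p : 'M[K]_(r, 3), is_config p /\ ~ zero_locus S p).

(* P holds for every tuple outside a countable union of proper closed subsets
   of (P^2)^r.  As the diagonals are proper closed subsets, very general points
   are pairwise distinct. *)
Definition very_general (K : fieldType) (r : nat)
    (P : 'M[K]_(r, 3) -> Prop) : Prop :=
  exists Z : nat -> {mpoly K[r * 3]} -> Prop,
    (forall n, proper_closed (Z n)) /\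
    (forall p, is_config p -> (forall n, ~ zero_locus (Z n) p) -> P p).

(* The order of vanishing at the origin of G != 0 (msize G exceeds the degree
   of each monomial of G). *)
Definition ord0_mpoly (K : fieldType) (n : nat) (G : {mpoly K[n]}) : nat :=
  \big[minn/msize G]_(m <- msupp G) mdeg m.

(* The multiplicity at [q] of the plane curve F = 0: it is the multiplicity at
   the vector q of the affine cone over that curve. *)
Definition mult_P2 (K : fieldType) (F : {mpoly K[3]}) (q : 'rV[K]_3) : nat :=
  ord0_mpoly (F \mPo [tuple (q 0 j)%:MP + 'X_j | j < 3]).

Definition frame (K : fieldType) (q a b : 'rV[K]_3) : 'M[K]_3 :=
  col_mx q (col_mx a b).

(* The points of X, the blow up of P^2 at the rows p_i of p:
   X = (P^2 \ {p_1, ..., p_r}) + \sum_i P(T_{p_i} P^2).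
   As with homogeneous coordinates, a point is given by non-unique data, which
   here include local coordinates (u, v) on X centred at the point:
   - Away q a b is the point [q], distinct from the p_i, with the blow-down
     given by (u, v) |-> [q + u a + v b];
   - Over i a b is the point of E_i given by the tangent direction at p_i of
     the line through p_i and a, with the blow-down given by
     (u, v) |-> [p_i + u (a + v b)]; E_i is u = 0. *)
Inductive blowup (K : fieldType) (r : nat) (p : 'M[K]_(r, 3)) : Type :=
| Away (q a b : 'rV[K]_3) of
    frame q a b \in unitmx & (forall i, row_free (col_mx (row i p) q))
| Over (i : 'I_r) (a b : 'rV[K]_3) of frame (row i p) a b \in unitmx.

Definition on_exc (K : fieldType) (r : nat) (p : 'M[K]_(r, 3))
    (x : blowup p) (i : 'I_r) : bool :=
  match x with
  | Away _ _ _ _ _ => false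
  | Over k _ _ _ => k == i
  end.

(* The pull-back to X of the form F, in the local coordinates u = 'X_0 and
   v = 'X_1 at x. *)
Definition pullback (K : fieldType) (r : nat) (p : 'M[K]_(r, 3))
    (x : blowup p) (F : {mpoly K[3]}) : {mpoly K[2]} :=
  let u := 'X_ord0 in let v := 'X_ord_max in
  match x with
  | Away q a b _ _ =>
      F \mPo [tuple (q 0 j)%:MP + (a 0 j)%:MP * u + (b 0 j)%:MP * v | j < 3]
  | Over i a b _ =>
      F \mPo [tuple (p i j)%:MP + u * ((a 0 j)%:MP + (b 0 j)%:MP * v) | j < 3]
  end.

(* An effective divisor in |dH - \sum_i m_i E_i|, for d : nat and m_i : int of
   any sign, is pi^*(F = 0) - \sum_i m_i E_i for a form F != 0 of degree d,
   unique up to scalars, such that ord_{E_i} (pi^* F) = mult_{p_i} F >= m_i for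
   all i.  As Pic X is freely generated by H, E_1, ..., E_r and H is nef, all
   effective divisors are of this kind; for instance E_k is F = 1, m_k = -1 and
   m_i = 0 for i != k. *)
Record curve (K : fieldType) (r : nat) (p : 'M[K]_(r, 3)) : Type := Curve {
  cdeg : nat;
  cmul : 'I_r -> int;
  cform : {mpoly K[3]};
  cform_neq0 : cform != 0;
  cform_homog : cform \is cdeg.-homog;
  cmul_le : forall i, cmul i <= (mult_P2 cform (row i p))%:Z
}.

Definition in_system (K : fieldType) (r : nat) (p : 'M[K]_(r, 3))
    (C : curve p) (d : nat) (m : 'I_r -> int) : Prop :=
  cdeg C = d /\ forall i, cmul C i = m i.

Definition zero_divisor (K : fieldType) (r : nat) (p : 'M[K]_(r, 3))
    (C : curve p) : Prop :=
  in_system C 0 (fun=> 0).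

(* C = A + B as divisors *)
Definition is_sum (K : fieldType) (r : nat) (p : 'M[K]_(r, 3))
    (C A B : curve p) : Prop :=
  cform C = cform A * cform B /\ forall i, cmul C i = cmul A i + cmul B i.

Definition integral_curve (K : fieldType) (r : nat) (p : 'M[K]_(r, 3))
    (C : curve p) : Prop :=
  ~ zero_divisor C /\
  forall A B, is_sum C A B -> zero_divisor A \/ zero_divisor B.

(* C = A + (A + B) with A != 0 *)
Definition non_reduced (K : fieldType) (r : nat) (p : 'M[K]_(r, 3))
    (C : curve p) : Prop :=
  exists A B D : curve p, ~ zero_divisor A /\ is_sum D A B /\ is_sum C A D.

(* mult_x is additive on divisors, and mult_x E_i is 1 or 0 according to
   whether x lies on E_i. *)
Definition mult_at (K : fieldType) (r : nat) (p : 'M[K]_(r, 3))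
    (C : curve p) (x : blowup p) : int :=
  (ord0_mpoly (pullback x (cform C)))%:Z
  - \sum_(i < r | on_exc x i) cmul C i.

(* The class a H - \sum_i b_i E_i in Pic X tensored with R is (a, b). *)
Definition rdivisor (R : realType) (r : nat) : Type := (R * ('I_r -> R))%type.

Definition class_of (R : realType) (r : nat) (p : 'M[R[i]]_(r, 3))
    (C : curve p) : rdivisor R r :=
  ((cdeg C)%:R, fun i => (cmul C i)%:~R).

Definition intersection (R : realType) (r : nat) (L M : rdivisor R r) : R :=
  L.1 * M.1 - \sum_(i < r) L.2 i * M.2 i.

Definition weakly_submaximal (R : realType) (r : nat) (p : 'M[R[i]]_(r, 3))
    (L : rdivisor R r) (C : curve p) : Prop :=
  integral_curve C /\
  exists x : blowup p, 0 < mult_at C x /\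
    intersection L (class_of C) / (mult_at C x)%:~R
      <= Num.sqrt (intersection L L).

Definition uniform_divisor (R : realType) (r : nat) (mu : R) : rdivisor R r :=
  (mu, fun=> 1).

Definition admits_weakly_submaximal (R : realType) (r : nat)
    (p : 'M[R[i]]_(r, 3)) (mu : R) : Prop :=
  exists C : curve p, weakly_submaximal (uniform_divisor r mu) C.

Definition submaximality_threshold (R : realType) (r : nat)
    (p : 'M[R[i]]_(r, 3)) (mu0 : R) : Prop :=
  [/\ Num.sqrt r%:R <= mu0,
      forall mu, Num.sqrt r%:R <= mu -> mu < mu0 ->
        ~ admits_weakly_submaximal p mu
    & forall mu, mu0 <= mu -> admits_weakly_submaximal p mu].

Definition strong_SHGH (R : realType) : Prop :=
  forall r : nat, very_general (fun p : 'M[R[i]]_(r, 3) =>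
    forall (d t : nat) (m : 'I_r -> nat), (1 <= d)%N -> (1 <= t)%N ->
      'C(d.+2, 2)%:Z - \sum_(i < r) 'C((m i).+1, 2)%:Z
        <= Num.max ('C(t.+1, 2)%:Z - 2) 0 ->
      forall C : curve p, in_system C d (fun i => (m i)%:Z) ->
        (exists x : blowup p, mult_at C x = t%:Z) -> non_reduced C).

Definition threshold_value (R : realType) (r : nat) : R :=
  match r with
  | 10 => 77%:R / 24%:R
  | 11 => 4%:R - Num.sqrt 3%:R / 3%:R
  | 13 => (26%:R - Num.sqrt 13%:R) / 6%:R
  | _ => Num.sqrt r.+1%:R
  end.

(* Main.v *)
(* Below the threshold, the strong SHGH statement bounds the expected dimension
   of an integral curve with a point of multiplicity t; together with submaximality
   and Cauchy-Schwarz this leaves finitely many numerical types (r, d, t, sum m_i),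
   each of which is excluded by its quadratic inequality in mu.  Once
   mu ^+ 2 >= r + 1, the exceptional curves are submaximal.

   For r = 10, 11, 13 the remaining interval is covered by a nodal curve in the
   pencil |10H - 4E_1 - 3E_2 - ... - 3E_10|, |4H - 2E_1 - E_2 - ... - E_11| or
   |4H - E_1 - ... - E_13| respectively, and for r = 10, beyond mu = 13/4, by the
   cubic through nine of the points; an effective submaximal divisor has a
   submaximal component.  The nodal curve exists for very general points
   because it exists, and is an etale solution of the equations defining it, for
   one explicit configuration (the kernel being trivial modulo 97).  An etale
   solution has a Zariski dense set of neighbours: the ideal of the
   equations, saturated by the Jacobian, is stable under lifts of the derivations
   d/dp_i, so it contains no nonzero polynomial in p, and the Nullstellensatz
   applies.  By quantifier elimination, solvability holds generically or fails
   generically, so it holds generically.  Very general sets are made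
   multihomogeneous by splitting polynomials into multidegree parts. *)
From Stdlib Require Import ZArith.
Require Import Defs.
From HB Require Import structures.
From mathcomp Require Import all_boot all_order all_algebra.
From mathcomp Require Import boolp classical_sets cardinality.
From mathcomp Require Import reals closed_field.
From mathcomp.real_closed Require Import complex.
From mathcomp.multinomials Require Import mpoly.
From mathcomp Require Import ssrZ zify ring lra.

Set Implicit Arguments.
Unset Strict Implicit.
Unset Printing Implicit Defensive.

Import Order.TTheory GRing.Theory Num.Theory.
Local Open Scope ring_scope.

(** The hypothesis only forbids curves, so those that realise the thresholds for r = 10, 11, 13 must
    be constructed, and one example spreads to other configurations only if it is rigid. In a
    pencil, a member and the position of its node are three unknowns, subject to the three equations
    of a singular point. With the linear conditions at the p_i this is a square system. Its Jacobian
    is invertible at an example whose linear conditions are independent, whose node is not a base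
    point of the pencil, and whose tangent cone at the node is nondegenerate. The constants are
    roots in mu of (d mu - M)^2 = t^2 (mu^2 - r), where M is the sum of the m_i: a curve of type (d,
    t, M) is submaximal between the two roots. For r = 10, the type (10, 2, 31) has roots 77/24 and
    13/4. As 13/4 is smaller than sqrt 11, the cubic (3, 1, 9), with roots 13/4 and 7/2, must take
    over. For r = 11 and 13, the larger root of (4, 2, 12) and of (4, 2, 13) already exceeds sqrt (r
    + 1). *)

(** * Quantifier elimination and solvability at general parameters *)

Section GenericDichotomy.
Variable K : closedFieldType.

Definition env n (p : 'I_n -> K) : seq K := [seq p i | i <- enum 'I_n].

Lemma nth_env n (p : 'I_n -> K) (i : 'I_n) : (env p)`_i = p i.
Proof. by rewrite (nth_map i) ?size_enum_ord // nth_ord_enum. Qed.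

Lemma env_default n (p : 'I_n -> K) k : (n <= k)%N -> (env p)`_k = 0.
Proof. by move=> le_nk; rewrite nth_default // size_map size_enum_ord. Qed.

Lemma eval_rterm_mpoly n (t : GRing.term K) : GRing.rterm t ->
  exists Q : {mpoly K[n]}, forall p, GRing.eval (env p) t = Q.@[p].
Proof.
elim: t => //=.
- move=> i _; case: (ltnP i n) => [lt_in|le_ni].
    by exists 'X_(Ordinal lt_in) => p; rewrite mevalXU -(nth_env p (Ordinal lt_in)).
  by exists 0 => p; rewrite env_default // meval0.
- by move=> c _; exists c%:MP => p; rewrite mevalC.
- by move=> k _; exists k%:R => p; rewrite -mpolyC_nat mevalC.
- move=> t1 IH1 t2 IH2 /andP[/IH1[Q1 E1] /IH2[Q2 E2]].
  by exists (Q1 + Q2) => p; rewrite mevalD E1 E2.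
- by move=> t IH /IH[Q E]; exists (- Q) => p; rewrite mevalN E.
- by move=> t IH k /IH[Q E]; exists (Q *+ k) => p; rewrite mevalMn E.
- move=> t1 IH1 t2 IH2 /andP[/IH1[Q1 E1] /IH2[Q2 E2]].
  by exists (Q1 * Q2) => p; rewrite mevalM E1 E2.
- by move=> t IH k /IH[Q E]; exists (Q ^+ k) => p; rewrite rmorphXn /= E.
Qed.

(** An equation between terms is either a polynomial identity or false off the hypersurface where
    the two sides agree. Polynomials form a domain, so the product of two such hypersurface
    equations serves for a compound formula. *)
Lemma qf_generically_constant n (f : GRing.formula K) :
  GRing.qf_form f -> GRing.rformula f ->
  exists2 P : {mpoly K[n]}, P != 0 &
  exists b, forall p, P.@[p] != 0 -> GRing.qf_eval (env p) f = b.
Proof.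
have comb (op : bool -> bool -> bool) f1 f2 :
    (exists2 P : {mpoly K[n]}, P != 0 &
      exists b, forall p, P.@[p] != 0 -> GRing.qf_eval (env p) f1 = b) ->
    (exists2 P : {mpoly K[n]}, P != 0 &
      exists b, forall p, P.@[p] != 0 -> GRing.qf_eval (env p) f2 = b) ->
    exists2 P : {mpoly K[n]}, P != 0 &
      exists b, forall p, P.@[p] != 0 ->
        op (GRing.qf_eval (env p) f1) (GRing.qf_eval (env p) f2) = b.
  move=> [P1 nz1 [b1 E1]] [P2 nz2 [b2 E2]].
  exists (P1 * P2); first by rewrite mulf_neq0.
  exists (op b1 b2) => p; rewrite mevalM mulf_eq0 negb_or => /andP[/E1-> /E2->].
  by [].
elim: f => //=.
- by move=> b _ _; exists 1; [rewrite oner_neq0 | exists b].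
- move=> t1 t2 _ /andP[/(@eval_rterm_mpoly n)[Q1 E1] /(@eval_rterm_mpoly n)[Q2 E2]].
  case: (eqVneq Q1 Q2) => [eqQ|neQ].
    exists 1; first by rewrite oner_neq0.
    by exists true => p _; rewrite E1 E2 eqQ eqxx.
  exists (Q1 - Q2); first by rewrite subr_eq0.
  by exists false => p; rewrite mevalB subr_eq0 E1 E2 => /negbTE.
- move=> f1 IH1 f2 IH2 /andP[q1 q2] /andP[r1 r2].
  by apply: (comb andb); [apply: IH1|apply: IH2].
- move=> f1 IH1 f2 IH2 /andP[q1 q2] /andP[r1 r2].
  by apply: (comb orb); [apply: IH1|apply: IH2].
- move=> f1 IH1 f2 IH2 /andP[q1 q2] /andP[r1 r2].
  by apply: (comb implb); [apply: IH1|apply: IH2].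
- move=> f IH q r; have [P nz [b E]] := IH q r.
  by exists P => //; exists (~~ b) => p /E->.
Qed.

Lemma formula_generically_constant n (f : GRing.formula K) :
  GRing.rformula f ->
  exists2 P : {mpoly K[n]}, P != 0 &
    (forall p, P.@[p] != 0 -> GRing.holds (env p) f) \/
    (forall p, P.@[p] != 0 -> ~ GRing.holds (env p) f).
Proof.
move=> rf; set qf := GRing.quantifier_elim (@ClosedFieldQE.ex_elim K) f.
have axK : GRing.MathCompCompatClosedField.ClosedField.axiom K.
  by move=> k P k_gt0; apply: solve_monicpoly.
have /andP[q r] := GRing.quantifier_elim_wf (@ClosedFieldQE.wf_ex_elim K) rf.
have [P nz [b E]] := qf_generically_constant n q r.
have h p := GRing.quantifier_elim_rformP (@ClosedFieldQE.wf_ex_elim K)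
  (ClosedFieldQE.holds_ex_elim axK) (env p) rf.
exists P => //; case: b E => E; [left|right] => p /E Ep; apply/h; first exact: Ep.
by rewrite /= Ep.
Qed.

Lemma mpoly_rterm n (P : {mpoly K[n]}) : exists2 t : GRing.term K,
  GRing.rterm t & forall e, GRing.eval e t = P.@[fun i : 'I__ => e`_i].
Proof.
have prodt (F : 'I_n -> nat) (s : seq 'I_n) : exists2 t : GRing.term K,
    GRing.rterm t & forall e, GRing.eval e t = \prod_(i <- s) e`_i ^+ F i.
  elim: s => [|i s [t rt Et]].
    by exists (GRing.Const 1) => // e; rewrite big_nil.
  exists (GRing.Mul (GRing.Exp (GRing.Var K i) (F i)) t) => //= e.
  by rewrite big_cons Et.
suff [t rt Et] : exists2 t : GRing.term K, GRing.rterm t & forall e,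
    GRing.eval e t = \sum_(m <- msupp P) P@_m * \prod_(i < n) e`_i ^+ m i.
  by exists t => // e; rewrite Et mevalE.
elim: (msupp P) => [|m s [t rt Et]].
  by exists (GRing.Const 0) => // e; rewrite big_nil.
have [u ru Eu] := prodt (fun i => m i) (index_enum 'I_n).
exists (GRing.Add (GRing.Mul (GRing.Const P@_m) u) t); first by rewrite /= ru.
by move=> e; rewrite big_cons /= Et Eu.
Qed.

Lemma solvability_dichotomy n N (fs : seq {mpoly K[n + N]}) (g : {mpoly K[n + N]}) :
  let sol (p : 'I_n -> K) := exists v : 'I_(n + N) -> K,
    [/\ forall i, v (lshift N i) = p i, forall f, f \in fs -> f.@[v] = 0
      & g.@[v] != 0] in
  exists2 P : {mpoly K[n]}, P != 0 &
    (forall p, P.@[p] != 0 -> sol p) \/ (forall p, P.@[p] != 0 -> ~ sol p).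
Proof.
have [tg rg Eg] := mpoly_rterm g.
have [phi rphi Ephi] : exists2 phi : GRing.formula K, GRing.rformula phi &
    forall e, GRing.holds e phi <-> forall f, f \in fs -> f.@[fun i : 'I__ => e`_i] = 0.
  elim: fs => [|f fs [phi rphi Ephi]]; first by exists (GRing.Bool true).
  have [t rt Et] := mpoly_rterm f.
  exists (GRing.And (GRing.Equal t (GRing.Const 0)) phi); first by rewrite /= rt.
  move=> e /=; rewrite Et Ephi; split=> [[h1 h2] f'|h].
    by rewrite inE => /orP[/eqP->|/h2].
  by split=> [|f' f'fs]; apply: h; rewrite inE ?eqxx ?f'fs ?orbT.
(* The first n variables are the parameters; those numbered from n to n + N - 1 are the unknowns,
   bound one after the other. *)
pose psi := foldr GRing.Exists
  (GRing.And phi (GRing.Not (GRing.Equal tg (GRing.Const 0)))) (iota n N).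
have rpsi : GRing.rformula psi.
  by rewrite /psi; elim: (iota n N) => //=; rewrite rphi rg.
move=> sol; suff E p : GRing.holds (env p) psi <-> sol p.
  have [P nz h] := formula_generically_constant n rpsi.
  by exists P => //; case: h => h; [left|right] => p /h /E.
rewrite -GRing.foldExistsP; split=> [[e he /=]|[v [v1 v2 v3]]].
  rewrite Ephi Eg => -[h1 h2]; exists (fun i : 'I__ => e`_i); split=> // [i|]; last exact/eqP.
  by rewrite -(nth_env p) -he //= !inE mem_iota /=; case: (leqP n i) (ltn_ord i) => //; lia.
have evE (i : 'I__) : (env v)`_i = v i by rewrite nth_env.
exists (env v) => /= [k|]; last first.
  rewrite Ephi Eg (meval_eq _ evE); split; last exact/eqP.
  by move=> f /v2; rewrite (meval_eq _ evE).
rewrite !inE mem_iota negb_and -!ltnNge => /orP[lt_kn|le_k].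
  rewrite (nth_env p (Ordinal lt_kn)) -v1.
  by rewrite -(evE (lshift N (Ordinal lt_kn))).
by rewrite !env_default //; lia.
Qed.

End GenericDichotomy.

(** * Uncountability of the real numbers *)

Section Uncountable.
Variable R : realType.

(** One point cannot lie in both outer thirds of an interval, so each point of [s] costs one
    trisection. *)
Lemma subitv_avoid (s : seq R) (a b : R) : a < b ->
  exists a' b', [/\ a <= a', a' < b', b' <= b
    & forall x, x \in s -> ~~ (a' <= x <= b')].
Proof.
elim: s a b => [|y s IH] a b lt_ab; first by exists a, b.
have [a1 [b1 [le_a lt1 le_b avoid]]] := IH _ _ lt_ab.
pose d := (b1 - a1) / 3; have d_gt0 : 0 < d by rewrite divr_gt0 ?subr_gt0.
have Ed : b1 = a1 + 3 * d by rewrite /d; field.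
case: (leP y (a1 + d)) => hy.
  exists (a1 + 2 * d), b1; split=> //; [lra|lra|] => x.
  rewrite inE => /orP[/eqP->|/avoid h]; first by rewrite negb_and -!ltNge; lra.
  by apply: contra h => /andP[h1 h2]; lra.
exists a1, (a1 + d); split=> //; [lra|lra|] => x.
rewrite inE => /orP[/eqP->|/avoid h]; first by rewrite negb_and -!ltNge; lra.
by apply: contra h => /andP[h1 h2]; lra.
Qed.

(** Otherwise all fibres are finite. Choose nested intervals, the step numbered v avoiding the fibre
    over v: the supremum of the left ends lies in all of them, hence in no fibre. *)
Lemma infinite_fiber (phi : R -> nat) :
  exists v, forall L, exists s : seq R,
    [/\ uniq s, size s = L & forall x, x \in s -> phi x = v].
Proof.
suff [v infv] : exists v, infinite_set [set x | phi x = v]%classic.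
  exists v => L; have [B subB szB] := infinite_set_fset L infv.
  exists (take L (finmap.enum_fset B)); split.
  - by rewrite take_uniq ?finmap.fset_uniq.
  - by rewrite size_take; case: ltngtP szB.
  - by move=> x /mem_take xB; apply: (subB x).
apply: contrapT => /forallNP fin_all.
have /choice[s sP] : forall v, exists s : seq R, forall x, phi x = v -> x \in s.
  move=> v; have [s Es] := (finite_seqP _).1 (contrapT (fin_all v)).
  by exists s => x hx; have : [set x | phi x = v]%classic x by []; rewrite Es.
have /choice[f fP] : forall v, exists f : R * R -> R * R, forall ab,
    ab.1 < ab.2 -> [/\ ab.1 <= (f ab).1, (f ab).1 < (f ab).2, (f ab).2 <= ab.2
    & forall x, x \in s v -> ~~ ((f ab).1 <= x <= (f ab).2)].
  move=> v; suff /choice[g gP] : forall ab : R * R, exists cd : R * R, ab.1 < ab.2 ->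
      [/\ ab.1 <= cd.1, cd.1 < cd.2, cd.2 <= ab.2
        & forall x, x \in s v -> ~~ (cd.1 <= x <= cd.2)] by exists g.
  move=> [a b]; case: (ltP a b) => /= [/(subitv_avoid (s v))[a' [b' h]]|].
    by exists (a', b').
  by exists (0, 0).
pose I := fix I k := if k is j.+1 then f j (I j) else (0, 1) : R * R.
have Ilt k : (I k).1 < (I k).2.
  by elim: k => [|k IH] /=; [rewrite ltr01|have [] := fP k _ IH].
have Istep k j : (I k).1 <= (I (k + j)%N).1 /\ (I (k + j)%N).2 <= (I k).2.
  elim: j => [|j [IH1 IH2]]; first by rewrite addn0.
  rewrite addnS /=; have [h1 _ h2 _] := fP (k + j)%N _ (Ilt (k + j)%N).
  by split; [apply: le_trans h1|apply: le_trans IH2].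
pose E := [set x | exists k, x = (I k).1]%classic.
have ubE k : (ubound E (I k).2)%classic.
  move=> _ [j ->]; have [h1 _] := Istep j k; have [_ h2] := Istep k j.
  by rewrite (le_trans h1) // (le_trans _ h2) // addnC ltW.
have E0 : (E !=set0)%classic by exists (I 0).1; exists 0%N.
pose x := sup E; pose v := phi x.
have [_ _ _ /(_ x (sP v x erefl))] := fP v _ (Ilt v).
have xle : x <= (I v.+1).2 by apply: ge_sup.
have xge : (I v.+1).1 <= x.
  by apply: sup_upper_bound; [split=> //; exists (I 0).2|exists v.+1].
by rewrite [in X in ~~ X](_ : f v (I v) = I v.+1) // xle xge.
Qed.

End Uncountable.

(** * Prime ideals and the Nullstellensatz *)

Section Ideals.
Variable A : comNzRingType.

Definition is_ideal (I : set A) : Prop :=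
  [/\ I 0, forall a b, I a -> I b -> I (a + b) & forall a b, I b -> I (a * b)].

Lemma ideal_sum (I : set A) (T : Type) (r : seq T) (P : pred T) (F : T -> A) :
  is_ideal I -> (forall i, P i -> I (F i)) -> I (\sum_(i <- r | P i) F i).
Proof. by case=> I0 ID _ hF; apply: big_ind. Qed.

Lemma ideal_opp (I : set A) a : is_ideal I -> I a -> I (- a).
Proof. by case=> _ _ IM /(IM (-1)); rewrite mulN1r. Qed.

(* Krull: an ideal avoiding the powers of h is contained in a maximal such one,
   which is prime; every b outside it divides a power of h modulo it. *)
Lemma maximal_avoiding (I : set A) (h : A) :
  is_ideal I -> (forall k, ~ I (h ^+ k)) ->
  exists M : set A, [/\ is_ideal M, (I `<=` M)%classic,
    forall k, ~ M (h ^+ k),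
    forall a b, M (a * b) -> M a \/ M b
    & forall a, ~ M a -> exists b k, M (h ^+ k - a * b)].
Proof.
move=> idI avI.
pose good (X : set A) := [/\ is_ideal X, (I `<=` X)%classic & forall k, ~ X (h ^+ k)].
have [F subF totF|M [PM maxM]] := @Zorn_bigcup A (fun X => X = set0 \/ good X).
  have [allE|/existsNP[X /not_implyP[FX nX0]]] :=
    pselect (forall X, F X -> X = set0).
    by left; apply/seteqP; split=> // x [X /allE->].
  have gX : good X by case: (subF X FX).
  have goodF Y y : F Y -> Y y -> good Y.
    by move=> FY Yy; case: (subF Y FY) => // EY; rewrite EY in Yy.
  right; split; first split.
  - by exists X => //; case: gX => -[].
  - move=> a b [Y FY Ya] [Z FZ Zb].
    case: (totF Y Z FY FZ) => sub.
      by exists Z => //; have [[_ D _] _ _] := goodF _ _ FZ Zb; apply: D => //; apply: sub.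
    by exists Y => //; have [[_ D _] _ _] := goodF _ _ FY Ya; apply: D => //; apply: sub.
  - by move=> a b [Y FY Yb]; exists Y => //; have [[_ _ D] _ _] := goodF _ _ FY Yb; apply: D.
  - by move=> x Ix; exists X => //; case: gX => _ + _; apply.
  - by move=> k [Y FY Yh]; have [_ _ /(_ k)] := goodF _ _ FY Yh.
have gI : good I by split.
have gM : good M.
  case: PM => // EM; case: (maxM I); last by right.
  by rewrite EM; split=> // /(_ 0); apply; case: idI.
have [idM IM avM] := gM; have [M0 MD MM] := idM.
have maxP a : ~ M a -> exists b k, M (h ^+ k - a * b).
  move=> nMa; apply: contrapT => /forallNP nex.
  pose N := [set x | exists m b, M m /\ x = m + a * b]%classic.
  apply: (maxM N).
    split=> [x Mx|sub]; first by exists x, 0; rewrite mulr0 addr0.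
    by apply: nMa; apply: sub; exists 0, 1; rewrite mulr1 add0r.
  right; split; first split.
  - by exists 0, 0; rewrite mulr0 addr0.
  - move=> _ _ [m [b [Mm ->]]] [m' [b' [Mm' ->]]].
    by exists (m + m'), (b + b'); split; [apply: MD|rewrite mulrDr addrACA].
  - move=> c _ [m [b [Mm ->]]]; exists (c * m), (c * b).
    by split; [apply: (MM)|rewrite mulrDr mulrCA].
  - by move=> x /IM Mx; exists x, 0; rewrite mulr0 addr0.
  - move=> k [m [b [Mm Ek]]]; case: (nex b); exists k.
    by rewrite Ek addrK.
exists M; split=> // a b Mab.
case: (pselect (M a)) => [|/maxP[c [k Mc]]]; [by left|right].
(* Modulo [M], [h ^+ k] is [a * c] and [h ^+ l] is [b * d], so the product of the two powers is a
   multiple of [a * b] and would lie in [M]. *)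
apply: contrapT => /maxP[d [l Md]]; apply: (avM (k + l)%N).
have -> : h ^+ (k + l) = h ^+ l * (h ^+ k - a * c) + (a * c * (h ^+ l - b * d)
    + c * d * (a * b)) by rewrite exprD; ring.
by apply: (MD); [|apply: (MD)]; apply: (MM).
Qed.

End Ideals.

Section Nullstellensatz.
Variables (R : realType) (n : nat).
Local Notation C := R[i].
Local Notation A := {mpoly C[n]}.

Lemma bounded_mpoly_dependent (D L : nat) (b : 'I_L -> A) :
  (forall j, msize (b j) <= D)%N -> (#|{: 'X_{1..n < D}}| < L)%N ->
  exists2 u : 'I_L -> C, (exists j, u j != 0) & \sum_j u j *: b j = 0.
Proof.
move=> szb ltL; pose T : finType := 'X_{1..n < D}.
pose M : 'M[C]_(L, #|T|) := \matrix_(j, t) (b j)@_(enum_val t : T).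
have kn0 : kermx M != 0.
  by rewrite -mxrank_eq0 mxrank_ker subn_eq0 -ltnNge (leq_ltn_trans (rank_leq_col M)).
have /rowV0Pn[u /sub_kermxP uM0 u0] := kn0.
exists (fun j => u 0 j).
  apply: contrapT => /forallNP h; case/eqP: u0; apply/rowP => j; rewrite mxE.
  by apply/eqP; have /negP := h j; rewrite negbK.
apply/mpolyP => m; rewrite mcoeff0 raddf_sum /=.
case: (ltnP (mdeg m) D) => [ltmD|leDm]; last first.
  apply: big1 => j _; rewrite mcoeffZ memN_msupp_eq0 ?mulr0 //.
  by apply/negP => /msize_mdeg_lt; rewrite ltnNge (leq_trans (szb j)).
have /rowP/(_ (enum_rank (BMultinom ltmD))) := uM0; rewrite !mxE => {2}<-.
by apply: eq_bigr => j _; rewrite mcoeffZ !mxE enum_rankK.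
Qed.

Let ev (i : 'I_n) (q : {poly C}) : A := (map_poly (@mpolyC n C) q).['X_i].

Let evM i : {morph ev i : p q / p * q}.
Proof. by move=> p q; rewrite /ev rmorphM hornerM. Qed.

Let evC i c : ev i c%:P = c%:MP.
Proof. by rewrite /ev map_polyC hornerC. Qed.

Let evXsubC i c : ev i ('X - c%:P) = 'X_i - c%:MP.
Proof. by rewrite /ev rmorphB /= map_polyX map_polyC hornerD hornerN hornerX hornerC. Qed.

Let ev_prod i (T : Type) (r : seq T) (P : pred T) F :
  ev i (\prod_(t <- r | P t) F t) = \prod_(t <- r | P t) ev i (F t).
Proof. by rewrite /ev rmorph_prod horner_prod. Qed.

Let ev_sum i (T : Type) (r : seq T) (P : pred T) F :
  ev i (\sum_(t <- r | P t) F t) = \sum_(t <- r | P t) ev i (F t).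
Proof. by rewrite /ev rmorph_sum horner_sum. Qed.

(* Each variable is algebraic modulo a maximal ideal: otherwise the inverses of
   the uncountably many X_i - c would be linearly independent in a space of
   countable dimension. *)
Lemma nullstellensatz (I : set A) (h : A) :
  is_ideal I -> (forall k, ~ I (h ^+ k)) ->
  exists v : 'I_n -> C, (forall f, I f -> f.@[v] = 0) /\ h.@[v] != 0.
Proof.
move=> idI avI.
have [M [idM IM avM primeM maxM]] := maximal_avoiding idI avI.
have [M0 MD MM] := idM.
have constM c : M c%:MP -> c = 0.
  move=> Mc; apply/eqP/negPn/negP => c0; apply: (avM 0%N).
  by rewrite expr0 -mpolyC1 -(mulVf c0) mpolyCM; apply: (MM).
have /choice[v vP] : forall i : 'I_n, exists c, M ('X_i - c%:MP).
  move=> i; apply: contrapT => /forallNP nroot.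
  have /choice[bk bkP] : forall x : R, exists bk : A * nat,
      M (h ^+ bk.2 - ('X_i - (x%:C)%C%:MP) * bk.1).
    by move=> x; have [b [k ?]] := maxM _ (nroot (x%:C)%C); exists (b, k).
  (* Colouring each real x by the size of its chosen inverse and by the exponent of h gives
     arbitrarily many inverses of bounded degree, all with the same power of h. *)
  have [w infw] := infinite_fiber (fun x => pickle (msize (bk x).1, (bk x).2)).
  have [s1 [_ s1sz s1w]] := infw 1%N.
  case: s1 s1sz s1w => // x0 [] // _ /(_ x0 (mem_head _ _)) x0w.
  pose D := msize (bk x0).1; pose k := (bk x0).2.
  have fib x : pickle (msize (bk x).1, (bk x).2) = w ->
      msize (bk x).1 = D /\ (bk x).2 = k.
    by rewrite -x0w => /(pcan_inj pickleK)[].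
  pose L := #|{: 'X_{1..n < D}}|.+1.
  have [s [us szs sw]] := infw L.
  pose c (j : 'I_L) := s`_j; pose b j := (bk (c j)).1.
  have cs j : c j \in s by rewrite mem_nth // szs.
  have c_inj : injective c.
    by move=> j1 j2 /eqP; rewrite nth_uniq ?szs // => /eqP/val_inj.
  have szb j : (msize (b j) <= D)%N by have [-> ] := fib _ (sw _ (cs j)).
  have [u [j0 uj0] dep] := bounded_mpoly_dependent szb (ltnSn _).
  (* The numerator of the relation sum_j u_j / (X_i - c_j) = 0 between the inverses; its value at
     c_j0 is u_j0 times a nonzero product. *)
  pose q := \sum_j u j *: \prod_(l < L | l != j) ('X - ((c l)%:C)%C%:P).
  have q0 : q != 0.
    apply/eqP => /(congr1 (fun p => p.[((c j0)%:C)%C])); rewrite horner0 horner_sum.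
    rewrite (bigD1 j0) //= [X in _ + X]big1 ?addr0 => [|j jj0].
      rewrite hornerZ horner_prod => /eqP; rewrite mulf_eq0 (negbTE uj0) /=.
      rewrite prodf_seq_eq0 => /hasP[l _ /andP[lj0]].
      rewrite hornerXsubC subr_eq0 => /eqP/complexI/c_inj E.
      by rewrite E eqxx in lj0.
    rewrite hornerZ horner_prod (bigD1 j0) 1?eq_sym //= hornerXsubC subrr.
    by rewrite mul0r mulr0.
  have Mq : M (ev i q).
    suff : M (h ^+ k * ev i q) by case/primeM => // /(avM _).
    pose w' j := 'X_i - ((c j)%:C)%C%:MP : A.
    have -> : h ^+ k * ev i q =
        \sum_j (u j)%:MP * (\prod_(l < L | l != j) w' l) * (h ^+ k - w' j * b j).
      transitivity (\sum_j (u j)%:MP * (\prod_(l < L | l != j) w' l) * h ^+ k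
          - (\prod_(l < L) w' l) * \sum_j u j *: b j); last first.
        rewrite mulr_sumr -sumrB; apply: eq_bigr => j _.
        rewrite [in X in _ - X](bigD1 j) //= -mul_mpolyC; ring.
      rewrite dep mulr0 subr0 /q ev_sum mulr_sumr; apply: eq_bigr => j _.
      rewrite -mul_polyC evM evC ev_prod mulrC; congr (_ * _ * _).
      by apply: eq_bigr => l _; rewrite evXsubC.
    apply: (ideal_sum _ idM) => j _; apply: (MM).
    by have := bkP (c j); have [_ ->] := fib _ (sw _ (cs j)).
  (* As q splits and [M] is prime, [M] contains either a nonzero constant or some X_i - z, and both
     are excluded. *)
  have [rs Eq] := closed_field_poly_normal q.
  have : M (ev i (\prod_(z <- rs) ('X - z%:P))).
    move: Mq; rewrite Eq -mul_polyC evM evC => /primeM[] // /constM /eqP.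
    by rewrite lead_coef_eq0 (negbTE q0).
  elim: rs {Eq} => [|z rs IH].
    by rewrite big_nil -[1]/(1%:P) evC => /constM/eqP; rewrite oner_eq0.
  by rewrite big_cons evM evXsubC => /primeM[/nroot|/IH].
have evalM (f : A) : M (f - f.@[v]%:MP).
  elim/mpolyind: f => [|a m f _ _ IH].
    by rewrite meval0 mpolyC0 subr0.
  rewrite mevalD mevalZ mpolyCD opprD addrACA; apply: (MD) => //.
  rewrite mpolyCM -mul_mpolyC -mulrBr; apply: (MM).
  rewrite mevalX mpolyXE_id; elim/big_ind2: _ => [|c1 p1 c2 p2 h1 h2|i _].
  - by rewrite mpolyC1 subrr.
  - rewrite mpolyCM (_ : _ - _ = p1 * (p2 - c2%:MP) + c2%:MP * (p1 - c1%:MP)); last by ring.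
    by apply: (MD); apply: (MM).
  - by rewrite rmorphXn /= subrXX mulrC; apply: (MM).
exists v; split=> [f /IM Mf|].
  apply: constM; rewrite (_ : _%:MP = f + - (f - f.@[v]%:MP)); last by ring.
  by apply: (MD) => //; apply: ideal_opp.
apply/eqP => hv0; apply: (avM 1%N); rewrite expr1.
by have := evalM h; rewrite hv0 mpolyC0 subr0.
Qed.

End Nullstellensatz.

Lemma mpoly_alg_ind (K : comNzRingType) n (P : {mpoly K[n]} -> Prop) :
  (forall c, P c%:MP) -> (forall i, P 'X_i) ->
  (forall p q, P p -> P q -> P (p + q)) ->
  (forall p q, P p -> P q -> P (p * q)) -> forall p, P p.
Proof.
move=> PC PX PD PM; elim/mpolyind=> [|a m p _ _ IH]; first by rewrite -mpolyC0.
apply: (PD) => //; rewrite -mul_mpolyC; apply: (PM) => //.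
rewrite mpolyXE_id; apply: (big_ind P) => [||i _] //.
  by rewrite -mpolyC1.
elim: (m i) => [|k IHk]; first by rewrite expr0 -mpolyC1.
by rewrite exprS; apply: (PM).
Qed.

(** * Density of the parameters near an étale solution *)

Section Etale.
Variables (R : realType) (n N : nat).
Local Notation C := R[i].
Local Notation A := {mpoly C[n + N]}.

Definition emb_def (Q : {mpoly C[n]}) : A := Q \mPo [tuple 'X_(lshift N i) | i < n].
Definition emb := locked emb_def.

Lemma embC c : emb c%:MP = c%:MP.
Proof. by rewrite /emb -lock /emb_def comp_mpolyC. Qed.

Lemma embX i : emb 'X_i = 'X_(lshift N i).
Proof. by rewrite /emb -lock /emb_def comp_mpolyXU -tnth_nth tnth_mktuple. Qed.

Lemma embD : {morph emb : p q / p + q}.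
Proof. by move=> p q; rewrite /emb -lock /emb_def rmorphD. Qed.

Lemma embM : {morph emb : p q / p * q}.
Proof. by move=> p q; rewrite /emb -lock /emb_def rmorphM. Qed.

Lemma emb_eval Q v : (emb Q).@[v] = Q.@[fun i => v (lshift N i)].
Proof.
elim/mpoly_alg_ind: Q => [c|i|p q Ep Eq|p q Ep Eq].
- by rewrite embC !mevalC.
- by rewrite embX !mevalXU.
- by rewrite embD !mevalD Ep Eq.
- by rewrite embM !mevalM Ep Eq.
Qed.

Lemma mderiv_X (K : comNzRingType) k (i j : 'I_k) :
  ('X_j : {mpoly K[k]})^`M(i) = (i == j)%:R.
Proof.
rewrite mderivX mnm1E eq_sym; case: eqP => [->|_]; last by rewrite scale0r.
by rewrite (_ : U_(j) - U_(j) = 0)%MM ?mpolyX0 ?scale1r //; apply/mnmP => l;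
  rewrite mnmBE mnm0E subnn.
Qed.

Lemma emb_derivl i Q : (emb Q)^`M(lshift N i) = emb Q^`M(i).
Proof.
elim/mpoly_alg_ind: Q => [c|j|p q Ep Eq|p q Ep Eq].
- by rewrite embC !mderivC -mpolyC0 embC.
- by rewrite embX !mderiv_X (inj_eq (@lshift_inj _ _)) -!mpolyC_nat embC.
- by rewrite embD !mderivD Ep Eq embD.
- by rewrite embM !mderivM Ep Eq embD !embM.
Qed.

Lemma emb_derivr k Q : (emb Q)^`M(rshift n k) = 0.
Proof.
elim/mpoly_alg_ind: Q => [c|j|p q Ep Eq|p q Ep Eq].
- by rewrite embC !mderivC.
- by rewrite embX !mderiv_X eq_rlshift.
- by rewrite embD !mderivD Ep Eq addr0.
- by rewrite embM !mderivM Ep Eq mul0r mulr0 addr0.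
Qed.

(** Characteristic 0 enters here: a coefficient reappears in a derivative multiplied by a positive
    exponent. *)
Lemma mderiv_const (Q : {mpoly C[n]}) : (forall i, Q^`M(i) = 0) -> Q = (Q@_0%MM)%:MP.
Proof.
move=> dQ; apply/mpolyP => m; rewrite mcoeffC.
case: (eqVneq 0%MM m) => [<-|m0]; first by rewrite mulr1.
have [i mi] : exists i, m i != 0%N.
  apply: contrapT => /forallNP h; case/eqP: m0; apply/mnmP => i; rewrite mnm0E.
  by have /negP := h i; rewrite negbK => /eqP.
have /mpolyP/(_ (m - U_(i))%MM) := dQ i.
rewrite mulr0 mcoeff_deriv mcoeff0 submK ?lep1mP // => /eqP.
by rewrite -mulr_natr mulf_eq0 pnatr_eq0 orbF => /eqP.
Qed.

Variables (f : 'I_N -> A) (g : A) (v0 : 'I_(n + N) -> C).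
Hypothesis f0 : forall l, (f l).@[v0] = 0.
Hypothesis g0 : g.@[v0] != 0.
Hypothesis jac0 : forall w : 'I_N -> C,
  (forall l, \sum_k w k * ((f l)^`M(rshift n k)).@[v0] = 0) -> forall k, w k = 0.

(** Cramer's rule over the polynomial ring: [Delta] is the Jacobian determinant in the unknowns, and
    the adjugate solves the linear system up to the factor [Delta]. *)
Lemma tangent_coefficients : exists (Delta : A) (b : 'I_n -> 'I_N -> A),
  Delta.@[v0] != 0 /\ forall i l,
    \sum_k b i k * (f l)^`M(rshift n k) = Delta * (f l)^`M(lshift N i).
Proof.
pose Jac : 'M[A]_N := \matrix_(k, l) (f l)^`M(rshift n k).
exists (\det Jac), (fun i k => ((\row_l (f l)^`M(lshift N i)) *m \adj Jac) 0 k).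
split=> [|i l]; last first.
  have : (\row_l (f l)^`M(lshift N i)) *m \adj Jac *m Jac =
      \det Jac *: (\row_l (f l)^`M(lshift N i)).
    by rewrite -mulmxA mul_adj_mx mul_mx_scalar.
  move: (\det Jac) (_ *m \adj Jac) => Delta b /rowP/(_ l).
  rewrite [LHS]mxE [RHS]mxE [X in _ = _ * X]mxE => <-.
  by apply: eq_bigr => k _; rewrite [X in _ = _ * X]mxE.
rewrite -(det_map_mx (meval v0)) -unitfE -unitmxE -row_free_unit -kermx_eq0.
apply/eqP/row_matrixP => i; apply/rowP => k; rewrite row0 [RHS]mxE.
have /sub_kermxP := row_sub i (kermx (map_mx (meval v0) Jac)).
move: (row i _) => u uJ; apply: (@jac0 (fun k => u 0 k)) => l.
have /rowP/(_ l) := uJ; rewrite !mxE => uJl; rewrite -[RHS]uJl.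
by apply: eq_bigr => k' _; rewrite !mxE.
Qed.

Variables (Delta : A) (b : 'I_n -> 'I_N -> A).
Hypothesis Delta0 : Delta.@[v0] != 0.
Hypothesis bE : forall i l,
  \sum_k b i k * (f l)^`M(rshift n k) = Delta * (f l)^`M(lshift N i).

(* Delta * d/dp_i, lifted to a derivation tangent to {f = 0}. *)
Let theta i (h : A) : A :=
  Delta * h^`M(lshift N i) - \sum_k b i k * h^`M(rshift n k).

Let theta_f i l : theta i (f l) = 0.
Proof. by rewrite /theta bE subrr. Qed.

Let thetaM i p q : theta i (p * q) = theta i p * q + p * theta i q.
Proof.
rewrite /theta mderivM.
have -> : \sum_k b i k * (p * q)^`M(rshift n k) =
    (\sum_k b i k * p^`M(rshift n k)) * q + p * \sum_k b i k * q^`M(rshift n k).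
  rewrite mulr_suml mulr_sumr -big_split; apply: eq_bigr => k _ /=.
  by rewrite mderivM; move: (b i k) (p^`M(_)) (q^`M(_)) => x p' q'; ring.
by move: (\sum_k _) (\sum_k _) (p^`M(_)) (q^`M(_)) => x y p' q'; ring.
Qed.

Let theta_sum i (T : Type) (r : seq T) (F : T -> A) :
  theta i (\sum_(t <- r) F t) = \sum_(t <- r) theta i (F t).
Proof.
elim: r => [|t r IH].
  rewrite !big_nil /theta !linear0 mulr0 sub0r big1 ?oppr0 // => k _.
  by rewrite linear0 mulr0.
rewrite !big_cons -IH /theta mderivD mulrDr.
have -> : \sum_k b i k * (F t + \sum_(j <- r) F j)^`M(rshift n k) =
    \sum_k b i k * (F t)^`M(rshift n k)
    + \sum_k b i k * (\sum_(j <- r) F j)^`M(rshift n k).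
  by rewrite -big_split; apply: eq_bigr => k _; rewrite mderivD mulrDr.
by rewrite opprD addrACA.
Qed.

Let inF (h : A) := exists a : 'I_N -> A, h = \sum_l a l * f l.

Let inFD h1 h2 : inF h1 -> inF h2 -> inF (h1 + h2).
Proof.
move=> [a1 ->] [a2 ->]; exists (fun l => a1 l + a2 l).
by rewrite -big_split; apply: eq_bigr => l _; rewrite mulrDl.
Qed.

Let inFM c h : inF h -> inF (c * h).
Proof.
move=> [a ->]; exists (fun l => c * a l).
by rewrite mulr_sumr; apply: eq_bigr => l _; rewrite mulrA.
Qed.

Let inF_theta i h : inF h -> inF (theta i h).
Proof.
move=> [a ->]; exists (fun l => theta i (a l)); rewrite theta_sum.
by apply: eq_bigr => l _; rewrite thetaM theta_f mulr0 addr0.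
Qed.

Let G := g * Delta.
(** Membership must survive division by [Delta], to pass from Delta * d/dp_i to d/dp_i, and by [g],
    which has to stay nonzero at the solution found. *)
Let J (h : A) := exists j, inF (G ^+ j * h).

Let J_ideal : is_ideal (J : set A).
Proof.
split=> [|h1 h2 [j1 F1] [j2 F2]|c h [j Fh]].
- by exists 0%N, (fun=> 0); rewrite mulr0 big1 // => l _; rewrite mul0r.
- exists (j1 + j2)%N; rewrite mulrDr exprD; apply: inFD.
    by rewrite (mulrC (G ^+ j1)) -mulrA; apply: inFM.
  by rewrite -mulrA; apply: inFM.
- by exists j; rewrite mulrCA; apply: inFM.
Qed.

Let J_eval h : J h -> h.@[v0] = 0.
Proof.
move=> [j [a /(congr1 (meval v0))]]; rewrite mevalM rmorphXn rmorph_sum /=.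
rewrite big1 => [|l _]; last by rewrite mevalM f0 mulr0.
move/eqP; rewrite mulf_eq0 expf_eq0 /G mevalM mulf_eq0 (negbTE g0) (negbTE Delta0).
by rewrite andbF => /eqP.
Qed.

Let J_saturated c h : (exists c', c * c' = G) -> J (c * h) -> J h.
Proof.
move=> [c' Ec] [j Fh]; exists j.+1; rewrite exprSr.
move: (G ^+ j) Fh => x Fx; rewrite -Ec.
by rewrite (_ : _ * h = c' * (x * (c * h))); [apply: inFM|ring].
Qed.

(** By the Leibniz rule, [theta i (G ^+ j * h)] differs from [G ^+ j * theta i h] by a multiple of
    [h]; a second factor [G ^+ j] brings that term into the ideal. *)
Let J_theta i h : J h -> J (theta i h).
Proof.
move=> [j Fh]; exists (j + j)%N.
rewrite (_ : _ * _ = G ^+ j * theta i (G ^+ j * h) + (- theta i (G ^+ j)) * (G ^+ j * h)).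
  by apply: inFD; apply: inFM => //; apply: inF_theta.
rewrite thetaM exprD; move: (theta i (G ^+ j)) (theta i h) => x y; move: (G ^+ j) => z; ring.
Qed.

(** Differentiation lowers the degree, so by induction all derivatives of [Q] vanish and [Q] is
    constant. Elements of [J] vanish at [v0], so this constant is 0. *)
Let J_emb Q : J (emb Q) -> Q = 0.
Proof.
elim/ltn_ind: {Q}(msize Q) {-2}Q (erefl (msize Q)) => k IH Q szQ JQ.
case: (eqVneq Q 0) => // Q0.
have dQ i : Q^`M(i) = 0.
  apply: (IH (msize Q^`M(i))) => //.
    rewrite -szQ [X in (X < _)%N]msizeE big_seq.
    have : (0 < msize Q)%N by rewrite lt0n msize_poly_eq0.
    case E : (msize Q) => [//|s] _; rewrite ltnS; apply/bigmax_leqP_seq => m.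
    rewrite -[m \in _]negbK -mcoeff_eq0 mcoeff_deriv => + _.
    rewrite -mulr_natr mulf_eq0 negb_or => /andP[+ _].
    rewrite mcoeff_eq0 negbK => /msize_mdeg_lt.
    by rewrite E mdegD mdeg1 addn1 ltnS.
  apply: (@J_saturated Delta); first by exists g; rewrite mulrC.
  have := J_theta i JQ; rewrite /theta emb_derivl big1 ?subr0 // => k' _.
  by rewrite emb_derivr mulr0.
move: (J_eval JQ); rewrite (mderiv_const dQ) embC mevalC => ->.
by rewrite mpolyC0.
Qed.

Lemma etale_dense (P : {mpoly C[n]}) : P != 0 ->
  exists v : 'I_(n + N) -> C, [/\ forall l, (f l).@[v] = 0, g.@[v] != 0
    & P.@[fun i => v (lshift N i)] != 0].
Proof.
move=> P0; have [k|v [Jv]] := @nullstellensatz R _ J (emb P * G) J_ideal.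
  rewrite exprMn mulrC => JPG.
  have : J (emb (P ^+ k)).
    suff <- : emb P ^+ k = emb (P ^+ k).
      case: JPG => j Fj; exists (j + k)%N.
      by rewrite exprD -mulrA.
    by rewrite /emb -lock /emb_def rmorphXn.
  by move=> /J_emb /eqP; rewrite expf_eq0 (negbTE P0) andbF.
rewrite mevalM /G mevalM emb_eval !mulf_eq0 !negb_or => /and3P[Pv gv _].
exists v; split=> // l; apply: Jv; exists 0%N, (fun l' => (l == l')%:R).
rewrite mul1r (bigD1 l) //= eqxx mul1r big1 ?addr0 // => l' ne.
by rewrite eq_sym (negbTE ne) mul0r.
Qed.

End Etale.

Section GenericSolvability.
Variables (R : realType) (n N : nat).
Local Notation C := R[i].

Lemma generically_solvable (f : 'I_N -> {mpoly C[n + N]}) (g : {mpoly C[n + N]})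
    (v0 : 'I_(n + N) -> C) :
  (forall l, (f l).@[v0] = 0) -> g.@[v0] != 0 ->
  (forall w : 'I_N -> C,
    (forall l, \sum_k w k * ((f l)^`M(rshift n k)).@[v0] = 0) -> forall k, w k = 0) ->
  exists2 P : {mpoly C[n]}, P != 0 & forall p, P.@[p] != 0 ->
    exists v : 'I_(n + N) -> C,
    [/\ forall i, v (lshift N i) = p i, forall l, (f l).@[v] = 0 & g.@[v] != 0].
Proof.
move=> f0 g0 jac0.
have [P P0 [sol|nsol]] := solvability_dichotomy [seq f l | l <- enum 'I_N] g.
  exists P => // p /sol[v [v1 v2 v3]]; exists v; split=> // l.
  by apply: v2; apply: map_f; rewrite mem_enum.
have [Delta [b [Delta0 bE]]] := tangent_coefficients jac0.
have [v [fv gv Pv]] := etale_dense f0 g0 Delta0 bE P0.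
case: (nsol _ Pv); exists v; split=> // _ /mapP[l _ ->]; exact: fv.
Qed.

End GenericSolvability.

(** * Very general configurations *)

Section VeryGeneral.

Lemma very_general_and (K : fieldType) r (P Q : 'M[K]_(r, 3) -> Prop) :
  very_general P -> very_general Q -> very_general (fun p => P p /\ Q p).
Proof.
move=> [Z [Zc ZP]] [Y [Yc YQ]].
exists (fun n => if odd n then Z n./2 else Y n./2).
split=> [n|p cp h]; first by case: ifP.
split; [apply: ZP|apply: YQ] => // n.
  by have := h n.*2.+1; rewrite /= odd_double /= uphalf_double.
by have := h n.*2; rewrite odd_double doubleK.
Qed.

Lemma very_general_mono (K : fieldType) r (P Q : 'M[K]_(r, 3) -> Prop) :
  (forall p, is_config p -> P p -> Q p) -> very_general P -> very_general Q.
Proof. by move=> PQ [Z [Zc ZP]]; exists Z; split=> // p cp /ZP/PQ; apply. Qed.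

Variables (R : realType) (r : nat).
Local Notation C := R[i].

(** The Nullstellensatz for the zero ideal. Multiplying by all variables puts the point in the
    torus, so that it can serve as a vector of row scalings or as a configuration with nonzero
    rows. *)
Lemma mpoly_nonvanishing n (P : {mpoly C[n]}) : P != 0 ->
  exists v : 'I_n -> C, (forall i, v i != 0) /\ P.@[v] != 0.
Proof.
move=> P0; have [|k|v [_]] := @nullstellensatz R n (fun h => h = 0) (P * \prod_i 'X_i).
- by split=> // [a b -> ->|a b ->]; rewrite ?addr0 ?mulr0.
- apply/eqP; rewrite expf_eq0 mulf_eq0 (negbTE P0) /= prodf_seq_eq0.
  apply/negP => /andP[_ /hasP[i _ /andP[_ /eqP/(congr1 (mcoeff U_(i)))]]].
  by rewrite mcoeffX eqxx mcoeff0 => /eqP; rewrite oner_eq0.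
rewrite mevalM rmorph_prod mulf_eq0 negb_or => /andP[Pv /prodf_neq0 Xv].
by exists v; split=> // i; have := Xv i isT; rewrite /= mevalXU.
Qed.

Definition multidegree (m : 'X_{1..(r * 3)}) : 'X_{1..r} :=
  [multinom (\sum_(j < 3) m (mxvec_index i j))%N | i < r].

Definition multidegree_part (e : 'X_{1..r}) (P : {mpoly C[r * 3]}) :
    {mpoly C[r * 3]} :=
  \sum_(m <- msupp P | multidegree m == e) P@_m *: 'X_[m].

Lemma mcoeff_multidegree_part e P m :
  (multidegree_part e P)@_m = if multidegree m == e then P@_m else 0.
Proof.
rewrite /multidegree_part raddf_sum /=.
case: (boolP (m \in msupp P)) => [mP|mP]; last first.
  rewrite (memN_msupp_eq0 mP) if_same big_seq_cond big1 // => m' /andP[m'P _].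
  rewrite mcoeffZ mcoeffX; case: eqP => [E|_]; last by rewrite mulr0.
  by rewrite -E m'P in mP.
rewrite big_mkcond (bigD1_seq m) ?msupp_uniq //= big1 ?addr0 => [|m' ne].
  by case: ifP => // _; rewrite mcoeffZ mcoeffX eqxx mulr1.
by case: ifP => // _; rewrite mcoeffZ mcoeffX (negbTE ne) mulr0.
Qed.

Definition scale_rows (c : 'I_r -> C) (p : 'M[C]_(r, 3)) : 'M[C]_(r, 3) :=
  \matrix_(i, j) (c i * p i j).

Local Notation pt p := (fun k => mxvec p 0 k).

Lemma prod_mxvec_index (F : 'I_(r * 3) -> C) :
  \prod_k F k = \prod_(i < r) \prod_(j < 3) F (mxvec_index i j).
Proof.
rewrite pair_big /= (reindex _ (curry_mxvec_bij r 3)) /=.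
by apply: eq_bigr => -[].
Qed.

(** Scaling row i by c_i multiplies the part of multidegree e by c^e, so one polynomial in c records
    the values at p of all multidegree parts. *)
Lemma scaled_value (P : {mpoly C[r * 3]}) (p : 'M[C]_(r, 3)) :
  exists2 Phi : {mpoly C[r]},
    (forall c, Phi.@[c] = P.@[pt (scale_rows c p)]) &
    forall e, Phi@_e = (multidegree_part e P).@[pt p].
Proof.
exists (\sum_(m <- msupp P) (P@_m * \prod_k (mxvec p 0 k) ^+ m k) *: 'X_[multidegree m]).
  move=> c; rewrite [in RHS]mevalE rmorph_sum; apply: eq_bigr => m _ /=.
  rewrite mevalZ mevalX -mulrA; congr (_ * _).
  rewrite !prod_mxvec_index -big_split; apply: eq_bigr => i _ /=.
  rewrite mnmE expr_sum -big_split; apply: eq_bigr => j _ /=.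
  by rewrite !mxvecE mxE exprMn mulrC.
move=> e; rewrite raddf_sum /multidegree_part rmorph_sum [RHS]big_mkcond /=.
apply: eq_bigr => m _; rewrite mcoeffZ mcoeffX mevalZ mevalX.
by case: eqP; rewrite ?mulr1 ?mulr0.
Qed.

(** The vanishing of [P] depends on the chosen homogeneous coordinates; that of all its multidegree
    parts does not. If one part is nonzero at p, then [P] is nonzero at some rescaling of the rows,
    and this is why [Q p] is to be deduced from a rescaling. *)
Lemma very_general_of_poly (P : {mpoly C[r * 3]}) (Q : 'M[C]_(r, 3) -> Prop) :
  P != 0 ->
  (forall p c, is_config p -> (forall i, c i != 0) ->
     P.@[pt (scale_rows c p)] != 0 -> Q p) ->
  very_general Q.
Proof.
move=> P0 hQ; pose Z : {mpoly C[r * 3]} -> Prop := fun G => exists e, G = multidegree_part e P.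
exists (fun=> Z); split=> [_|p cp /(_ 0%N) nZ].
  split=> [_ [e ->]|].
    exists e => m; rewrite -[m \in _]negbK -mcoeff_eq0 mcoeff_multidegree_part.
    by case: (eqVneq (multidegree m) e) => [<- _ i|_]; rewrite ?eqxx // mnmE.
  have [v [v0 Pv]] := mpoly_nonvanishing P0.
  pose p : 'M[C]_(r, 3) := \matrix_(i, j) v (mxvec_index i j).
  have ptp : pt p =1 v.
    by move=> k; case/mxvec_indexP: k => i j; rewrite mxvecE mxE.
  exists p; split=> [i|zP].
    apply/eqP => /rowP/(_ 0); rewrite !mxE => /eqP.
    by rewrite (negbTE (v0 _)).
  have [Phi E1 E2] := scaled_value P p.
  case/eqP: Pv; rewrite -(meval_eq _ ptp).
  have -> : P.@[pt p] = Phi.@[fun=> 1].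
    rewrite E1; apply: meval_eq => k; congr (mxvec _ 0 k).
    by apply/matrixP => i j; rewrite [RHS]mxE mul1r.
  suff -> : Phi = 0 by rewrite meval0.
  by apply/mpolyP => e; rewrite E2 mcoeff0 zP //; exists e.
have [Phi E1 E2] := scaled_value P p.
have Phi0 : Phi != 0.
  apply/eqP => Phi0; apply: nZ => _ [e ->].
  by rewrite -E2 Phi0 mcoeff0.
have [c [c0 Pc]] := mpoly_nonvanishing Phi0.
by apply: (hQ p c) => //; rewrite -E1.
Qed.

End VeryGeneral.

(** * Orders of vanishing and Taylor coefficients *)

Section Order.
Variables (K : fieldType) (n : nat).
Implicit Types G H : {mpoly K[n]}.

Lemma ord0_geP G k : G != 0 ->
  reflect (forall m, m \in msupp G -> (k <= mdeg m)%N) (k <= ord0_mpoly G)%N.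
Proof.
move=> G0; rewrite /ord0_mpoly.
have E x (s : seq 'X_{1..n}) : (k <= \big[minn/x]_(m <- s) mdeg m)%N =
    (k <= x)%N && all (fun m => k <= mdeg m)%N s.
  elim: s => [|m s IH]; first by rewrite big_nil andbT.
  by rewrite big_cons leq_min IH /= andbCA.
rewrite E; apply: (iffP andP) => [[_ /allP//]|h]; split; last exact/allP.
have /h : mlead G \in msupp G by apply: mlead_supp.
move=> h1; apply: leq_trans h1 _.
by rewrite ltnW // msize_mdeg_lt // mlead_supp.
Qed.

Lemma ord0_mlast G : G != 0 -> ord0_mpoly G = mdeg (mlast G).
Proof.
move=> G0; apply/eqP; rewrite eqn_leq; apply/andP; split.
  by apply: (elimT (ord0_geP _ G0) (leqnn _)); apply: mlast_supp.
by apply/(ord0_geP _ G0) => m /mlast_lemc/lemc_mdeg.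
Qed.

(** The two smallest monomials multiply without cancellation. As the monomial order refines the
    degree, this makes the order of vanishing additive. *)
Lemma mlastM G H : G != 0 -> H != 0 -> mlast (G * H) = (mlast G + mlast H)%MM.
Proof.
move=> G0 H0; have lowP m : m \in msupp (G * H) -> ((mlast G + mlast H)%MM <= m)%O.
  move/msuppM_le/allpairsP => [[m1 m2] /= [m1G m2H ->]].
  by apply: lem_add; apply: mlast_lemc.
apply: mlastE => //; rewrite -[_ \in _]negbK -mcoeff_eq0.
set m := (mlast G + mlast H)%MM.
have dG : (mdeg (mlast G) < (mdeg m).+1)%N by rewrite ltnS mdegD leq_addr.
have dH : (mdeg (mlast H) < (mdeg m).+1)%N by rewrite ltnS mdegD leq_addl.
rewrite mcoeffM (bigD1 (BMultinom dG, BMultinom dH)) //= big1 ?addr0.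
  by rewrite mulf_neq0 ?mcoeff_eq0 ?negbK ?mlast_supp.
move=> [[m1 h1] [m2 h2]] /= /andP[/eqP Em ne].
apply/eqP; rewrite mulf_eq0 !mcoeff_eq0 -negb_and; apply/negP => /andP[m1G m2H].
case/negP: ne.
have l1 := mlast_lemc m1G; have l2 := mlast_lemc m2H.
case: (eqVneq m1 (mlast G)) => [E1|n1].
  have E2 : m2 = mlast H by move: Em; rewrite /m E1 => /eqP; rewrite eqm_add2l => /eqP.
  by apply/eqP; congr pair; apply: val_inj.
have lt1 : (mlast G < m1)%O by rewrite lt_neqAle eq_sym n1.
by have := ltmc_le_add lt1 l2; rewrite -Em ltxx.
Qed.

Lemma ord0M G H : G != 0 -> H != 0 ->
  ord0_mpoly (G * H) = (ord0_mpoly G + ord0_mpoly H)%N.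
Proof.
by move=> G0 H0; rewrite !ord0_mlast ?mulf_neq0 // mlastM // mdegD.
Qed.

Lemma ord0C c : c != 0 -> ord0_mpoly (c%:MP : {mpoly K[n]}) = 0%N.
Proof.
move=> c0; have C0 : (c%:MP : {mpoly K[n]}) != 0 by rewrite mpolyC_eq0.
by rewrite ord0_mlast // (mlastE (m := 0%MM)) ?mdeg0 // => [|m _]; rewrite ?le0x // msuppC (negbTE c0) inE.
Qed.

Lemma dhomog0_const G : G \is 0.-homog -> G = (G@_0%MM)%:MP.
Proof.
move=> hG; apply/mpolyP => m; rewrite mcoeffC.
case: (eqVneq 0%MM m) => [<-|m0]; first by rewrite mulr1.
by rewrite mulr0 (dhomog_nemf_coeff hG) // mdeg_eq0 eq_sym.
Qed.

Lemma dhomog_eval G d c v : G \is d.-homog ->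
  G.@[fun i => c * v i] = c ^+ d * G.@[v].
Proof.
move=> hG; rewrite !mevalE mulr_sumr [LHS]big_seq [RHS]big_seq.
apply: eq_bigr => m mG; have <- : mdeg m = d by apply: (dhomog_mf hG).
rewrite mulrCA; congr (_ * _); rewrite mdegE expr_sum -big_split.
by apply: eq_bigr => i _; rewrite exprMn.
Qed.

End Order.

Section Taylor.
Variables (K : fieldType) (n : nat).

Lemma exprD_widen (B k : nat) (x y : {mpoly K[n]}) : (k < B)%N ->
  (x + y) ^+ k = \sum_(j < B) (x ^+ (k - j) * y ^+ j) *+ 'C(k, j).
Proof.
move=> ltkB; rewrite exprDn (big_ord_widen _ (fun j => (x ^+ (k - j) * y ^+ j) *+ 'C(k, j)) ltkB).
rewrite big_mkcond; apply: eq_bigr => j _ /=; case: ltnP => // ltkj.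
by rewrite bin_small // mulr0n.
Qed.

Lemma mcoeff_shift (F : {mpoly K[n]}) (q : 'I_n -> K) (al : 'X_{1..n}) :
  (F \mPo [tuple (q i)%:MP + 'X_i | i < n])@_al =
  \sum_(m <- msupp F) F@_m * \prod_(i < n) (q i ^+ (m i - al i) *+ 'C(m i, al i)).
Proof.
rewrite comp_mpolyEX raddf_sum; apply: eq_bigr => m _ /=.
rewrite mcoeffZ; congr (_ * _).
(* A common strict bound on all exponents, so that the product of sums expands over functions into a
   single type ['I_B]. *)
pose B := (\max_i m i + \max_i al i).+1.
have mB i : (m i < B)%N by rewrite ltnS (leq_trans (leq_bigmax i)) ?leq_addr.
have alB i : (al i < B)%N by rewrite ltnS (leq_trans (leq_bigmax i)) ?leq_addl.
pose cf i (j : 'I_B) : K := q i ^+ (m i - j) *+ 'C(m i, j).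
transitivity ((\prod_(i < n) \sum_(j < B) cf i j *: ('X_i : {mpoly K[n]}) ^+ j)@_al).
  rewrite comp_mpolyX; congr (mcoeff _ _); apply: eq_bigr => i _.
  rewrite tnth_mktuple (exprD_widen _ _ (mB i)); apply: eq_bigr => j _.
  by rewrite -mul_mpolyC /cf rmorphMn rmorphXn /= mulrnAl.
rewrite bigA_distr_bigA /= raddf_sum /=.
pose f0 : {ffun 'I_n -> 'I_B} := [ffun i => Ordinal (alB i)].
have coefE (f : {ffun 'I_n -> 'I_B}) :
    (\prod_i (cf i (f i) *: ('X_i : {mpoly K[n]}) ^+ f i))@_al =
    (\prod_i cf i (f i)) * (f == f0)%:R.
  rewrite scaler_prod mcoeffZ; congr (_ * _).
  have -> : \prod_i ('X_i : {mpoly K[n]}) ^+ f i = 'X_[[multinom (f i : nat) | i < n]].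
    by rewrite mpolyXE_id; apply: eq_bigr => i _; rewrite mnmE.
  rewrite mcoeffX; congr (nat_of_bool _)%:R; apply/eqP/eqP => [E|->].
    by apply/ffunP => i; apply: val_inj; rewrite ffunE /= -E mnmE.
  by apply/mnmP => i; rewrite mnmE ffunE.
rewrite (bigD1 f0) //= coefE eqxx mulr1 [X in _ + X]big1 ?addr0 => [|f ne].
  by apply: eq_bigr => i _; rewrite /cf ffunE.
by rewrite coefE (negbTE ne) mulr0.
Qed.

End Taylor.

(** * Frames of the projective plane *)

Section Frames.
Variable K : fieldType.
Implicit Types q a b : 'rV[K]_3.

Lemma frameE q a b (v : 'rV[K]_3) j :
  (v *m frame q a b) 0 j = v 0 0 * q 0 j + v 0 1 * a 0 j + v 0 2 * b 0 j.
Proof.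
rewrite mxE !big_ord_recl big_ord0 addr0 /frame addrA.
congr (_ * _ + _ * _ + _ * _).
- rewrite -[RHS](col_mxEu q (col_mx a b) ord0 j).
  by congr (fun_of_matrix _ _ _); apply: val_inj.
- by congr (v 0 _); apply: val_inj.
- rewrite -[RHS](col_mxEu a b ord0 j) -[RHS](col_mxEd q (col_mx a b)).
  by congr (fun_of_matrix _ _ _); apply: val_inj.
- by congr (v 0 _); apply: val_inj.
- rewrite -[RHS](col_mxEd a b ord0 j) -[RHS](col_mxEd q (col_mx a b)).
  by congr (fun_of_matrix _ _ _); apply: val_inj.
Qed.

Lemma ord3P (P : 'I_3 -> Prop) : P 0 -> P 1 -> P 2 -> forall j, P j.
Proof.
move=> P0 P1 P2 [[|[|[|//]]] h].
- by rewrite (_ : Ordinal h = 0) //; apply: val_inj.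
- by rewrite (_ : Ordinal h = 1) //; apply: val_inj.
- by rewrite (_ : Ordinal h = 2) //; apply: val_inj.
Qed.

Lemma frame_unitP q a b : reflect
  (forall w al be, (forall j, w * q 0 j + al * a 0 j + be * b 0 j = 0) ->
    [/\ w = 0, al = 0 & be = 0])
  (frame q a b \in unitmx).
Proof.
rewrite -row_free_unit -kermx_eq0; apply: (iffP rowV0P) => [h w al be E|h v].
  pose v : 'rV[K]_3 := \row_j [tuple w; al; be]`_j.
  have /rowP v0 : v = 0.
    by apply: h; apply/sub_kermxP/rowP => j; rewrite frameE !mxE /=.
  by split; [have := v0 0|have := v0 1|have := v0 2]; rewrite !mxE.
move/sub_kermxP/rowP => E; have [|v0 v1 v2] := h (v 0 0) (v 0 1) (v 0 2).
  by move=> j; rewrite -frameE E mxE.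
by apply/rowP; apply: ord3P; rewrite mxE.
Qed.

Lemma exists_frame q : q != 0 -> exists a b, frame q a b \in unitmx.
Proof.
move=> q0; have [j qj] : exists j, q 0 j != 0 by apply/rV0Pn.
have frame_delta (k l : 'I_3) : j != k -> j != l -> k != l ->
    frame q (delta_mx 0 k) (delta_mx 0 l) \in unitmx.
  move=> jk jl kl; apply/frame_unitP => w al be E.
  have w0 : w = 0.
    have := E j; rewrite !mxE (negbTE jk) (negbTE jl) !andbF !mulr0 !addr0.
    by move/eqP; rewrite mulf_eq0 (negbTE qj) orbF => /eqP.
  split=> //.
    by have := E k; rewrite w0 !mxE !eqxx (negbTE kl) /= mul0r add0r mulr1 mulr0 addr0.
  have := E l; rewrite w0 !mxE !eqxx eq_sym (negbTE kl) /= mul0r add0r mulr1 mulr0.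
  by rewrite add0r.
move: j qj frame_delta; apply: ord3P => qj fr.
- by exists (delta_mx 0 1), (delta_mx 0 2); apply: fr.
- by exists (delta_mx 0 0), (delta_mx 0 2); apply: fr.
- by exists (delta_mx 0 0), (delta_mx 0 1); apply: fr.
Qed.

Lemma exists_coordinates q a b (y : 'rV[K]_3) : frame q a b \in unitmx ->
  exists w al be, forall j, y 0 j = w * q 0 j + al * a 0 j + be * b 0 j.
Proof.
move=> fu; pose v := y *m invmx (frame q a b).
exists (v 0 0), (v 0 1), (v 0 2) => j.
by rewrite -frameE /v -mulmxA mulVmx // mulmx1.
Qed.

Lemma row_free_col_mxP q a : reflect
  (forall w al, (forall j, w * q 0 j + al * a 0 j = 0) -> w = 0 /\ al = 0)
  (row_free (col_mx q a)).
Proof.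
have E (v : 'rV[K]_2) j : (v *m col_mx q a) 0 j = v 0 0 * q 0 j + v 0 1 * a 0 j.
  rewrite mxE !big_ord_recl big_ord0 addr0; congr (_ * _ + _ * _).
  - rewrite -[RHS](col_mxEu q a ord0 j).
    by congr (fun_of_matrix _ _ _); apply: val_inj.
  - by congr (v 0 _); apply: val_inj.
  - rewrite -[RHS](col_mxEd q a ord0 j).
    by congr (fun_of_matrix _ _ _); apply: val_inj.
rewrite -kermx_eq0; apply: (iffP rowV0P) => [h w al Ew|h v].
  pose v : 'rV[K]_2 := \row_j [tuple w; al]`_j.
  have /rowP v0 : v = 0.
    by apply: h; apply/sub_kermxP/rowP => j; rewrite E !mxE /=.
  by split; [have := v0 0|have := v0 1]; rewrite !mxE.
move/sub_kermxP/rowP => Ev; have [|v0 v1] := h (v 0 0) (v 0 1).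
  by move=> j; rewrite -E Ev mxE.
by apply/rowP => -[[|[|//]] hk]; rewrite mxE; [rewrite -[RHS]v0|rewrite -[RHS]v1];
  congr (v 0 _); apply: val_inj.
Qed.

End Frames.

(** * Effective divisors and integral curves on the blow-up *)

Section Curves.
Variables (R : realType) (r : nat).
Local Notation C := R[i].
Variable p : 'M[C]_(r, 3).
Implicit Types (F : {mpoly C[3]}) (D A B : curve p) (x : blowup p).

Lemma frame_nonvanishing F (q a b : 'rV[C]_3) : F != 0 -> frame q a b \in unitmx ->
  exists w al be, [/\ w != 0, al != 0, be != 0
    & F.@[fun j => w * q 0 j + al * a 0 j + be * b 0 j] != 0].
Proof.
move=> F0 fu; pose t := [tuple (q 0 j)%:MP * 'X_0 + (a 0 j)%:MP * 'X_1
  + (b 0 j)%:MP * 'X_2 : {mpoly C[3]} | j < 3].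
have tE v : (F \mPo t).@[v] =
    F.@[fun j => v 0 * q 0 j + v 1 * a 0 j + v 2 * b 0 j].
  rewrite comp_mpoly_meval; apply: meval_eq => j; rewrite tnth_mktuple.
  by rewrite !mevalD !mevalM !mevalC !mevalXU ![_ 0 j * _]mulrC.
have [y [_ Fy]] := mpoly_nonvanishing F0.
have [w [al [be E]]] := exists_coordinates (\row_j y j) fu.
have G0 : F \mPo t != 0.
  apply/eqP => G0; case/eqP: Fy; pose v (j : 'I_3) := [tuple w; al; be]`_j.
  have := tE v; rewrite G0 meval0 => ->; apply: meval_eq => j.
  by have := E j; rewrite mxE.
have [v [v0 Fv]] := mpoly_nonvanishing G0.
by exists (v 0), (v 1), (v 2); split=> //; rewrite -tE.
Qed.

Lemma pullback_away q a b h1 h2 F v :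
  (pullback (@Away _ _ p q a b h1 h2) F).@[v] =
  F.@[fun j => q 0 j + v 0 * a 0 j + v 1 * b 0 j].
Proof.
rewrite /= comp_mpoly_meval; apply: meval_eq => j; rewrite tnth_mktuple.
rewrite !mevalD !mevalM !mevalC !mevalXU ![_ 0 j * _]mulrC.
by congr (_ + v _ * _ + v _ * _); apply: val_inj.
Qed.

Lemma pullback_over i a b h F v :
  (pullback (@Over _ _ p i a b h) F).@[v] =
  F.@[fun j => p i j + v 0 * (a 0 j + v 1 * b 0 j)].
Proof.
rewrite /= comp_mpoly_meval; apply: meval_eq => j; rewrite tnth_mktuple.
rewrite !mevalD mevalM mevalD mevalM !mevalC !mevalXU [b 0 j * _]mulrC.
by congr (_ + v _ * (_ + v _ * _)); apply: val_inj.
Qed.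

Lemma pullbackM x F G : pullback x (F * G) = pullback x F * pullback x G.
Proof. by case: x => * /=; rewrite rmorphM. Qed.

Lemma pullbackC x c : pullback x c%:MP = c%:MP.
Proof. by case: x => * /=; rewrite comp_mpolyC. Qed.

(** Both charts are dominant: after division by w, a vector with nonzero frame coordinates w, al, be
    is in the image, at v = be / w in the first chart and at v = be / al in the second, with u = al
    / w in both. *)
Lemma pullback_neq0 x F d : F != 0 -> F \is d.-homog -> pullback x F != 0.
Proof.
move=> F0 hF; apply/eqP => P0.
case: x P0 => [q a b h1 h2|i a b h] P0.
  have [w [al [be [w0 al0 be0]]]] := frame_nonvanishing F0 h1; case/negP.
  have := pullback_away h1 h2 F (fun j : 'I_2 => if j == 0 then al / w else be / w).
  rewrite P0 meval0 /= => E.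
  have := dhomog_eval w (fun j => q 0 j + al / w * a 0 j + be / w * b 0 j) hF.
  rewrite -E mulr0 => /eqP; congr (_ == 0); apply: meval_eq => j.
  by field.
have [w [al [be [w0 al0 be0]]]] := frame_nonvanishing F0 h; case/negP.
have := pullback_over h F (fun j : 'I_2 => if j == 0 then al / w else be / al).
rewrite P0 meval0 /= => E.
have := dhomog_eval w (fun j => p i j + al / w * (a 0 j + be / al * b 0 j)) hF.
rewrite -E mulr0 => /eqP; congr (_ == 0); apply: meval_eq => j; rewrite mxE.
by field; rewrite w0 al0.
Qed.

(** Translation preserves the coefficient of the leading monomial, since no other monomial of the
    same degree is divisible by it. *)
Lemma mult_P2_le F d q : F != 0 -> F \is d.-homog -> (mult_P2 F q <= d)%N.
Proof.
move=> F0 hF; have mF : mdeg (mlead F) = d by apply: (dhomog_mf hF); apply: mlead_supp.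
have E : (F \mPo [tuple (q 0 j)%:MP + 'X_j | j < 3])@_(mlead F) = F@_(mlead F).
  rewrite mcoeff_shift (bigD1_seq (mlead F)) ?msupp_uniq ?mlead_supp //=.
  rewrite [X in _ + X]big_seq_cond [X in _ + X]big1 ?addr0.
    by rewrite big1 ?mulr1 // => i _; rewrite subnn binn.
  move=> m /andP[mFs ne]; suff [i lt_i] : exists i, (m i < mlead F i)%N.
    by rewrite (bigD1 i) //= bin_small // mulr0n mul0r mulr0.
  apply: contrapT => /forallNP nlt; case/eqP: ne.
  have /submK Em : (mlead F <= m)%MM.
    by apply/mnm_lepP => i; rewrite leqNgt; apply/negP/nlt.
  have : mdeg m = mdeg (mlead F) by rewrite mF; apply: (dhomog_mf hF).
  rewrite -{1}Em mdegD => /eqP; rewrite -{2}[mdeg (mlead F)]add0n eqn_add2r mdeg_eq0.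
  by move=> /eqP E0; rewrite -Em E0 add0m.
have lead0 : F@_(mlead F) != 0 by rewrite mcoeff_eq0 negbK mlead_supp.
rewrite /mult_P2 -mF; set G := _ \mPo _ in E *.
have G0 : G != 0 by apply/eqP => G0; rewrite G0 mcoeff0 in E; rewrite -E eqxx in lead0.
have := leqnn (ord0_mpoly G); move/(ord0_geP _ G0); apply.
by rewrite -[_ \in _]negbK -mcoeff_eq0 E.
Qed.

Lemma mult_P2_const c q : c != 0 -> mult_P2 (c%:MP : {mpoly C[3]}) q = 0%N.
Proof. by move=> c0; rewrite /mult_P2 comp_mpolyC ord0C. Qed.

Lemma cdeg_sum D A B : is_sum D A B -> cdeg D = (cdeg A + cdeg B)%N.
Proof.
move=> [E _]; apply: (dhomog_uniq (cform_neq0 D)); first exact: cform_homog.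
by rewrite E dhomogM // cform_homog.
Qed.

Lemma mult_at_sum D A B x : is_sum D A B -> mult_at D x = mult_at A x + mult_at B x.
Proof.
move=> [E Em]; rewrite /mult_at E pullbackM.
rewrite ord0M ?(pullback_neq0 _ (cform_neq0 _) (cform_homog _)) //.
rewrite PoszD addrACA -opprD -big_split; congr (_ - _).
by apply: eq_bigr => i _; rewrite Em.
Qed.

Lemma cdeg0_form D : cdeg D = 0%N -> exists2 c, c != 0 & cform D = c%:MP.
Proof.
move=> d0; have := cform_homog D; rewrite d0 => /dhomog0_const E.
exists (cform D)@_0%MM => //; apply/eqP => c0.
by have := cform_neq0 D; rewrite E c0 mpolyC0 eqxx.
Qed.

Lemma cdeg0_cmul D i : cdeg D = 0%N -> cmul D i <= 0.
Proof.
move/cdeg0_form => [c c0 E]; have := cmul_le D i.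
by rewrite E mult_P2_const.
Qed.

Lemma cmul_le_cdeg D i : cmul D i <= (cdeg D)%:Z.
Proof.
apply: le_trans (cmul_le D i) _.
by rewrite lez_nat (mult_P2_le _ (cform_neq0 D) (cform_homog D)).
Qed.

(* The degree of D with respect to (r + 1)H - \sum_i E_i, which is positive on
   nonzero effective divisors. *)
Definition height D : int := (cdeg D)%:Z *+ r.+1 - \sum_i cmul D i.

Lemma height_sum D A B : is_sum D A B -> height D = height A + height B.
Proof.
move=> S; rewrite /height (cdeg_sum S) PoszD mulrnDl addrACA -opprD -big_split.
by congr (_ - _); case: S => _ S; apply: eq_bigr => i _; rewrite S.
Qed.

Lemma height_gt0 D : ~ zero_divisor D -> 0 < height D.
Proof.
move=> nz; have le : \sum_i cmul D i <= (cdeg D)%:Z *+ r.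
  have -> : (cdeg D)%:Z *+ r = \sum_(i < r) (cdeg D)%:Z by rewrite sumr_const card_ord.
  by apply: ler_sum => i _; apply: cmul_le_cdeg.
rewrite /height mulrSr; case: (posnP (cdeg D)) => [d0|]; last by lia.
rewrite d0 mul0rn addr0 sub0r oppr_gt0.
have := le; rewrite d0 mul0rn le_eqVlt => /orP[/eqP s0|//].
case: nz; split=> // i; apply/eqP; rewrite eq_le cdeg0_cmul //=.
rewrite leNgt; apply/negP => lt; suff : \sum_i cmul D i < 0 by rewrite s0 ltxx.
rewrite (bigD1 i) //= -(addr0 0) ltr_leD //.
by apply: sumr_le0 => j _; apply: cdeg0_cmul.
Qed.

(** By additivity, one of two summands inherits [phi <= 0]. The descent runs on [height] because the
    degree does not see exceptional components. *)
Lemma integral_component (phi : curve p -> R) :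
  (forall D A B, is_sum D A B -> phi D = phi A + phi B) ->
  forall D, ~ zero_divisor D -> phi D <= 0 ->
  exists2 E, integral_curve E & phi E <= 0.
Proof.
move=> phiD D; have [k] := ubnP `|height D|%N.
elim: k D => // k IH D ltk nz le0.
case: (pselect (integral_curve D)) => [iD|nI]; first by exists D.
have [A [B [S nA nB]]] : exists A B, [/\ is_sum D A B, ~ zero_divisor A & ~ zero_divisor B].
  apply: contrapT => h; apply: nI; split=> // A B S.
  apply: contrapT => /not_orP[nA nB]; apply: h; by exists A, B.
have hA := height_gt0 nA; have hB := height_gt0 nB; have hS := height_sum S.
case: (leP (phi A) 0) => [leA|gtA]; first by apply: (IH A) => //; lia.
apply: (IH B) => //; first by lia.
by move: le0; rewrite (phiD _ _ _ S); lra.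
Qed.

Definition exc_mul (i k : 'I_r) : int := - (k == i)%:Z.

Lemma exc_le i k : exc_mul i k <= (mult_P2 (1 : {mpoly C[3]}) (row k p))%:Z.
Proof. by rewrite -mpolyC1 mult_P2_const ?oner_neq0 // /exc_mul; case: eqP. Qed.

Definition exceptional (i : 'I_r) : curve p :=
  @Curve _ _ p 0 (exc_mul i) 1 (oner_neq0 _) (@dhomog1 _ _ _) (exc_le i).

Lemma exceptional_integral i : integral_curve (exceptional i).
Proof.
split=> [[_ /(_ i)]|A B S]; first by rewrite /= /exc_mul eqxx.
have := cdeg_sum S => /= /esym/eqP; rewrite addn_eq0 => /andP[/eqP dA /eqP dB].
have [_ Sm] := S; have mA k := cdeg0_cmul k dA; have mB k := cdeg0_cmul k dB.
have Ek k : k != i -> cmul A k = 0 /\ cmul B k = 0.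
  move=> ne; have := Sm k; rewrite /= /exc_mul (negbTE ne).
  by have := mA k; have := mB k; lia.
have := Sm i; rewrite /= /exc_mul eqxx => Ei.
have [Ai|Bi] : cmul A i = 0 \/ cmul B i = 0 by have := mA i; have := mB i; lia.
  by left; split=> // k; case: (eqVneq k i) => [->|/Ek[]].
by right; split=> // k; case: (eqVneq k i) => [->|/Ek[]].
Qed.

(** A negative multiplicity at p_i can be raised by 1 without violating the bound by [mult_P2],
    which splits off E_i; an integral curve is then E_i itself. *)
Lemma integral_cases D : integral_curve D ->
  (exists i, cdeg D = 0%N /\ forall k, cmul D k = exc_mul i k) \/
  ((0 < cdeg D)%N /\ forall k, 0 <= cmul D k).
Proof.
move=> [nz iD]; case: (pselect (exists i, cmul D i < 0)) => [[i lt0]|nneg].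
  left; exists i.
  have le k : cmul D k - exc_mul i k <= (mult_P2 (cform D) (row k p))%:Z.
    case: (eqVneq k i) => [->|ne]; last by rewrite /exc_mul (negbTE ne) subr0 cmul_le.
    by rewrite /exc_mul eqxx opprK; apply: (@le_trans _ _ 0) => //; lia.
  pose A := Curve (cform_neq0 D) (cform_homog D) le.
  have S : is_sum D A (exceptional i).
    by split=> [|k] /=; [rewrite mulr1|rewrite subrK].
  case: (iD _ _ S) => [[dA mA]|[_ /(_ i)]]; last by rewrite /= /exc_mul eqxx.
  by split=> // k; have := mA k => /= /eqP; rewrite subr_eq0 => /eqP.
right; have pos k : 0 <= cmul D k.
  by rewrite leNgt; apply/negP => lt; apply: nneg; exists k.
split=> //; rewrite lt0n; apply/eqP => d0; apply: nz; split=> // k.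
by apply/eqP; rewrite eq_le pos cdeg0_cmul.
Qed.

Lemma integral_not_non_reduced D : integral_curve D -> ~ non_reduced D.
Proof.
move=> [nz iD] [A [B [G [nA [SG SD]]]]].
case: (iD _ _ SD) => // -[dG mG]; apply: nA.
have := cdeg_sum SG; rewrite dG => /esym/eqP; rewrite addn_eq0 => /andP[/eqP dA /eqP dB].
have [_ Sm] := SG; split=> // k.
by have := cdeg0_cmul k dA; have := cdeg0_cmul k dB; have := Sm k; rewrite mG; lia.
Qed.

Lemma mult_at_exceptional D i x : cdeg D = 0%N -> (forall k, cmul D k = exc_mul i k) ->
  mult_at D x = (on_exc x i)%:Z.
Proof.
move=> d0 mD; have [c c0 E] := cdeg0_form d0.
rewrite /mult_at E pullbackC ord0C // sub0r (eq_bigr (exc_mul i)) //.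
rewrite big_mkcond (bigD1 i) //= big1 => [|k ne].
  by rewrite addr0 /exc_mul eqxx; case: on_exc.
by rewrite /exc_mul (negbTE ne) if_same.
Qed.

End Curves.

(** * Existence of points on curves *)

Section Points.
Variables (R : realType) (r : nat).
Local Notation C := R[i].

Lemma meval_zero (K : comNzRingType) n (G : {mpoly K[n]}) : G.@[fun=> 0] = G@_0%MM.
Proof.
elim/mpoly_alg_ind: G => [c|i|p q Ep Eq|p q Ep Eq].
- by rewrite mevalC mcoeffC eqxx mulr1.
- by rewrite mevalXU mcoeffX mnm1_eq0.
- by rewrite mevalD mcoeffD Ep Eq.
- by rewrite mevalM Ep Eq rmorphM.
Qed.

Lemma ord0_gt0 (K : fieldType) n (G : {mpoly K[n]}) : G != 0 -> G.@[fun=> 0] = 0 ->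
  (0 < ord0_mpoly G)%N.
Proof.
rewrite meval_zero => G0 c0; apply/ord0_geP => // m mG.
rewrite lt0n mdeg_eq0; apply: contraL mG => /eqP ->.
by rewrite -mcoeff_eq0 c0.
Qed.

(** A restriction to the affine line without roots is a constant c. By homogeneity F (y1 + s y0) = c
    s^d for nonzero s, hence for all s, and s = 0 gives the zero at infinity. *)
Lemma zero_on_line (F : {mpoly C[3]}) d (y0 y1 : 'I_3 -> C) :
  F \is d.-homog -> (0 < d)%N ->
  (exists t, F.@[fun j => y0 j + t * y1 j] = 0) \/ F.@[y1] = 0.
Proof.
move=> hF d0; pose ln (z0 z1 : 'I_3 -> C) : {poly C} :=
  mmap polyC (fun j => (z0 j)%:P + z1 j *: 'X) F.
have lnE z0 z1 t : (ln z0 z1).[t] = F.@[fun j => z0 j + t * z1 j].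
  rewrite /ln /mmap horner_sum mevalE; apply: eq_bigr => m _.
  rewrite hornerM hornerC /mmap1 horner_prod; congr (_ * _).
  by apply: eq_bigr => j _; rewrite horner_exp hornerD hornerC hornerZ hornerX mulrC.
case: (eqVneq (size (ln y0 y1)) 1%N) => [/eqP/size_poly1P[c c0 Ec]|sz]; last first.
  by left; have /closed_rootP[t /rootP Et] := sz; exists t; rewrite -lnE.
right; have Fc t : F.@[fun j => y0 j + t * y1 j] = c by rewrite -lnE Ec hornerC.
have g s : s != 0 -> (ln y1 y0).[s] = s ^+ d * c.
  move=> s0; rewrite lnE -(Fc s^-1) -(dhomog_eval s _ hF); apply: meval_eq => j.
  by rewrite mulrDr mulrA mulfV // mul1r addrC.
have : ln y1 y0 - c *: 'X^d = 0.
  apply/eqP/negPn/negP => P0.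
  have /closed_nonrootP[s] : 'X * (ln y1 y0 - c *: 'X^d) != 0.
    by rewrite mulf_neq0 // polyX_eq0.
  rewrite rootM negb_or rootX => /andP[s0]; rewrite rootE hornerD hornerN hornerZ hornerXn.
  by rewrite g // mulrC subrr eqxx.
move/(congr1 (fun P => P.[0])); rewrite hornerD hornerN hornerZ hornerXn expr0n.
rewrite -[d == 0%N]negbK -lt0n d0 mulr0 subr0 horner0 lnE => <-.
by apply: meval_eq => j; rewrite mul0r addr0.
Qed.

Variable p : 'M[C]_(r, 3).
Hypothesis cp : is_config p.

(** The curve is cut with a line that avoids every p_i, so that the point found lies off the
    exceptional divisors. *)
Lemma exists_point (D : curve p) : (0 < cdeg D)%N -> exists x, 0 < mult_at D x.
Proof.
move=> d0; have [l [l0 lp]] : exists l : 'I_3 -> C, (forall j, l j != 0) /\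
    forall i, \sum_j p i j * l j != 0.
  pose P : {mpoly C[3]} := \prod_(i < r) \sum_j p i j *: 'X_j.
  have PE l : P.@[l] = \prod_(i < r) \sum_j p i j * l j.
    rewrite rmorph_prod; apply: eq_bigr => i _ /=; rewrite raddf_sum.
    by apply: eq_bigr => j _ /=; rewrite mevalZ mevalXU.
  have P0 : P != 0.
    apply/prodf_neq0 => i _; have := cp i; apply: contraNneq => E.
    apply/eqP/rowP => j; rewrite !mxE; have := congr1 (mcoeff U_(j)) E.
    rewrite mcoeff0 raddf_sum (bigD1 j) //= mcoeffZ mcoeffX eqxx mulr1 big1 ?addr0 //.
    by move=> k ne; rewrite mcoeffZ mcoeffX eq_mnm1 (negbTE ne) mulr0.
  have [l [l0 Pl]] := mpoly_nonvanishing P0; exists l; split=> // i.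
  by move: Pl; rewrite PE => /prodf_neq0/(_ i isT).
suff [q [q0 lq Fq]] : exists q : 'rV[C]_3, [/\ q != 0, \sum_j q 0 j * l j = 0
    & (cform D).@[fun j => q 0 j] = 0].
  have [a [b fu]] := exists_frame q0.
  have rf i : row_free (col_mx (row i p) q).
    apply/row_free_col_mxP => w al E.
    have w0 : w = 0.
      have : w * \sum_j p i j * l j + al * \sum_j q 0 j * l j = 0.
        rewrite !mulr_sumr -big_split big1 // => j _ /=.
        by rewrite !mulrA -mulrDl; have := E j; rewrite mxE => ->; rewrite mul0r.
      by rewrite lq mulr0 addr0 => /eqP; rewrite mulf_eq0 (negbTE (lp i)) orbF => /eqP.
    split=> //; have /rV0Pn[j qj] := q0; have := E j; rewrite w0 mul0r add0r.
    by move/eqP; rewrite mulf_eq0 (negbTE qj) orbF => /eqP.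
  exists (Away fu rf); rewrite /mult_at big_pred0 // subr0 ltz_nat ord0_gt0 //.
    exact: (pullback_neq0 _ (cform_neq0 D) (cform_homog D)).
  rewrite pullback_away -[RHS]Fq; apply: meval_eq => j.
  by rewrite !mul0r !addr0.
(* Two points spanning the line l = 0; as all l_j are nonzero, neither y0 + t y1 nor y1 is the zero
   vector. *)
pose y0 (j : 'I_3) : C := [tuple l 1; - l 0; 0]`_j.
pose y1 (j : 'I_3) : C := [tuple 0; l 2; - l 1]`_j.
have sum3 (f : 'I_3 -> C) : \sum_j f j = f 0 + f 1 + f 2.
  rewrite !big_ord_recl big_ord0 addr0 addrA.
  by congr (_ + f _ + f _); apply: val_inj.
have [[t Et]|E1] := zero_on_line y0 y1 (cform_homog D) d0.
  exists (\row_j (y0 j + t * y1 j)); split.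
  - by apply/rV0Pn; exists 0; rewrite mxE /y0 /y1 /= mulr0 addr0.
  - rewrite sum3 !mxE /y0 /y1 /=; ring.
  - by rewrite -[RHS]Et; apply: meval_eq => j; rewrite mxE.
exists (\row_j y1 j); split.
- by apply/rV0Pn; exists 1; rewrite mxE /y1 /=.
- rewrite sum3 !mxE /y1 /=; ring.
- by rewrite -[RHS]E1; apply: meval_eq => j; rewrite mxE.
Qed.

End Points.

Delimit Scope Z_scope with BZ.

(** * The finite list of numerical types *)

Section IntegerBound.

Definition zrange (n : nat) : seq Z := [seq Z.of_nat i | i <- iota 0 n].

(* M points of multiplicities as equal as possible have this sum of squares. *)
Definition balanced (r M : Z) : Z :=
  let k := Z.div M r in ((2 * k + 1) * M - r * (k * (k + 1)))%BZ.

(* [q1 / q0] bounds sqrt (mu ^ 2 - r). *)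
Definition candidate (q0 q1 r d t M : Z) : bool :=
  [&& (0 <? d)%BZ, (0 <? t)%BZ,
      (r * (d * d) <=? M * M + r * (t * t))%BZ,
      (q0 * q0 * (r * (d * d)) <=? (q0 * M + q1 * t) * (q0 * M + q1 * t))%BZ &
      if (t =? 1)%BZ then (balanced r M + M <=? d * d + 3 * d)%BZ
      else (balanced r M + M + t * t + t <=? d * d + 3 * d + 4)%BZ].

(** Tuples (r, d, t, M) that pass the integral tests. Among them, (10, 10, 2, 31), (11, 4, 2, 12)
    and (13, 4, 2, 13) determine the thresholds, and (10, 3, 1, 9) is the cubic. *)
Definition exceptions : seq (nat * nat * nat * nat) :=
  ([:: (10, 3, 1, 9); (10, 6, 2, 18); (10, 10, 2, 31); (10, 13, 3, 40);
      (11, 3, 2, 8); (11, 4, 2, 12); (11, 7, 3, 21); (11, 8, 4, 23);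
      (12, 4, 2, 12); (12, 8, 4, 24); (13, 4, 2, 13); (14, 4, 2, 13)])%N.

Definition eq4 (r d t M : Z) (y : nat * nat * nat * nat) : bool :=
  let: (r', d', t', M') := y in
  [&& r =? Z.of_nat r', d =? Z.of_nat d', t =? Z.of_nat t' & M =? Z.of_nat M']%BZ.

Definition candidates_ok (q0 q1 : nat) (r : Z) (D : nat) : bool :=
  all (fun d => let dz := Z.of_nat d in all (fun t => let tz := Z.of_nat t in
    all (fun M => candidate (Z.of_nat q0) (Z.of_nat q1) r dz tz M ==>
      has (eq4 r dz tz M) exceptions) (zrange (3 * d + 5 - t)))
    (iota 0 (3 * d + 5))) (iota 0 D.+1).

(** The inequality r d^2 <= (3 d + 4)^2 gives d <= 24 for r = 10, d <= 12 for r = 11 and d <= 8 for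
    r >= 12. From r = 49 on it leaves only d = 1, so the search stops at r = 48. *)
Lemma candidates_checked :
  [&& candidates_ok 24 13 (Z.of_nat 10) 24, candidates_ok 1 1 (Z.of_nat 11) 12 &
      all (fun r => candidates_ok 1 1 (Z.of_nat r) 8) (iota 12 37)].
Proof. by vm_compute. Qed.

Lemma zrange_all n (P : Z -> bool) : all P (zrange n) ->
  forall i : nat, (i < n)%N -> P (Z.of_nat i).
Proof. by rewrite all_map => /allP h i lt; apply: h; rewrite mem_iota. Qed.

Lemma candidates_okP (q0 q1 r D d t M : nat) :
  candidates_ok q0 q1 (Z.of_nat r) D -> (d <= D)%N -> (t + M <= 3 * d + 4)%N ->
  candidate (Z.of_nat q0) (Z.of_nat q1) (Z.of_nat r) (Z.of_nat d) (Z.of_nat t) (Z.of_nat M) ->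
  List.In (r, d, t, M) exceptions.
Proof.
move=> ok ld ltM c.
have /implyP/(_ c) : candidate (Z.of_nat q0) (Z.of_nat q1) (Z.of_nat r) (Z.of_nat d) (Z.of_nat t) (Z.of_nat M)
    ==> has (eq4 (Z.of_nat r) (Z.of_nat d) (Z.of_nat t) (Z.of_nat M)) exceptions.
  have dD : d \in iota 0 D.+1 by rewrite mem_iota.
  have td : t \in iota 0 (3 * d + 5) by rewrite mem_iota; lia.
  by apply: (zrange_all (allP (allP ok d dD) t td)); lia.
elim: exceptions => //= -[[[a b] c'] d'] s IH /orP[|/IH]; last by right.
case/and4P => /Z.eqb_spec/Nat2Z.inj -> /Z.eqb_spec/Nat2Z.inj ->.
by move=> /Z.eqb_spec/Nat2Z.inj -> /Z.eqb_spec/Nat2Z.inj ->; left.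
Qed.

Lemma integer_bound (r d t M S q0 q1 : nat) :
  (10 <= r)%N -> (0 < d)%N -> (0 < t)%N ->
  (forall k, k.*2.+1 * M <= S + r * (k * k.+1))%N ->
  (if t == 1 then S + M <= d * d + 3 * d else S + M + t * t + t <= d * d + 3 * d + 4)%N ->
  (r * (d * d) <= M * M + r * (t * t))%N ->
  (q0, q1) = (if r == 10%N then (24, 13) else (1, 1))%N ->
  (q0 * q0 * (r * (d * d)) <= (q0 * M + q1 * t) * (q0 * M + q1 * t))%N ->
  List.In (r, d, t, M) exceptions.
Proof.
move=> r10 d0 t0 bal chi cs eq qb.
have chi' : (S + M + t * t + t <= d * d + 3 * d + 4)%N.
  by move: chi; case: eqP => [->|//]; lia.
have Sbal := bal (M %/ r)%N.
have balZ : (balanced (Z.of_nat r) (Z.of_nat M) <= Z.of_nat S)%BZ.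
  have ur : (M %% r < r)%N by rewrite ltn_mod; lia.
  rewrite /balanced -(Z.div_unique_pos _ _ (Z.of_nat (M %/ r)) (Z.of_nat (M %% r))); last 2 first.
  - by move: (M %% r)%N ur => u; lia.
  - have := divn_eq M r; move: (M %/ r)%N (M %% r)%N => k u; nia.
  by move: (M %/ r)%N Sbal => k; lia.
have cauchy : (M * M <= r * S)%N.
  move: Sbal; have := divn_eq M r; have : (M %% r < r)%N by rewrite ltn_mod; lia.
  move: (M %/ r)%N (M %% r)%N => k u lt ->; rewrite -muln2 => h.
  have : (r * ((k * 2).+1 * (k * r + u)) <= r * (S + r * (k * k.+1)))%N by rewrite leq_mul2l h orbT.
  by nia.
(* Together, [cs] and [cauchy] give d^2 <= S + t^2, which cancels the quadratic terms of [chi']. *)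
have tM : (t + M <= 3 * d + 4)%N by nia.
have qb1 : (r * (d * d) <= (M + t) * (M + t))%N.
  by move: qb eq; case: eqP => _ qb' eq'; case: eq' => E0 E1; rewrite E0 E1 in qb'; nia.
have qb2 : (r * (d * d) <= (3 * d + 4) * (3 * d + 4))%N.
  by apply: (leq_trans qb1); rewrite leq_mul //; lia.
have candP : candidate (Z.of_nat q0) (Z.of_nat q1) (Z.of_nat r) (Z.of_nat d) (Z.of_nat t) (Z.of_nat M).
  apply/and5P; split; [lia|lia|lia|lia|].
  have [t1|ne] := eqVneq t 1%N.
    rewrite ifT; last by rewrite t1.
    rewrite t1 /= in chi.
    by apply/Z.leb_spec0; move: (balanced _ _) balZ => b; lia.
  rewrite ifF; last by apply/Z.eqb_neq; lia.
  by apply/Z.leb_spec0; move: (balanced _ _) balZ => b; lia.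
have /and3P[ok10 ok11 ok12] := candidates_checked.
have [E10|n10] := eqVneq r 10%N.
  rewrite E10 /= in eq; case: eq => E0 E1; rewrite E0 E1 E10 in candP; rewrite E10 in qb2 *.
  by apply: (candidates_okP ok10 _ tM candP); nia.
rewrite (negbTE n10) in eq; case: eq => E0 E1; rewrite E0 E1 in candP.
have [E11|n11] := eqVneq r 11%N.
  rewrite E11 in candP qb2 *.
  by apply: (candidates_okP ok11 _ tM candP); nia.
have r12 : (12 <= r)%N by lia.
case: (ltnP r 49) => [lt49|ge49].
  have d8 : (d <= 8)%N.
    have : (12 * (d * d) <= (3 * d + 4) * (3 * d + 4))%N.
      exact: leq_trans (leq_mul r12 (leqnn (d * d)%N)) qb2.
    by clear; nia.
  have okr : candidates_ok 1 1 (Z.of_nat r) 8.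
    by move/allP: ok12; apply; rewrite mem_iota; lia.
  by apply: (candidates_okP okr _ tM candP); lia.
have d1 : d = 1%N by nia.
have SM : (M <= S)%N by have := bal 0%N; lia.
(* For a line, [chi] allows M + t to be at most 3. *)
subst d; exfalso; have : (7 <= M + t)%N by nia.
nia.
Qed.

End IntegerBound.

(** * Inequalities in mu below the threshold *)

Section RealBound.
Variable R : realType.
Implicit Types mu s : R.

Lemma threshold_value_ge14 r : (14 <= r)%N -> threshold_value R r = Num.sqrt r.+1%:R.
Proof. by do 14! [case: r => [|r] //]. Qed.

(** Below the threshold this makes q = sqrt (mu^2 - r) smaller than 1, which is also what keeps the
    exceptional curves from being submaximal. *)
Lemma sqr_threshold_le r : (10 <= r)%N ->
  0 <= threshold_value R r /\ threshold_value R r ^+ 2 <= r.+1%:R.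
Proof.
move=> r10; have [r14|lt14] := leqP 14 r.
  by rewrite threshold_value_ge14 // sqr_sqrtr ?ler0n ?sqrtr_ge0.
have s3 : Num.sqrt 3%:R ^+ 2 = 3%:R :> R by rewrite sqr_sqrtr ?ler0n.
have s13 : Num.sqrt 13%:R ^+ 2 = 13%:R :> R by rewrite sqr_sqrtr ?ler0n.
have p3 : 0 <= Num.sqrt 3%:R :> R by apply: sqrtr_ge0.
have p13 : 0 <= Num.sqrt 13%:R :> R by apply: sqrtr_ge0.
have [->|n10] := eqVneq r 10%N; first by rewrite /=; split; lra.
have [->|n11] := eqVneq r 11%N; first by rewrite /=; split; nra.
have [->|n12] := eqVneq r 12%N.
  by rewrite /= sqr_sqrtr ?ler0n ?sqrtr_ge0.
have -> : r = 13%N by lia.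
by rewrite /=; split; nra.
Qed.

Lemma numeric_bound (r d t M S : nat) mu :
  (10 <= r)%N -> (0 < d)%N -> (0 < t)%N ->
  (forall k, k.*2.+1 * M <= S + r * (k * k.+1))%N ->
  (if t == 1 then S + M <= d * d + 3 * d else S + M + t * t + t <= d * d + 3 * d + 4)%N ->
  Num.sqrt r%:R <= mu -> mu < threshold_value R r ->
  t%:R * Num.sqrt (mu ^+ 2 - r%:R) < mu * d%:R - M%:R.
Proof.
move=> r10 d0 t0 bal chi lemu ltmu; rewrite ltNge; apply/negP => sub.
have r0 : 0 < r%:R :> R by rewrite ltr0n; lia.
have mu0 : 0 < mu by apply: lt_le_trans lemu; rewrite sqrtr_gt0.
have lemu2 : r%:R <= mu ^+ 2.
  rewrite -[X in X <= _]sqr_sqrtr ?ler0n //.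
  by rewrite ler_sqr ?nnegrE ?sqrtr_ge0 // ltW.
set q := Num.sqrt _ in sub; have q0 : 0 <= q by apply: sqrtr_ge0.
have q2 : q ^+ 2 = mu ^+ 2 - r%:R by rewrite sqr_sqrtr // subr_ge0.
have [th0 th2] := sqr_threshold_le r10.
have mu2 : mu ^+ 2 < r.+1%:R.
  by apply: lt_le_trans th2; rewrite ltr_sqr ?nnegrE // ltW.
have q1 : q < 1.
  by rewrite -(@ltr_pXn2r _ 2) ?nnegrE // expr1n q2 ltrBlDr addrC natr1.
have d0R : 0 < d%:R :> R by rewrite ltr0n.
have t0R : 0 < t%:R :> R by rewrite ltr0n.
have M0R : 0 <= M%:R :> R by rewrite ler0n.
have sub' : mu * d%:R <= M%:R + t%:R * q by rewrite -lerBlDl.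
(* Cauchy-Schwarz in the form r (M + t q)^2 <= (M^2 + r t^2) (r + q^2), where r + q^2 = mu^2; the
   difference of the two sides is (M q - r t)^2. *)
have cs : (r * (d * d) <= M * M + r * (t * t))%N.
  rewrite -(ler_nat R) natrD !natrM -(@ler_pM2r _ (mu ^+ 2)) ?exprn_gt0 //.
  apply: (@le_trans _ _ (r%:R * (M%:R + t%:R * q) ^+ 2)).
    rewrite (_ : _ * _ * _ = r%:R * (mu * d%:R) ^+ 2); last by ring.
    by rewrite ler_pM2l // ler_sqr ?nnegrE ?addr_ge0 ?mulr_ge0 // ltW.
  rewrite (_ : mu ^+ 2 = r%:R + q ^+ 2); last by rewrite q2; ring.
  rewrite -subr_ge0 (_ : _ - _ = (M%:R * q - r%:R * t%:R) ^+ 2); last by ring.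
  exact: sqr_ge0.
(* For r = 10, q is at most sqrt ((77/24)^2 - 10) = 13/24; otherwise only q < 1 is used. *)
pose qq := (if r == 10 then (24, 13) else (1, 1))%N.
have qq1 : (qq.1)%:R * q <= (qq.2)%:R.
  rewrite /qq; case: eqP => [E10|_] /=; last by rewrite mul1r ltW.
  have ltmu' : mu < 77%:R / 24%:R by move: ltmu; rewrite E10.
  rewrite -(@ler_pXn2r _ 2) ?nnegrE ?mulr_ge0 ?ler0n // exprMn q2 E10; nra.
have qb : (qq.1 * qq.1 * (r * (d * d)) <= (qq.1 * M + qq.2 * t) * (qq.1 * M + qq.2 * t))%N.
  rewrite -(ler_nat R) !(natrD, natrM) -!expr2.
  move: (qq.1)%:R (qq.2)%:R (ler0n R qq.1) (ler0n R qq.2) qq1 => a b a0 b0 ab.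
  apply: (@le_trans _ _ (a ^+ 2 * (mu ^+ 2 * d%:R ^+ 2))).
    by rewrite ler_wpM2l ?sqr_ge0 // ler_wpM2r ?sqr_ge0.
  rewrite -!exprMn ler_sqr ?nnegrE ?addr_ge0 ?mulr_ge0 ?ler0n ?(ltW mu0) //.
  apply: (le_trans (ler_wpM2l a0 sub')); rewrite mulrDr lerD2l mulrCA mulrC.
  by rewrite ler_wpM2r // ltW.
have ein := integer_bound r10 d0 t0 bal chi cs (esym (surjective_pairing qq)) qb.
have quad : (M * M <= r * (d * d))%N ->
    (mu * d%:R - M%:R) ^+ 2 <= t%:R ^+ 2 * (mu ^+ 2 - r%:R).
  rewrite -(ler_nat R) !natrM -!expr2 => hM.
  have h : M%:R <= mu * d%:R.
    rewrite -ler_sqr ?nnegrE ?mulr_ge0 ?(ltW mu0) ?(ltW d0R) // exprMn.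
    by apply: (le_trans hM); rewrite ler_wpM2r ?sqr_ge0.
  by rewrite -q2 -exprMn ler_sqr ?nnegrE ?mulr_ge0 ?subr_ge0 ?(ltW t0R).
have s3 : Num.sqrt 3%:R ^+ 2 = 3%:R :> R by rewrite sqr_sqrtr ?ler0n.
have s13 : Num.sqrt 13%:R ^+ 2 = 13%:R :> R by rewrite sqr_sqrtr ?ler0n.
have p3 : 0 <= Num.sqrt 3%:R :> R by apply: sqrtr_ge0.
have p13 : 0 <= Num.sqrt 13%:R :> R by apply: sqrtr_ge0.
clear bal chi lemu cs qb q2 q1 q0 qq1 th2 th0 sub sub' d0R t0R M0R qq.
have s3_ge : 17%:R / 10%:R <= Num.sqrt 3%:R :> R by nra.
(* In each case [quad] is a quadratic inequality in mu that fails below its roots,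
   and [ha] and [hb] compare mu with these roots. *)
have roots (a b : R) : mu < a -> mu < b -> 0 < (a - mu) * (b - mu).
  by move=> ha hb; rewrite mulr_gt0 // subr_gt0.
have lt4 : mu ^+ 2 < 15%:R -> mu < 4%:R by move=> h; nra.
case: ein => [[? ? ? ?]|ein].
  subst; have {}quad := quad isT; rewrite /= in ltmu mu2 lemu2 quad.
  have ha : mu < (13%:R / 4%:R) by lra.
  have hb : mu < (7%:R / 2%:R) by lra.
  by have := roots _ _ ha hb; lra.
case: ein => [[? ? ? ?]|ein].
  subst; have {}quad := quad isT; rewrite /= in ltmu mu2 lemu2 quad.
  have ha : mu < (13%:R / 4%:R) by lra.
  have hb : mu < (7%:R / 2%:R) by lra.
  by have := roots _ _ ha hb; lra.
case: ein => [[? ? ? ?]|ein].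
  subst; have {}quad := quad isT; rewrite /= in ltmu mu2 lemu2 quad.
  have ha : mu < (77%:R / 24%:R) by lra.
  have hb : mu < (13%:R / 4%:R) by lra.
  by have := roots _ _ ha hb; lra.
case: ein => [[? ? ? ?]|ein].
  subst; have {}quad := quad isT; rewrite /= in ltmu mu2 lemu2 quad.
  have ha : mu < (13%:R / 4%:R) by lra.
  have hb : mu < (13%:R / 4%:R) by lra.
  by have := roots _ _ ha hb; lra.
case: ein => [[? ? ? ?]|ein].
  subst; have {}quad := quad isT; rewrite /= in ltmu mu2 lemu2 quad.
  have ha : mu < (18%:R / 5%:R) by lra.
  have hb : mu < (6%:R) by lra.
  by have := roots _ _ ha hb; lra.
case: ein => [[? ? ? ?]|ein].
  subst; have {}quad := quad isT; rewrite /= in ltmu mu2 lemu2 quad.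
  have ha : mu < (4%:R - Num.sqrt 3%:R / 3%:R) by lra.
  have hb : mu < (4%:R + Num.sqrt 3%:R / 3%:R) by lra.
  by have := roots _ _ ha hb; nra.
case: ein => [[? ? ? ?]|ein].
  subst; have {}quad := quad isT; rewrite /= in ltmu mu2 lemu2 quad.
  have ha : mu < (18%:R / 5%:R) by lra.
  have hb : mu < (15%:R / 4%:R) by lra.
  by have := roots _ _ ha hb; lra.
case: ein => [[? ? ? ?]|ein].
  subst; have {}quad := quad isT; rewrite /= in ltmu mu2 lemu2 quad.
  have ha : mu < (15%:R / 4%:R) by lra.
  have hb : mu < (47%:R / 12%:R) by lra.
  by have := roots _ _ ha hb; lra.
case: ein => [[? ? ? ?]|ein].
  subst; have {}quad := quad isT; rewrite /= in ltmu mu2 lemu2 quad.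
  have {}lt4 : mu < 4%:R by apply: lt4; lra.
  have ha : mu < (4%:R) by lra.
  have hb : mu < (4%:R) by lra.
  by have := roots _ _ ha hb; lra.
case: ein => [[? ? ? ?]|ein].
  subst; have {}quad := quad isT; rewrite /= in ltmu mu2 lemu2 quad.
  have {}lt4 : mu < 4%:R by apply: lt4; lra.
  have ha : mu < (4%:R) by lra.
  have hb : mu < (4%:R) by lra.
  by have := roots _ _ ha hb; lra.
case: ein => [[? ? ? ?]|ein].
  subst; have {}quad := quad isT; rewrite /= in ltmu mu2 lemu2 quad.
  have ha : mu < ((26%:R - Num.sqrt 13%:R) / 6%:R) by lra.
  have hb : mu < ((26%:R + Num.sqrt 13%:R) / 6%:R) by lra.
  by have := roots _ _ ha hb; nra.
case: ein => [[? ? ? ?]|ein].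
  subst; have {}quad := quad isT; rewrite /= in ltmu mu2 lemu2 quad.
  have {}lt4 : mu < 4%:R by apply: lt4; lra.
  have ha : mu < (25%:R / 6%:R) by lra.
  have hb : mu < (9%:R / 2%:R) by lra.
  by have := roots _ _ ha hb; lra.
by [].
Qed.

End RealBound.

(** * Submaximal curves and the SHGH hypothesis *)

Section Submaximal.
Variables (R : realType) (r : nat).
Local Notation C := R[i].
Variable p : 'M[C]_(r, 3).
Implicit Types (D A B : curve p) (x : blowup p) (mu : R).

Definition SHGH_at : Prop :=
  forall (d t : nat) (m : 'I_r -> nat), (1 <= d)%N -> (1 <= t)%N ->
    'C(d.+2, 2)%:Z - \sum_(i < r) 'C((m i).+1, 2)%:Z
      <= Num.max ('C(t.+1, 2)%:Z - 2) 0 ->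
    forall D, in_system D d (fun i => (m i)%:Z) ->
      (exists x, mult_at D x = t%:Z) -> non_reduced D.

Definition degree mu D : R := mu * (cdeg D)%:R - (\sum_i cmul D i)%:~R.

Lemma intersection_degree mu D :
  intersection (uniform_divisor r mu) (class_of D) = degree mu D.
Proof.
rewrite /intersection /degree /=; congr (_ - _); rewrite rmorph_sum /=.
by apply: eq_bigr => i _; rewrite mul1r.
Qed.

Lemma intersection_uniform mu :
  intersection (uniform_divisor r mu) (uniform_divisor r mu) = mu ^+ 2 - r%:R.
Proof.
rewrite /intersection /= -expr2; congr (_ - _).
rewrite (eq_bigr (fun=> 1)) => [|i _]; last by rewrite mulr1.
by rewrite sumr_const card_ord.
Qed.

Lemma degree_sum mu D A B : is_sum D A B -> degree mu D = degree mu A + degree mu B.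
Proof.
move=> S; rewrite /degree (cdeg_sum S) natrD mulrDr addrACA -opprD -intrD -big_split.
by congr (_ - _%:~R); case: S => _ S; apply: eq_bigr => i _; rewrite S.
Qed.

Lemma bin2_double n : ('C(n.+1, 2) * 2 = n.+1 * n)%N.
Proof. by elim: n => // n IH; rewrite binS bin1 mulnDl IH; lia. Qed.

(** The contrapositive of the hypothesis, doubled to clear the binomials. Strictness between
    integers gains 2 after doubling; the maximum is 0 for t = 1 and ['C(t.+1, 2) - 2] for larger
    t. *)
Lemma integral_chi D x (t : nat) : SHGH_at -> integral_curve D ->
  (0 < cdeg D)%N -> (forall i, 0 <= cmul D i) -> mult_at D x = t%:Z -> (0 < t)%N ->
  (let S := \sum_i `|cmul D i| * `|cmul D i| in let M := \sum_i `|cmul D i| in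
  let d := cdeg D in
  if t == 1 then S + M <= d * d + 3 * d else S + M + t * t + t <= d * d + 3 * d + 4)%N.
Proof.
set S := (\sum_i _ * _)%N; set M := (\sum_i _)%N; set d := cdeg D; rewrite /= -/d.
move=> shgh iD d0 pos Et t0; pose m i := `|cmul D i|%N.
have mE i : cmul D i = (m i)%:Z by rewrite /m gez0_abs.
have chi : ~ ('C(d.+2, 2)%:Z - \sum_(i < r) 'C((m i).+1, 2)%:Z
      <= Num.max ('C(t.+1, 2)%:Z - 2) 0).
  move=> le; apply: (integral_not_non_reduced iD).
  by apply: (shgh d t m) => //; exists x.
move/negP: chi; rewrite -ltNge gt_max => /andP[c1 c2].
have Es : (\sum_(i < r) 'C((m i).+1, 2)%:Z) * 2 = S%:Z + M%:Z.
  rewrite mulr_suml /S /M -PoszD -big_split /= -[RHS]/(Posz _).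
  rewrite (big_morph Posz PoszD (erefl _)); apply: eq_bigr => i _.
  by rewrite -[2]/(Posz 2) -PoszM bin2_double mulSn addnC.
have Ed := bin2_double d.+1; have Et' := bin2_double t.
move: (\sum_(i < r) _) Es c1 c2 => s Es c1 c2.
by case: eqP => [t1|_]; [subst t|]; nia.
Qed.

(** Summation of (m_i - k) (m_i - k - 1) >= 0, a product of consecutive integers. *)
Lemma balanced_multiplicities (m : 'I_r -> nat) k :
  (k.*2.+1 * (\sum_i m i) <= \sum_i m i * m i + r * (k * k.+1))%N.
Proof.
have -> : (r * (k * k.+1) = \sum_(i < r) k * k.+1)%N by rewrite sum_nat_const card_ord.
rewrite big_distrr -big_split /=; apply: leq_sum => i _.
case: (leqP (m i) k) => h; [have [u ->] : exists u, k = (m i + u)%N by exists (k - m i)%N; lia|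
  have [u ->] : exists u, m i = (k + u.+1)%N by exists (m i - k.+1)%N; lia]; nia.
Qed.

Lemma degree_gt mu D x : SHGH_at -> (10 <= r)%N ->
  Num.sqrt r%:R <= mu -> mu < threshold_value R r ->
  integral_curve D -> 0 < mult_at D x ->
  (mult_at D x)%:~R * Num.sqrt (mu ^+ 2 - r%:R) < degree mu D.
Proof.
move=> shgh r10 lemu ltmu iD t0; case: (integral_cases iD) => [[i [d0 mE]]|[d0 pos]].
  have := mult_at_exceptional x d0 mE; case: on_exc => Et; last by rewrite Et in t0.
  rewrite Et mul1r /degree d0 mulr0 sub0r (bigD1 i) //= mE big1 => [|k ne]; last first.
    by rewrite mE /exc_mul (negbTE ne).
  rewrite /exc_mul eqxx addr0 mulrNz opprK.
  have [th0 th2] := sqr_threshold_le R r10.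
  have mu0 : 0 <= mu by apply: le_trans lemu; apply: sqrtr_ge0.
  have mu2 : mu ^+ 2 < r.+1%:R.
    by apply: lt_le_trans th2; rewrite ltr_sqr ?nnegrE.
  by rewrite -[X in _ < X]sqrtr1 ltr_sqrt ?ltr01 // ltrBlDl natr1.
have [t Et] : exists t : nat, mult_at D x = t%:Z by exists `|mult_at D x|%N; lia.
rewrite Et in t0 *; have chi := integral_chi shgh iD d0 pos Et t0.
have := numeric_bound (R := R) r10 d0 t0 (balanced_multiplicities _) chi lemu ltmu.
rewrite /degree; congr (_ < _ - _); rewrite !rmorph_sum /=.
by apply: eq_bigr => i _; rewrite -[in RHS](gez0_abs (pos i)).
Qed.

Lemma no_weakly_submaximal mu : SHGH_at -> (10 <= r)%N ->
  Num.sqrt r%:R <= mu -> mu < threshold_value R r -> ~ admits_weakly_submaximal p mu.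
Proof.
move=> shgh r10 lemu ltmu [D [iD [x [t0]]]].
rewrite intersection_degree intersection_uniform ler_pdivrMr ?ltr0z // mulrC.
by rewrite leNgt (degree_gt shgh).
Qed.

(* A component on which degree - q * mult_x is nonpositive has positive
   multiplicity at x, for otherwise it would be submaximal at mu = sqrt r. *)
Lemma weakly_submaximal_of_effective mu D x : is_config p -> SHGH_at -> (10 <= r)%N ->
  Num.sqrt r%:R < threshold_value R r -> Num.sqrt r%:R <= mu ->
  ~ zero_divisor D ->
  degree mu D <= (mult_at D x)%:~R * Num.sqrt (mu ^+ 2 - r%:R) ->
  admits_weakly_submaximal p mu.
Proof.
move=> cp shgh r10 ltth lemu nz; set q := Num.sqrt _ => le.
pose phi A := degree mu A - (mult_at A x)%:~R * q.
have [A B E S||E iE leE] := @integral_component _ _ p phi _ D nz.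
  by rewrite /phi (degree_sum _ S) (mult_at_sum _ S) intrD mulrDl opprD addrACA.
  by rewrite /phi subr_le0.
exists E; split=> //; exists x.
rewrite intersection_degree intersection_uniform -/q.
have q0 : 0 <= q by apply: sqrtr_ge0.
have tE : 0 < mult_at E x.
  rewrite ltNge; apply/negP => t0; have degE : degree mu E <= 0.
    move: leE; rewrite /phi subr_le0 => /le_trans; apply.
    by rewrite mulr_le0_ge0 // lerz0.
  case: (integral_cases iE) => [[i [d0 mE]]|[d0 pos]].
    move: degE; rewrite /degree d0 mulr0 sub0r (bigD1 i) //= mE big1 => [|k ne]; last first.
      by rewrite mE /exc_mul (negbTE ne).
    by rewrite /exc_mul eqxx addr0 mulrNz opprK leNgt ltr01.
  have [y ty] := exists_point cp d0.
  have := degree_gt shgh r10 (lexx _) ltth iE ty.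
  rewrite sqr_sqrtr ?ler0n // subrr sqrtr0 mulr0 ltNge => /negP; apply.
  by apply: le_trans degE; rewrite lerD2r ler_wpM2r ?ler0n.
split=> //; rewrite ler_pdivrMr ?ltr0z // mulrC -subr_le0.
exact: leE.
Qed.

Lemma exceptional_weakly_submaximal mu (i : 'I_r) : is_config p ->
  1 <= mu ^+ 2 - r%:R -> admits_weakly_submaximal p mu.
Proof.
move=> cp le; exists (exceptional p i); split; first exact: exceptional_integral.
have [a [b fu]] := exists_frame (cp i); exists (Over fu).
rewrite (mult_at_exceptional (i := i)) //= eqxx; split=> //.
rewrite intersection_degree intersection_uniform divr1 /degree /= mulr0 sub0r.
rewrite (bigD1 i) //= big1 => [|k ne]; last by rewrite /exc_mul (negbTE ne).
rewrite /exc_mul eqxx addr0 mulrNz opprK -[X in X <= _]sqrtr1.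
by rewrite ler_wsqrtr.
Qed.

End Submaximal.

(** * Multiplicity conditions on forms *)

Section TaylorForms.
Variables (n : nat) (mon : 'I_n -> 'X_{1..3}).

(* The coefficient of X^al in F (q + X), where F = \sum_k c_k X^(mon k). *)
Definition taylor (A : comNzRingType) (q : 'I_3 -> A) (al : 'X_{1..3}) (c : 'I_n -> A) : A :=
  \sum_k c k * \prod_(j < 3) (q j ^+ (mon k j - al j) *+ 'C(mon k j, al j)).

Lemma taylor_morph (A B : comNzRingType) (f : {rmorphism A -> B}) q al c :
  f (taylor q al c) = taylor (f \o q) al (f \o c).
Proof.
rewrite /taylor rmorph_sum; apply: eq_bigr => k _.
rewrite rmorphM rmorph_prod; congr (_ * _); apply: eq_bigr => j _.
by rewrite rmorphMn rmorphXn.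
Qed.

Lemma eq_taylor (A : comNzRingType) (q q' : 'I_3 -> A) al c c' :
  q =1 q' -> c =1 c' -> taylor q al c = taylor q' al c'.
Proof.
move=> Eq Ec; apply: eq_bigr => k _; rewrite Ec; congr (_ * _).
by apply: eq_bigr => j _; rewrite Eq.
Qed.

Lemma prod3 (A : comNzRingType) (f : 'I_3 -> A) : \prod_j f j = f 0 * f 1 * f 2.
Proof.
rewrite !big_ord_recl big_ord0 mulr1 mulrA.
by congr (_ * f _ * f _); apply: val_inj.
Qed.

Lemma mdeg3 (m : 'X_{1..3}) : mdeg m = (m 0%R + m 1%R + m 2%:R)%N.
Proof.
rewrite mdegE !big_ord_recl big_ord0 addn0 addnA.
by congr (_ + m _ + m _)%N; apply: val_inj.
Qed.

Variables (d : nat).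
Hypothesis mon_deg : forall k, mdeg (mon k) = d.

(* Euler's relation for the derivative of order al. *)
Lemma taylor_euler (A : comNzRingType) (q : 'I_3 -> A) al c : (mdeg al <= d)%N ->
  \sum_j q j * taylor q (al + U_(j))%MM c *+ (al j).+1 = taylor q al c *+ (d - mdeg al).
Proof.
move=> le_d; have exch (j : 'I_3) : q j * taylor q (al + U_(j))%MM c *+ (al j).+1 =
    \sum_k c k * (\prod_(l < 3) (q l ^+ (mon k l - al l) *+ 'C(mon k l, al l))) *+ (mon k j - al j).
  rewrite /taylor mulr_sumr -sumrMnl; apply: eq_bigr => k _.
  rewrite mulrCA -!mulrnAr; congr (_ * _).
  rewrite (bigD1 j) //= [in RHS](bigD1 j) //= -?mulrnAl -?mulrnAr mulrA; congr (_ * _); last first.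
    apply: eq_bigr => l ne; rewrite mnmDE mnm1E eq_sym (negbTE ne) addn0 //.
  rewrite mnmDE mnm1E eqxx addn1 !mulrnAr -!mulrnA.
  have -> : ('C(mon k j, (al j).+1) * (al j).+1 = 'C(mon k j, al j) * (mon k j - al j))%N.
    by rewrite mulnC mul_bin_left mulnC.
  case: (ltnP (al j) (mon k j)) => h; last by rewrite (eqP (_ : mon k j - al j == 0)%N) ?muln0 ?mulr0n ?subn_eq0.
  by rewrite -exprS subnSK.
rewrite (eq_bigr _ (fun j _ => exch j)) exchange_big /taylor -sumrMnl.
apply: eq_bigr => k _; rewrite /= sumrMnr.
have [h|] := boolP [forall j, al j <= mon k j]%N; last first.
  case/forallPn => j; rewrite -ltnNge => lt.
  by rewrite (bigD1 j) //= bin_small // mulr0n mul0r mulr0 !mul0rn.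
congr (_ *+ _); rewrite -(mon_deg k) !mdegE -sumnB // => j _.
exact: (forallP h j).
Qed.

End TaylorForms.

Section Forms.
Variables (K : numFieldType) (n d : nat) (mon : 'I_n -> 'X_{1..3}).
Hypothesis mon_deg : forall k, mdeg (mon k) = d.
Hypothesis mon_inj : injective mon.
Implicit Types (q : 'I_3 -> K) (c : 'I_n -> K).

(** Euler's relation expresses derivatives along a coordinate that is nonzero at q through the
    others. Only the ['C(m.+1, 2)] transversal conditions remain, as is needed for a square
    system. *)
Lemma taylor_transversal q c (j1 : 'I_3) m : (m <= d)%N -> q j1 != 0 ->
  (forall al : 'X_{1..3}, al j1 = 0%N -> (mdeg al < m)%N -> taylor mon q al c = 0) ->
  forall al, (mdeg al < m)%N -> taylor mon q al c = 0.
Proof.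
move=> le_md q0 h al; have [k] := ubnP (al j1).
elim: k al => // k IH al lt_k lt_m.
have [a0|a0] := eqVneq (al j1) 0%N; first exact: h.
have U_le : (U_(j1) <= al)%MM by rewrite lep1mP.
pose be := (al - U_(j1))%MM; have Eal : (be + U_(j1) = al)%MM by rewrite submK.
have deg_be : (mdeg be).+1 = mdeg al by rewrite -Eal mdegD mdeg1 addn1.
have be_j1 : (be j1).+1 = al j1 by rewrite -Eal mnmDE mnm1E eqxx addn1.
have le_bed : (mdeg be <= d)%N by lia.
have := taylor_euler mon_deg q c le_bed.
rewrite (IH be); [|lia|lia]; rewrite mul0rn (bigD1 j1) //= big1 => [|j ne].
  rewrite Eal addr0 be_j1 => /eqP.
  by rewrite -mulr_natr !mulf_eq0 (negbTE q0) pnatr_eq0 (negbTE a0) orbF => /eqP.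
rewrite (IH (be + U_(j))%MM) ?mulr0 ?mul0rn // ?mdegD ?mdeg1; last by lia.
by rewrite mnmDE mnm1E (negbTE ne); lia.
Qed.

Definition form_of c : {mpoly K[3]} := \sum_k c k *: 'X_[mon k].

Lemma form_of_homog c : form_of c \is d.-homog.
Proof.
apply: rpred_sum => k _; apply: dhomogZ; rewrite dhomogX; exact/eqP/mon_deg.
Qed.

Lemma mcoeff_form_of c k : (form_of c)@_(mon k) = c k.
Proof.
rewrite /form_of raddf_sum (bigD1 k) //= mcoeffZ mcoeffX eqxx mulr1 big1 ?addr0 //.
by move=> l ne; rewrite mcoeffZ mcoeffX (inj_eq mon_inj) (negbTE ne) mulr0.
Qed.

Lemma mcoeff_shift_form q al c :
  (form_of c \mPo [tuple (q i)%:MP + 'X_i | i < 3])@_al = taylor mon q al c.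
Proof.
rewrite /form_of rmorph_sum raddf_sum; apply: eq_bigr => k _ /=.
rewrite comp_mpolyZ mcoeffZ mcoeff_shift msuppX big_seq1 mcoeffX eqxx mul1r.
by [].
Qed.

Lemma shift_neq0 (F : {mpoly K[3]}) q : F != 0 ->
  F \mPo [tuple (q i)%:MP + 'X_i | i < 3] != 0.
Proof.
move=> F0; apply: contraNneq F0 => E.
have -> : F = (F \mPo [tuple (q i)%:MP + 'X_i | i < 3]) \mPo
    [tuple 'X_i - (q i)%:MP | i < 3].
  elim/mpoly_alg_ind: F {E} => [a|i|F G EF EG|F G EF EG].
  - by rewrite !comp_mpolyC.
  - rewrite comp_mpolyXU -tnth_nth tnth_mktuple comp_mpolyD comp_mpolyC.
    by rewrite comp_mpolyXU -tnth_nth tnth_mktuple addrC subrK.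
  - by rewrite !comp_mpolyD -EF -EG.
  - by rewrite !rmorphM /= -EF -EG.
by rewrite E comp_mpoly0.
Qed.

Lemma mult_P2_geP c (q : 'rV[K]_3) m : form_of c != 0 -> reflect
  (forall al, (mdeg al < m)%N -> taylor mon (fun j => q 0 j) al c = 0)
  (m <= mult_P2 (form_of c) q)%N.
Proof.
move=> F0; rewrite /mult_P2.
apply: (iffP (ord0_geP _ (shift_neq0 _ F0))) => h al.
  rewrite -mcoeff_shift_form => lt; apply/eqP; rewrite mcoeff_eq0.
  by apply/negP => /h; rewrite leqNgt lt.
rewrite leqNgt -[al \in _]negbK -mcoeff_eq0 mcoeff_shift_form => nz.
by apply/negP => /h E; rewrite E eqxx in nz.
Qed.

Lemma taylor_scale (s : K) q al c :
  s ^+ mdeg al * taylor mon (fun j => s * q j) al c = s ^+ d * taylor mon q al c.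
Proof.
rewrite /taylor !mulr_sumr; apply: eq_bigr => k _; rewrite !(mulrCA _ (c k)).
congr (_ * _); rewrite -(mon_deg k) !mdegE !expr_sum -!big_split.
apply: eq_bigr => j _ /=; case: (leqP (al j) (mon k j)) => h; last first.
  by rewrite bin_small // !mulr0n !mulr0.
rewrite exprMn -mulrnAr mulrA -exprD subnKC //.
Qed.

End Forms.

Section LinearSubstitution.
Variable K : numFieldType.

(** Used to compare the multiplicity of the affine cone with that of its slice by a chart of the
    blow-up. *)
Lemma ord0_linear n k (G : {mpoly K[n]}) (L : n.-tuple {mpoly K[k]}) :
  (forall i, tnth L i \is 1.-homog) -> G != 0 -> G \mPo L != 0 ->
  (ord0_mpoly G <= ord0_mpoly (G \mPo L))%N.
Proof.
move=> hL G0 GL0; apply/ord0_geP => // al alG; rewrite leqNgt; apply/negP => lt.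
move: alG; rewrite -[_ \in _]negbK -mcoeff_eq0 comp_mpolyEX raddf_sum /=.
rewrite big_seq big1 ?eqxx // => m mG; rewrite mcoeffZ comp_mpolyX.
suff -> : (\prod_(i < n) tnth L i ^+ m i)@_al = 0 by rewrite mulr0.
have hm : \prod_(i < n) tnth L i ^+ m i \is (mdeg m).-homog.
  rewrite mdegE; apply: (big_ind2 (fun (P : {mpoly K[k]}) e => P \is e.-homog)).
  - exact: dhomog1.
  - by move=> P e Q f hP hQ; apply: dhomogM.
  - by move=> i _; have := dhomogMn (m i) (hL i); rewrite mul1n.
apply: (dhomog_nemf_coeff hm); rewrite /= ltn_eqF //.
apply: (leq_trans lt).
by have /(ord0_geP _ G0) := leqnn (ord0_mpoly G); apply.
Qed.

End LinearSubstitution.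

Definition triple (a b c : nat) : 'X_{1..3} := [multinom nth 0%N [:: a; b; c] j | j < 3].

Lemma tripleE a b c :
  (triple a b c 0 = a) * (triple a b c 1 = b) * (triple a b c 2 = c).
Proof. by rewrite !mnmE. Qed.

Lemma mdeg_triple a b c : mdeg (triple a b c) = (a + b + c)%N.
Proof. by rewrite mdeg3 !tripleE. Qed.

Lemma triple_eta (m : 'X_{1..3}) : m = triple (m 0) (m 1) (m 2).
Proof. by apply/mnmP; apply: ord3P; rewrite tripleE. Qed.

Lemma forall_mem_cat4 (T : eqType) (s : seq T) a b c e (Q : T -> Prop) :
  (forall x, x \in s ++ [:: a; b; c; e] -> Q x) <->
  [/\ forall x, x \in s -> Q x, Q a, Q b, Q c & Q e].
Proof.
split=> [h|[h1 h2 h3 h4 h5] x].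
  by split=> [x xs||||]; apply: h; rewrite mem_cat ?xs // !inE eqxx ?orbT.
rewrite mem_cat !inE => /orP[/h1//|]; by case/or4P => /eqP ->.
Qed.

(** * The square system for a nodal member of a pencil *)

Section NodalMember.
Variables (R : realType) (r d n : nat) (m : 'I_r -> nat) (mon : 'I_n -> 'X_{1..3}).
Local Notation C := R[i].
Hypothesis mon_deg : forall k, mdeg (mon k) = d.
Hypothesis mon_inj : injective mon.
Hypothesis d2 : (2 <= d)%N.
Hypothesis m_le : forall i, (m i <= d)%N.
Hypothesis nE : n = (\sum_i 'C((m i).+1, 2) + 2)%N.
Variables (p0 : 'M[C]_(r, 3)) (c0 : 'I_n -> C) (k0 k1 : 'I_n).

Definition passes (p : 'M[C]_(r, 3)) (c : 'I_n -> C) : Prop :=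
  forall i a b, (a + b < m i)%N -> taylor mon (fun j => p i j) (triple a 0 b) c = 0.

(** The coefficient of y^b z^c in the local equation at (1 : 0 : 0); for b + c = 2 these are the
    coefficients of the tangent cone. *)
Definition hessian (b c : nat) : C := \sum_(k | (mon k 1 == b) && (mon k 2 == c)) c0 k.

Hypothesis p0_1 : forall i, p0 i 1 = 1.
Hypothesis c0_k0 : c0 k0 != 0.
Hypothesis c0_passes : passes p0 c0.
Hypothesis c0_node : forall k, (d <= (mon k 0%R).+1)%N -> c0 k = 0.
Hypothesis mon_k1 : mon k1 0 = d.
(** The coefficient at [k0] is fixed by normalisation, and the one at [k1], belonging to x^d, is the
    value at (1 : 0 : 0). The hypothesis says that these two separate the members of the pencil. *)
Hypothesis kernel : forall c, passes p0 c -> c k0 = 0 -> c k1 = 0 -> forall k, c k = 0.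
Hypothesis hess : hessian 1 1 ^+ 2 != 4%:R * hessian 2 0 * hessian 0 2.

Local Notation N := (n + 2)%N.
Local Notation A := {mpoly C[r * 3 + N]}.

Let pv (i : 'I_r) (j : 'I_3) : A := 'X_(lshift N (mxvec_index i j)).
Let cv (k : 'I_n) : A := 'X_(rshift (r * 3) (lshift 2 k)).
Let yv : A := 'X_(rshift (r * 3) (rshift n (0 : 'I_2))).
Let zv : A := 'X_(rshift (r * 3) (rshift n (1 : 'I_2))).
Let qv (j : 'I_3) : A := [:: 1; yv; zv]`_j.

Let conds : seq ('I_r * (nat * nat)) :=
  [seq (i, ab) | i <- enum 'I_r, ab <- [seq (a, b) | a <- iota 0 (m i), b <- iota 0 (m i - a)]].

Let condsP i a b : reflect (a + b < m i)%N ((i, (a, b)) \in conds).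
Proof.
apply: (iffP allpairsPdep) => [[i' [ab [_ /allpairsPdep[a' [b' [ha hb ->]]] [-> -> ->]]]]|lt].
  by move: ha hb; rewrite !mem_iota; lia.
exists i, (a, b); split=> //; first by rewrite mem_enum.
by apply/allpairsPdep; exists a, b; split=> //; rewrite mem_iota; lia.
Qed.

Let size_conds : (size conds + 2 = n)%N.
Proof.
rewrite nE; congr (_ + 2)%N; rewrite size_allpairs_dep sumnE big_map big_enum /=.
apply: eq_bigr => i _; rewrite size_allpairs_dep.
elim: (m i) => // k IH; rewrite binS bin1 -IH [RHS]addnC /= (iotaDl 1 0) -!map_comp size_map size_iota.
by congr (_ + sumn _)%N; apply: eq_map.
Qed.

(** There are n - 2 conditions at the points, one normalisation and three equations for a singular
    point at (1 : y : z), for the n coefficients together with y and z. *)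
Let es : seq A :=
  [seq taylor mon (pv x.1) (triple x.2.1 0 x.2.2) cv | x <- conds] ++
  [:: cv k0 - (c0 k0)%:MP; taylor mon qv (triple 0 0 0) cv;
      taylor mon qv (triple 0 1 0) cv; taylor mon qv (triple 0 0 1) cv].

Let size_es : size es = N.
Proof. by have := size_conds; rewrite size_cat size_map /=; lia. Qed.

Let f (l : 'I_N) : A := es`_l.

Let fP (Q : A -> Prop) : (forall l, Q (f l)) <-> (forall e, e \in es -> Q e).
Proof.
split=> [h e /(nthP 0)[l lt <-]|h l]; last by apply: h; rewrite mem_nth ?size_es.
by rewrite size_es in lt; have := h (Ordinal lt).
Qed.

(** The first factor keeps the node (1 : y : z) away from p_i; the second makes the conditions
    without y-derivatives sufficient at p_i. *)
Let g : A := \prod_i ((pv i 1 - yv * pv i 0) * pv i 1).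

Let esP (Q : A -> Prop) : (forall e, e \in es -> Q e) <->
  [/\ forall i a b, (a + b < m i)%N -> Q (taylor mon (pv i) (triple a 0 b) cv),
      Q (cv k0 - (c0 k0)%:MP), Q (taylor mon qv (triple 0 0 0) cv),
      Q (taylor mon qv (triple 0 1 0) cv) & Q (taylor mon qv (triple 0 0 1) cv)].
Proof.
split=> [/forall_mem_cat4[h1 h2 h3 h4 h5]|[h1 h2 h3 h4 h5]].
  split; [|exact: h2|exact: h3|exact: h4|exact: h5] => i a b lt.
  by apply: h1; apply/mapP; exists (i, (a, b)) => //; apply/condsP.
apply/forall_mem_cat4; split; [|exact: h2|exact: h3|exact: h4|exact: h5] => e.
case/mapP => -[i [a b]] /condsP lt ->; exact: (h1 i a b lt).
Qed.

Let v0 (k : 'I_(r * 3 + N)) : C :=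
  match split k with
  | inl i => mxvec p0 0 i
  | inr l => match split l with inl k' => c0 k' | inr _ => 0 end
  end.

Let splitl a b (i : 'I_a) : split (lshift b i) = inl i.
Proof. exact: (unsplitK (inl i)). Qed.

Let splitr a b (i : 'I_b) : split (rshift a i) = inr i.
Proof. exact: (unsplitK (inr i)). Qed.

Let v0_p i j : (pv i j).@[v0] = p0 i j.
Proof. by rewrite mevalXU /v0 splitl mxvecE. Qed.

Let v0_c k : (cv k).@[v0] = c0 k.
Proof. by rewrite mevalXU /v0 splitr splitl. Qed.

Let v0_y : yv.@[v0] = 0.
Proof. by rewrite mevalXU /v0 !splitr. Qed.

Let v0_z : zv.@[v0] = 0.
Proof. by rewrite mevalXU /v0 !splitr. Qed.

Let center (j : 'I_3) : C := [:: 1; 0; 0]`_j.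

Let v0_q j : (qv j).@[v0] = center j.
Proof.
by move: j; apply: ord3P; rewrite /qv /center /= ?v0_y ?v0_z ?meval1.
Qed.

Let g0 : g.@[v0] != 0.
Proof.
rewrite rmorph_prod; apply/prodf_neq0 => i _ /=.
by rewrite mevalM mevalB mevalM v0_y mul0r subr0 v0_p p0_1 mulr1 oner_neq0.
Qed.

(* At (1 : 0 : 0) only the monomials with the smallest exponent of x matter. *)
Let taylor_center (b c : nat) (w : 'I_n -> C) :
  taylor mon center (triple 0 b c) w = \sum_(k | (mon k 1 == b) && (mon k 2 == c)) w k.
Proof.
rewrite /taylor [RHS]big_mkcond; apply: eq_bigr => k _.
rewrite prod3 /center /= !tripleE subn0 bin0 expr1n mulr1n mul1r.
have E (a e : nat) : (0 ^+ (a - e) *+ 'C(a, e) : C) = (a == e)%:R.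
  case: (ltngtP a e) => [lt|lt|->]; last by rewrite subnn binn.
    by rewrite bin_small.
  by rewrite expr0n subn_eq0 leqNgt lt mul0rn.
by rewrite !E; do 2 case: eqP => _; rewrite ?mulr1 ?mulr0 ?mul0r.
Qed.

Let c0_low b c : (b + c <= 1)%N ->
  \sum_(k | (mon k 1 == b) && (mon k 2 == c)) c0 k = 0.
Proof.
move=> le1; rewrite big1 // => k /andP[/eqP E1 /eqP E2]; apply: c0_node.
by have := mon_deg k; rewrite mdeg3 E1 E2; lia.
Qed.

Let f0 l : (f l).@[v0] = 0.
Proof.
move: l; apply/(fP (fun e => e.@[v0] = 0))/esP; split=> [i a b lt||||].
- rewrite (taylor_morph _ (meval v0)) -[RHS](c0_passes lt).
  by apply: eq_taylor => [j|k] /=; rewrite ?v0_p ?v0_c.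
- by rewrite mevalB mevalC v0_c subrr.
all: rewrite (taylor_morph _ (meval v0)) (eq_taylor _ _ v0_q v0_c).
all: by rewrite taylor_center c0_low.
Qed.

Section PointDerivation.
Variables (D : A -> C) (dc : 'I_n -> C) (dy dz : C).
Hypothesis DD : forall h1 h2, D (h1 + h2) = D h1 + D h2.
Hypothesis DM : forall h1 h2, D (h1 * h2) = D h1 * h2.@[v0] + h1.@[v0] * D h2.
Hypothesis DC : forall c, D c%:MP = 0.
Hypothesis Dp : forall i j, D (pv i j) = 0.
Hypothesis Dc : forall k, D (cv k) = dc k.
Hypothesis Dy : D yv = dy.
Hypothesis Dz : D zv = dz.

Let D0 : D 0 = 0. Proof. by rewrite -mpolyC0 DC. Qed.

Let D1 : D 1 = 0. Proof. by rewrite -mpolyC1 DC. Qed.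

Let Dsum (I : finType) (F : I -> A) : D (\sum_i F i) = \sum_i D (F i).
Proof. by apply: (big_morph D); [exact: DD|exact: D0]. Qed.

Let DMn h e : D (h *+ e) = D h *+ e.
Proof.
elim: e => [|e IH]; first by rewrite !mulr0n D0.
by rewrite !mulrS DD IH.
Qed.

Let Dexp h e : D (h ^+ e) = h.@[v0] ^+ e.-1 *+ e * D h.
Proof.
elim: e => [|e IH]; first by rewrite expr0 D1 mulr0n mul0r.
rewrite exprS DM IH rmorphXn /= mulrS mulrDl addrC -[in RHS]mulrC.
case: e {IH} => [|e]; first by rewrite !mulr0n !mul0r mulr0 add0r addr0 mulrC.
by rewrite mulrnAl mulrnAr mulrA -exprS addrC mulrnAl.
Qed.

Let weight (q : 'I_3 -> A) al k : A :=
  \prod_(j < 3) (q j ^+ (mon k j - al j) *+ 'C(mon k j, al j)).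

Let D_taylor q al : D (taylor mon q al cv) =
  taylor mon (fun j => (q j).@[v0]) al dc + \sum_k c0 k * D (weight q al k).
Proof.
rewrite /taylor Dsum -big_split; apply: eq_bigr => k _ /=.
rewrite DM v0_c Dc; congr (_ * _ + _).
rewrite rmorph_prod; apply: eq_bigr => j _ /=.
by rewrite mevalMn rmorphXn.
Qed.

Let D_weight_pv i al k : D (weight (pv i) al k) = 0.
Proof.
rewrite /weight; apply: (big_ind (fun h => D h = 0)); first exact: D1.
  by move=> h1 h2 E1 E2; rewrite DM E1 E2 mul0r mulr0 addr0.
by move=> j _; rewrite DMn Dexp Dp mulr0 mul0rn.
Qed.

Let D_weight_qv b c k : D (weight qv (triple 0 b c) k) =
  ((mon k 1 == b.+1) && (mon k 2 == c))%:R * (b.+1%:R * dy) +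
  ((mon k 1 == b) && (mon k 2 == c.+1))%:R * (c.+1%:R * dz).
Proof.
have D2 (Y Z : A) (e1 b1 e2 b2 : nat) :
    D ((1 ^+ (mon k 0 - 0) *+ 'C(mon k 0, 0)) * (Y ^+ e1 *+ b1) * (Z ^+ e2 *+ b2)) =
    (Y.@[v0] ^+ e1.-1 *+ e1 * D Y *+ b1) * (Z.@[v0] ^+ e2 *+ b2) +
    (Y.@[v0] ^+ e1 *+ b1) * (Z.@[v0] ^+ e2.-1 *+ e2 * D Z *+ b2).
  by rewrite expr1n bin0 mulr1n mul1r DM !DMn !Dexp !mevalMn !rmorphXn.
rewrite /weight prod3 !tripleE -[qv 0]/(1 : A) -[qv 1]/yv -[qv 2]/zv D2 Dy Dz v0_y v0_z.
have E (a e : nat) : (0 ^+ (a - e) *+ 'C(a, e) : C) = (a == e)%:R.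
  case: (ltngtP a e) => [lt|lt|->]; last by rewrite subnn binn.
    by rewrite bin_small.
  by rewrite expr0n subn_eq0 leqNgt lt mul0rn.
have E1 (a e : nat) (x : C) : 0 ^+ (a - e).-1 *+ (a - e) * x *+ 'C(a, e) =
    (a == e.+1)%:R * (e.+1%:R * x).
  case: (ltngtP a e.+1) => [lt|lt|->].
  - have -> : (a - e = 0)%N by apply/eqP; rewrite subn_eq0.
    by rewrite mulr0n !mul0r mul0rn.
  - rewrite expr0n; have -> : ((a - e).-1 == 0)%N = false by apply/negbTE; lia.
    by rewrite mul0rn !mul0r mul0rn.
  - by rewrite subSn // subnn binSn mul1r mulr1n mul1r mulr_natl.
have BB (x y : bool) : (x && y)%:R = x%:R * y%:R :> C.
  by case: x; case: y; rewrite ?mul1r ?mul0r.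
rewrite !E !E1 !BB.
move: dy dz => Y Z; ring.
Qed.

Let D_qv b c : D (taylor mon qv (triple 0 b c) cv) =
  \sum_(k | (mon k 1 == b) && (mon k 2 == c)) dc k +
  (b.+1%:R * hessian b.+1 c * dy + c.+1%:R * hessian b c.+1 * dz).
Proof.
rewrite D_taylor -(taylor_center b c dc); congr (_ + _).
  by apply: eq_taylor.
have S (P : pred 'I_n) (x y : C) :
    \sum_k c0 k * ((P k)%:R * (x * y)) = x * (\sum_(k | P k) c0 k) * y.
  rewrite mulr_sumr mulr_suml [RHS]big_mkcond; apply: eq_bigr => k _.
  by case: (P k); rewrite ?mul1r ?mul0r ?mulr0 // mulrCA mulrA.
rewrite /hessian -(S (fun k => (mon k 1 == b.+1) && (mon k 2 == c))).
rewrite -(S (fun k => (mon k 1 == b) && (mon k 2 == c.+1))) -big_split.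
by apply: eq_bigr => k _ /=; rewrite D_weight_qv mulrDr.
Qed.

(** The system is triangular. Moving the node does not change the value there to first order, as the
    gradient vanishes, so that equation and the linear ones involve only [dc] and force it to be 0.
    The two gradient equations then say that the Hessian matrix kills (dy, dz). *)
Lemma tangent_vanishes : (forall l, D (f l) = 0) ->
  [/\ forall k, dc k = 0, dy = 0 & dz = 0].
Proof.
move/(fP (fun e => D e = 0))/esP => [h1 h2 h3 h4 h5].
have dc0 : forall k, dc k = 0.
  apply: kernel.
  - move=> i a b lt; have := h1 i a b lt; rewrite D_taylor big1 => [|k _]; last first.
      by rewrite D_weight_pv mulr0.
    by rewrite addr0 => <-; apply: eq_taylor.
  - by rewrite -[RHS]h2 -[- (c0 k0)%:MP]mulN1r DD DM DC mulr0 -mpolyC1 -mpolyCN DC mul0r !addr0 Dc.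
  - move: h3; rewrite D_qv /hessian !c0_low // !mulr0 !mul0r !addr0 => <-.
    have deg0 k : (mon k 1 == 0%N) && (mon k 2 == 0%N) = (k == k1).
      have := mon_deg k1; rewrite mdeg3 mon_k1 => e1.
      apply/andP/eqP => [[/eqP z2 /eqP z3]|->]; last by split; apply/eqP; lia.
      have := mon_deg k; rewrite mdeg3 => e2.
      by apply: mon_inj; rewrite [mon k]triple_eta [mon k1]triple_eta; congr triple; lia.
    by rewrite (eq_bigl (pred1 k1)) ?big_pred1_eq // => k; rewrite deg0.
have sum0 (P : pred 'I_n) : \sum_(k | P k) dc k = 0 by rewrite big1.
rewrite D_qv sum0 add0r mul1r in h4; rewrite D_qv sum0 add0r mul1r in h5.
have disc : hessian 1 1 ^+ 2 - 4%:R * hessian 2 0 * hessian 0 2 != 0 by rewrite subr_eq0.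
move: (hessian 2 0) (hessian 1 1) (hessian 0 2) h4 h5 disc => A2 A1 A0 h4 h5 disc.
have y0 : dy = 0.
  apply/eqP; have : (A1 ^+ 2 - 4%:R * A2 * A0) * dy = 0.
    have -> : (A1 ^+ 2 - 4%:R * A2 * A0) * dy =
      A1 * (A1 * dy + 2%:R * A0 * dz) - 2%:R * A0 * (2%:R * A2 * dy + A1 * dz) by ring.
    by rewrite h4 h5 !mulr0 subr0.
  by move/eqP; rewrite mulf_eq0 (negbTE disc).
have z0 : dz = 0.
  apply/eqP; have : (A1 ^+ 2 - 4%:R * A2 * A0) * dz = 0.
    have -> : (A1 ^+ 2 - 4%:R * A2 * A0) * dz =
      A1 * (2%:R * A2 * dy + A1 * dz) - 2%:R * A2 * (A1 * dy + 2%:R * A0 * dz) by ring.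
    by rewrite h4 h5 !mulr0 subr0.
  by move/eqP; rewrite mulf_eq0 (negbTE disc).
by split.
Qed.

End PointDerivation.

Let jac0 (w : 'I_N -> C) :
  (forall l, \sum_k w k * ((f l)^`M(rshift (r * 3) k)).@[v0] = 0) -> forall k, w k = 0.
Proof.
pose D (h : A) : C := \sum_k w k * (h^`M(rshift (r * 3) k)).@[v0].
have DD h1 h2 : D (h1 + h2) = D h1 + D h2.
  by rewrite /D -big_split; apply: eq_bigr => k _ /=; rewrite mderivD mevalD mulrDr.
have DM h1 h2 : D (h1 * h2) = D h1 * h2.@[v0] + h1.@[v0] * D h2.
  rewrite /D mulr_suml mulr_sumr -big_split; apply: eq_bigr => k _ /=.
  by rewrite mderivM mevalD !mevalM mulrDr mulrA [w k * (h1.@[v0] * _)]mulrCA.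
have DC c : D c%:MP = 0.
  by rewrite /D big1 // => k _; rewrite mderivC meval0 mulr0.
have Dl i : D 'X_(lshift N i) = 0.
  by rewrite /D big1 // => k _; rewrite mderiv_X eq_rlshift meval0 mulr0.
have Dr l : D 'X_(rshift (r * 3) l) = w l.
  rewrite /D (bigD1 l) //= mderiv_X eqxx meval1 mulr1 [X in _ + X]big1 ?addr0 // => k ne.
  by rewrite mderiv_X (inj_eq (@rshift_inj _ _)) (negbTE ne) meval0 mulr0.
move=> h; have [dc0 y0 z0] := tangent_vanishes DD DM DC (fun i j => Dl _) (fun k => Dr _)
  (Dr _) (Dr _) h.
move=> l; rewrite -(splitK l); case: (split l) => [k|[[|[|//]] hk]] /=; first exact: dc0.
  by rewrite -[RHS]y0; congr w; apply: val_inj.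
by rewrite -[RHS]z0; congr w; apply: val_inj.
Qed.

Let equations_at (v : 'I_(r * 3 + N) -> C) (p : 'M[C]_(r, 3)) :
  (forall i, v (lshift N i) = mxvec p 0 i) -> (forall l, (f l).@[v] = 0) ->
  let c k := (cv k).@[v] in
  let q (j : 'I_3) := [:: 1; yv.@[v]; zv.@[v]]`_j in
  [/\ passes p c, c k0 = c0 k0, taylor mon q (triple 0 0 0) c = 0,
      taylor mon q (triple 0 1 0) c = 0 & taylor mon q (triple 0 0 1) c = 0].
Proof.
move=> vp fv c q; move: fv => /(fP (fun e => e.@[v] = 0))/esP[h1 h2 h3 h4 h5].
have qE j : (qv j).@[v] = q j.
  by move: j; apply: ord3P; rewrite /qv /q /= ?meval1.
have pE i j : (pv i j).@[v] = p i j by rewrite mevalXU vp mxvecE.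
have tE al : (taylor mon qv al cv).@[v] = taylor mon q al c.
  by rewrite (taylor_morph mon (meval v)); apply: eq_taylor.
split.
- move=> i a b lt; have := h1 i a b lt; rewrite (taylor_morph mon (meval v)) => <-.
  by apply: eq_taylor => // j; rewrite /= pE.
- by move: h2; rewrite mevalB mevalC => /eqP; rewrite subr_eq0 => /eqP.
- exact: etrans (esym (tE _)) h3.
- exact: etrans (esym (tE _)) h4.
- exact: etrans (esym (tE _)) h5.
Qed.

Let g_at (v : 'I_(r * 3 + N) -> C) (p : 'M[C]_(r, 3)) :
  (forall i, v (lshift N i) = mxvec p 0 i) -> g.@[v] != 0 ->
  forall i, p i 1 - yv.@[v] * p i 0 != 0 /\ p i 1 != 0.
Proof.
move=> vp gv i; have pE j : (pv i j).@[v] = p i j by rewrite mevalXU vp mxvecE.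
move: gv; rewrite rmorph_prod => /prodf_neq0/(_ i isT) /=.
by rewrite mevalM mevalB mevalM !pE mulf_eq0 negb_or => /andP[].
Qed.

Lemma very_general_nodal_member : very_general (fun p : 'M[C]_(r, 3) =>
  exists D : curve p, in_system D d (fun i => (m i)%:Z) /\ exists x, 2 <= mult_at D x).
Proof.
have [P P0 hP] := generically_solvable f0 g0 jac0.
apply: (very_general_of_poly P0) => p s cp s0 /hP[v [vp fv gv]].
have {vp fv gv} [e1 e2] := (equations_at vp fv, g_at vp gv).
move: (yv.@[v]) (zv.@[v]) (fun k => (cv k).@[v]) e1 e2 => y z c /= [pass ck0 t0 t1 t2] gp.
pose F := form_of mon c.
have F0 : F != 0.
  apply: contraNneq c0_k0 => F0; rewrite -ck0.
  by have := mcoeff_form_of mon_inj c k0; rewrite -/F F0 mcoeff0 => <-.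
have mult_p i : (m i <= mult_P2 F (row i p))%N.
  apply/(mult_P2_geP _ _ F0) => al lt.
  (* The equations hold at the rescaled row; Taylor coefficients at p_i itself differ only by powers
     of s_i. *)
  have T0 : taylor mon (fun j => s i * row i p 0 j) al c = 0.
    move: al lt; apply: (taylor_transversal mon_deg (j1 := 1) (m_le i)).
      by have [_] := gp i; rewrite !mxE.
    move=> al al1; rewrite mdeg3 al1 addn0 => lt; rewrite [al]triple_eta al1.
    by rewrite -[RHS](pass i _ _ lt); apply: eq_taylor => // j; rewrite !mxE.
  have /eqP := taylor_scale mon_deg (s i) (fun j => row i p 0 j) al c.
  by rewrite T0 mulr0 eq_sym mulf_eq0 expf_eq0 (negbTE (s0 i)) andbF => /eqP.
pose q : 'rV[C]_3 := \row_j [:: 1; y; z]`_j.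
pose a : 'rV[C]_3 := delta_mx 0 1; pose b : 'rV[C]_3 := delta_mx 0 2.
have fu : frame q a b \in unitmx.
  apply/frame_unitP => w al be E; have := E 0; rewrite !mxE /= !mulr0 !addr0 mulr1 => w0.
  split=> //; first by have := E 1; rewrite !mxE /= w0 mul0r add0r mulr1 mulr0 addr0.
  by have := E 2; rewrite !mxE /= w0 mul0r add0r mulr0 mulr1 add0r.
have rf i : row_free (col_mx (row i p) q).
  apply/row_free_col_mxP => w al E; have := E 0; have := E 1; rewrite !mxE /= mulr1.
  have [+ _] := gp i; rewrite !mxE => nz E1 E0.
  have Eal : al = - (w * p i 0) by apply/eqP; rewrite -addr_eq0 addrC E0.
  have w0 : w = 0.
    apply/eqP; have : w * (s i * p i 1 - y * (s i * p i 0)) = 0.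
      have -> : w * (s i * p i 1 - y * (s i * p i 0)) =
        s i * (w * p i 1 - w * p i 0 * y) by ring.
      by rewrite -mulNr -Eal E1 mulr0.
    by move/eqP; rewrite mulf_eq0 (negbTE nz) orbF.
  by rewrite Eal w0 mul0r oppr0.
have mle i : (m i)%:Z <= (mult_P2 F (row i p))%:Z by rewrite lez_nat.
exists (Curve F0 (form_of_homog mon_deg c) mle); split=> //.
exists (Away fu rf); rewrite /mult_at big_pred0 // subr0.
(* The chart is the plane slice q + u a + v b of the affine cone: the pull-back is the translated
   form restricted along [L], which cannot lower the order. *)
pose L := [tuple (a 0 j)%:MP * 'X_ord0 + (b 0 j)%:MP * 'X_ord_max : {mpoly C[2]} | j < 3].
have hL i : tnth L i \is 1.-homog.
  rewrite tnth_mktuple !mul_mpolyC.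
  by apply: dhomogD; apply: dhomogZ; rewrite dhomogX; apply/eqP; apply: mdeg1.
have pb : pullback (Away fu rf) F = (F \mPo [tuple (q 0 j)%:MP + 'X_j | j < 3]) \mPo L.
  rewrite /=; elim/mpoly_alg_ind: (F) => [e|j|G H EG EH|G H EG EH].
  - by rewrite !comp_mpolyC.
  - rewrite !comp_mpolyXU -!tnth_nth !tnth_mktuple comp_mpolyD comp_mpolyC comp_mpolyXU.
    by rewrite -tnth_nth tnth_mktuple addrA.
  - by rewrite !comp_mpolyD EG EH.
  - by rewrite !rmorphM /= EG EH.
have pb0 := pullback_neq0 (Away fu rf) F0 (form_of_homog mon_deg c).
rewrite lez_nat /= -/(pullback (Away fu rf) F) pb; rewrite pb in pb0.
apply: leq_trans (ord0_linear hL (shift_neq0 _ F0) pb0).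
rewrite -[ord0_mpoly _]/(mult_P2 F q).
apply/(mult_P2_geP _ _ F0).
apply: (taylor_transversal mon_deg (j1 := 0) d2); first by rewrite mxE oner_neq0.
move=> al al0; rewrite mdeg3 al0 add0n => lt.
have qE : (fun j => q 0 j) =1 (fun j => [:: 1; y; z]`_j) by move=> j; rewrite mxE.
rewrite (eq_taylor _ _ qE (fun=> erefl)) [al]triple_eta al0.
case: (al 1) (al 2) lt => [|[|k1']] [|[|k2']] lt; [exact: t0|exact: t2|by move: lt; clear; lia|exact: t1|..].
all: by move: lt; clear; lia.
Qed.

End NodalMember.

(** * Trivial kernels certified modulo a prime *)

Section ModularInverse.
Local Notation row := (seq Z).

Fixpoint find_pivot (rs : seq row) : option (row * seq row) :=
  if rs is s :: rs' then
    if Z.eqb (head 0 s) 0 then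
      if find_pivot rs' is Some (p, t) then Some (p, s :: t) else None
    else Some (s, rs')
  else None.

(* Gauss-Jordan elimination modulo the prime q. *)
Fixpoint eliminate (q : Z) (k : nat) (done rest : seq row) : seq row :=
  if k is k'.+1 then
    if find_pivot rest is Some (s, t) then
      let inv := Z.modulo (Z.pow (head 0 s) (Z.sub q (Zpos 2))) q in
      let s' := [seq Z.modulo (Z.mul x inv) q | x <- behead s] in
      let reduce u := [seq Z.modulo (Z.sub xy.1 (Z.mul (head 0 u) xy.2)) q | xy <- zip (behead u) s'] in
      eliminate q k' (rcons (map reduce done) s') (map reduce t)
    else [::]
  else done.

Definition entry (M : seq row) (i k : nat) : Z := nth 0 (nth [::] M i) k.

Definition modular_inverse (q : Z) (n : nat) (M : seq row) : seq row :=
  eliminate q n [::]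
    [seq [seq Z.modulo x q | x <- nth [::] M i] ++
         [seq if i == j then 1 else 0 | j <- iota 0 n] | i <- iota 0 n].

Definition sumZ (n : nat) (F : nat -> Z) : Z := foldr (fun k s => Z.add (F k) s) 0 (iota 0 n).

Lemma sumZE n F : sumZ n F = \sum_(k < n) F k.
Proof.
rewrite /sumZ -(big_mkord xpredT F) /index_iota subn0.
by elim: (iota 0 n) => [|k s IH] /=; rewrite ?big_nil ?big_cons ?IH.
Qed.

(** Multiplying out certifies the inverse, so the correctness of the elimination itself is never at
    issue. *)
Definition invertible_mod (q : Z) (n : nat) (M : seq row) : bool :=
  let L := modular_inverse q n M in
  all (fun i => all (fun k =>
    Z.eqb (Z.modulo (Z.sub (sumZ n (fun j => Z.mul (entry L i j) (entry M j k)))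
      (if i == k then 1 else 0)) q) 0) (iota 0 n)) (iota 0 n).

Variable R : realType.
Definition Z_to_C (z : Z) : R[i] := (int_of_Z z)%:~R.

Lemma Z_to_C_eq0 z : (Z_to_C z == 0) = (z == 0).
Proof. by rewrite /Z_to_C intr_eq0 -(inj_eq (can_inj int_of_ZK)). Qed.

Lemma Z_to_C_morph : (zmod_morphism Z_to_C * monoid_morphism Z_to_C)%type.
Proof.
split=> [x y|]; first by rewrite /Z_to_C rmorphB intrB.
by split=> [|x y]; rewrite /Z_to_C ?rmorph1 // rmorphM intrM.
Qed.

HB.instance Definition _ := GRing.isZmodMorphism.Build Z R[i] Z_to_C Z_to_C_morph.1.
HB.instance Definition _ := GRing.isMonoidMorphism.Build Z R[i] Z_to_C Z_to_C_morph.2.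

(** A left inverse modulo q makes the determinant a unit modulo q; it is then a nonzero integer, and
    so nonzero in the complex numbers. *)
Lemma invertible_mod_kernel (q : nat) n (M : seq row) (c : 'I_n -> R[i]) :
  (1 < q)%N -> invertible_mod (Z.of_nat q) n M ->
  (forall j : 'I_n, \sum_k c k * Z_to_C (entry M j k) = 0) -> forall k, c k = 0.
Proof.
move=> q1 inv Mc.
pose MZ : 'M[Z]_n := \matrix_(j, k) entry M j k.
pose LZ : 'M[Z]_n := \matrix_(i, j) entry (modular_inverse (Z.of_nat q) n M) i j.
pose h : Z -> 'Z_q := fun z => (int_of_Z z)%:~R.
have hB : {morph h : x y / x - y} by move=> x y; rewrite /h rmorphB intrB.
have hM : {morph h : x y / x * y} by move=> x y; rewrite /h rmorphM intrM.
have h1 : h 1 = 1 by [].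
have hq z : h (Z.of_nat q * z) = 0.
  have Eq : h (Z.of_nat q) = 0.
    rewrite /h (_ : int_of_Z (Z.of_nat q) = q%:Z); last by lia.
    by rewrite -pmulrn char_Zp.
  by rewrite hM Eq mul0r.
have prod1 : map_mx (fun z => (int_of_Z z)%:~R : 'Z_q) (LZ *m MZ) = 1%:M.
  apply/matrixP => i k; rewrite 2!mxE.
  have /allP/(_ (i : nat)) := inv; rewrite mem_iota ltn_ord => /(_ isT).
  move/allP/(_ (k : nat)); rewrite mem_iota ltn_ord => /(_ isT)/Z.eqb_spec.
  rewrite sumZE (eq_bigr (fun j => LZ i j * MZ j k)) => [|j _]; last by rewrite !mxE.
  move: (\sum_j _) => x /Z.mod_divide[|y Ey]; first by lia.
  set dl := (if _ then _ else _) in Ey.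
  have -> : x = dl - Z.of_nat q * (- y).
    rewrite mulrN opprK; move: Ey; rewrite /GRing.add /GRing.mul /=; lia.
  rewrite -/(h _) hB hq subr0 mxE /dl -val_eqE.
  by case: (_ == _); rewrite ?h1 ?mulr1n ?mulr0n.
have det0 : \det MZ != 0.
  apply/eqP => d0; have := congr1 determinant prod1.
  rewrite det1 (det_map_mx (intr \o int_of_Z : {rmorphism Z -> 'Z_q})) det_mulmx d0.
  by rewrite mulr0 rmorph0 => /esym/eqP; rewrite oner_eq0.
have unitM : map_mx Z_to_C MZ \in unitmx.
  by rewrite unitmxE (det_map_mx Z_to_C) unitfE Z_to_C_eq0.
have c0 : \col_k c k = 0 :> 'cV_n.
  rewrite -[LHS](mulKmx unitM) (_ : map_mx Z_to_C MZ *m _ = 0) ?mulmx0 //.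
  apply/colP => j; rewrite !mxE -[RHS](Mc j); apply: eq_bigr => k _.
  by rewrite ?mxE mulrC.
by move=> k; have /colP/(_ k) := c0; rewrite !mxE.
Qed.

End ModularInverse.

(** * Computable certificates for nodal members *)

Section ExplicitNodalMember.
Local Notation point := (Z * Z * nat)%type.

(* (a, b) stands for x^a y^b z^(d - a - b). *)
Definition monomials (d : nat) : seq (nat * nat) :=
  [seq (a, b) | a <- iota 0 d.+1, b <- iota 0 (d - a).+1].

Definition monomial (d : nat) (k : 'I_(size (monomials d))) : 'X_{1..3} :=
  let e := nth (0, 0)%N (monomials d) k in triple e.1 e.2 (d - e.1 - e.2).

Lemma monomial_deg d k : mdeg (@monomial d k) = d.
Proof.
rewrite mdeg_triple; set e := nth _ _ _.
have : e \in monomials d by apply: mem_nth.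
by case/allpairsPdep => a [b [ha hb ->]] /=; move: ha hb; rewrite !mem_iota; lia.
Qed.

Lemma monomial_inj d : uniq (monomials d) -> injective (@monomial d).
Proof.
move=> u k l /mnmP E; have := E 0; have := E 1; rewrite /monomial !tripleE => E1 E0.
apply/val_inj/eqP; rewrite -(nth_uniq (0, 0)%N (ltn_ord k) (ltn_ord l) u).
by apply/eqP; rewrite [LHS]surjective_pairing [RHS]surjective_pairing E0 E1.
Qed.

(* The coefficient of u^a v^b in the monomial e at (x + u : 1 : z + v). *)
Definition taylorZ (d : nat) (pt : point) (ab e : nat * nat) : Z :=
  (pt.1.1 ^+ (e.1 - ab.1) *+ 'C(e.1, ab.1)) *
  (pt.1.2 ^+ (d - e.1 - e.2 - ab.2) *+ 'C(d - e.1 - e.2, ab.2)).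

Definition condition_rows (d : nat) (pts : seq point) : seq (seq Z) :=
  [seq [seq taylorZ d x.1 x.2 e | e <- monomials d] |
    x <- [seq (pt, ab) | pt <- pts,
      ab <- [seq (a, b) | a <- iota 0 pt.2, b <- iota 0 (pt.2 - a)]]].

Definition unit_row (n j : nat) : seq Z := [seq if k == j then 1 else 0 | k <- iota 0 n].

Definition hessianZ (d : nat) (F : seq Z) (b c : nat) : Z :=
  let ms := monomials d in
  sumZ (size ms) (fun k => let e := nth (0, 0)%N ms k in
    if (e.2 == b) && ((d - e.1 - e.2)%N == c) then nth 0 F k else 0).

(** The first monomial is z^d, whose coefficient is normalised, and the last is x^d, which gives the
    value at (1 : 0 : 0). Their unit rows complete the conditions at the points to a square
    matrix. *)
Definition nodal_data (d : nat) (pts : seq point) (F : seq Z) (q : nat) : bool :=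
  let ms := monomials d in let n := size ms in
  let rows := condition_rows d pts in
  [&& [&& (1 < d)%N, (1 < q)%N, all (fun pt => pt.2 <= d)%N pts, uniq ms &
          n == (sumn [seq 'C(pt.2.+1, 2) | pt <- pts] + 2)%N],
      [&& nth 0 F 0 != 0, nth (0, 0)%N ms 0 == (0, 0)%N & nth (0, 0)%N ms n.-1 == (d, 0)%N],
      all (fun s => sumZ n (fun k => Z.mul (nth 0 F k) (nth 0 s k)) == 0) rows,
      all (fun k => (d <= (nth (0, 0)%N ms k).1.+1)%N ==> (nth 0 F k == 0)) (iota 0 n),
      hessianZ d F 1 1 ^+ 2 != (1 + 1 + 1 + 1) * hessianZ d F 2 0 * hessianZ d F 0 2 &
      invertible_mod (Z.of_nat q) n (rows ++ [:: unit_row n 0; unit_row n n.-1])].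

Variable R : realType.

Lemma nodal_member_of_data d pts F q r (m : 'I_r -> nat) :
  size pts = r -> (forall i : 'I_r, m i = (nth (0, 0, 0%N) pts i).2) ->
  nodal_data d pts F q ->
  very_general (fun p : 'M[R[i]]_(r, 3) =>
    exists D : curve p, in_system D d (fun i => (m i)%:Z) /\ exists x, 2 <= mult_at D x).
Proof.
move=> szp mE; set ms := monomials d; set n := size ms.
case/and5P => [/and5P[d2 q1 m_le uniq_ms /eqP nE] /and3P[F0 /eqP ms0 /eqP msn]].
move=> rowsF nodeF /andP[hessF invF].
pose e (k : 'I_n) := nth (0, 0)%N ms k.
pose mon : 'I_n -> 'X_{1..3} := @monomial d.
have mon_inj : injective mon := monomial_inj uniq_ms.
have monE k : mon k = triple (e k).1 (e k).2 (d - (e k).1 - (e k).2) by [].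
have n0 : (0 < n)%N by rewrite /n /ms nE addn2.
pose k0 : 'I_n := Ordinal n0.
have n1 : (n.-1 < n)%N by rewrite ltn_predL.
pose k1 : 'I_n := Ordinal n1.
pose pt (i : 'I_r) := nth (0, 0, 0%N) pts i.
pose p0 : 'M[R[i]]_(r, 3) := \matrix_(i, j) Z_to_C R [:: (pt i).1.1; 1; (pt i).1.2]`_j.
pose c0 (k : 'I_n) : R[i] := Z_to_C R F`_k.
have taylorE i a b c : taylor mon (fun j => p0 i j) (triple a 0 b) c =
    \sum_k c k * Z_to_C R (taylorZ d (pt i) (a, b) (e k)).
  rewrite /taylor; apply: eq_bigr => k _; congr (_ * _); rewrite prod3 !mxE !monE !tripleE /= subn0 bin0 mulr1n.
  by rewrite rmorph1 expr1n mulr1 rmorphM !rmorphMn !rmorphXn.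
have rowP i a b : (a + b < m i)%N ->
    [seq taylorZ d (pt i) (a, b) x | x <- ms] \in condition_rows d pts.
  move=> lt.
  apply/mapP; exists (pt i, (a, b)) => //; apply/allpairsPdep; exists (pt i), (a, b).
  split=> //; first by rewrite mem_nth ?szp.
  by apply/allpairsPdep; exists a, b; rewrite !mem_iota -mE; split=> //; lia.
apply: (@very_general_nodal_member R r d n m mon (@monomial_deg d) mon_inj d2 _ _ p0 c0 k0 k1) => //.
- by move=> i; rewrite mE; apply: (allP m_le); rewrite mem_nth ?szp.
- rewrite [LHS]nE sumnE big_map; congr (_ + 2)%N.
  rewrite (big_nth (0, 0, 0%N)) szp big_mkord.
  by apply: eq_bigr => i _; rewrite mE.
- by move=> i; rewrite mxE rmorph1.
- by rewrite Z_to_C_eq0.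
- move=> i a b lt; rewrite taylorE; have /(allP rowsF)/eqP := rowP _ _ _ lt.
  rewrite sumZE => /(congr1 (Z_to_C R)); rewrite rmorph0 rmorph_sum => E; rewrite -[RHS]E.
  apply: eq_bigr => k _; rewrite (nth_map (0, 0)%N) // -[RHS]/(Z_to_C R (_ * _)) [RHS]rmorphM.
  by [].
- move=> k; rewrite monE tripleE => le.
  have /allP/(_ (k : nat)) := nodeF; rewrite mem_iota ltn_ord => /(_ isT)/implyP/(_ le)/eqP E.
  by rewrite /c0 E rmorph0.
- by rewrite monE tripleE /e /= msn.
- move=> c pass ck0 ck1; apply: (invertible_mod_kernel q1 invF) => j.
  have [lt|ge] := ltnP j (size (condition_rows d pts)).
    have /mapP[[pt' ab] /allpairsPdep[pt'' [ab' [ptP abP [E1 E2]]]] Es] := mem_nth [::] lt.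
    subst pt' ab; case/allpairsPdep: abP => a [b [ha hb E2]]; subst ab'.
    have /(nthP (0, 0, 0%N))[i lti Ei] := ptP; rewrite szp in lti.
    have := pass (Ordinal lti) a b; rewrite taylorE mE /pt /= Ei => E; rewrite -[RHS]E; last first.
      by move: ha hb; rewrite !mem_iota; lia.
    apply: eq_bigr => k _; rewrite /entry nth_cat lt Es (nth_map (0, 0)%N) //.
  rewrite /entry nth_cat ltnNge ge /=.
  have unitE l (ltl : (l < n)%N) : \sum_k c k * Z_to_C R (nth 0 (unit_row n l) k) = c (Ordinal ltl).
    rewrite (bigD1 (Ordinal ltl)) //= big1 ?addr0 => [|k ne].
      by rewrite (nth_map 0%N) ?size_iota // nth_iota // eqxx rmorph1 mulr1.
    rewrite (nth_map 0%N) ?size_iota // nth_iota // add0n.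
    by rewrite (_ : (k == l :> nat) = false) ?rmorph0 ?mulr0 //; apply/negbTE.
  case: (j - _)%N => [|[|l]] /=.
  - by rewrite unitE -[RHS]ck0; congr c; apply: val_inj.
  - by rewrite unitE -[RHS]ck1; congr c; apply: val_inj.
  - by apply: big1 => k _; rewrite !nth_nil rmorph0 mulr0.
- have hessE b c : hessian mon c0 b c = Z_to_C R (hessianZ d F b c).
    rewrite /hessian /hessianZ sumZE rmorph_sum big_mkcond; apply: eq_bigr => k _ /=.
    by rewrite !monE !tripleE -/ms -/(e k); case: ifP => _; rewrite ?rmorph0.
  rewrite !hessE -[4%:R](rmorph_nat (Z_to_C R) 4) -rmorphXn -!rmorphM -subr_eq0 -rmorphB.
  by rewrite Z_to_C_eq0 subr_eq0.
Qed.

End ExplicitNodalMember.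

(** * The cubic and the explicit configurations *)

Section CubicThroughNinePoints.
Variables (R : realType) (r : nat).
Local Notation C := R[i].

(** Ten cubic monomials against nine linear conditions. *)
Lemma exists_cubic (p : 'M[C]_(r, 3)) : r = 10%N ->
  exists D : curve p, in_system D 3 (fun i => (i < 9)%N%:Z).
Proof.
move=> r10; pose mon := @monomial 3; have inj : injective mon by apply: monomial_inj.
pose M : 'M[C]_(10, 9) := \matrix_(k, i) \prod_j (p (cast_ord (esym r10) (inord i)) j) ^+ mon k j.
have kn0 : kermx M != 0.
  by rewrite -mxrank_eq0 mxrank_ker subn_eq0 -ltnNge (leq_ltn_trans (rank_leq_col M)).
have /rowV0Pn[u /sub_kermxP uM0 u0] := kn0.
pose F : {mpoly C[3]} := form_of mon (fun k => u 0 k).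
have F0 : F != 0.
  apply: contraNneq u0 => F0; apply/eqP/rowP => k; rewrite mxE.
  by rewrite -(mcoeff_form_of inj (fun k => u 0 k) k) -/F F0 mcoeff0.
have le (i : 'I_r) : (i < 9)%N%:Z <= (mult_P2 F (row i p))%:Z.
  case: ltnP => // lt9; rewrite lez_nat ord0_gt0 ?shift_neq0 //.
  rewrite comp_mpoly_meval /F /form_of raddf_sum /=.
  have /rowP/(_ (Ordinal lt9)) := uM0; rewrite !mxE => E; rewrite -[RHS]E.
  apply: eq_bigr => k _; rewrite mxE mevalZ mevalX; congr (_ * _).
  apply: eq_bigr => j _; rewrite tnth_mktuple mevalD mevalC mevalXU addr0 mxE.
  by congr (p _ _ ^+ _); apply: val_inj; rewrite /= inordK // ltnS ltnW.
by exists (Curve F0 (form_of_homog (@monomial_deg 3) _) le).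
Qed.

End CubicThroughNinePoints.

Local Open Scope Z_scope.

(* (x, z, m) is the point (x : 1 : z) with multiplicity m, and the coefficients
   of the members are in the order of [monomials].  Points and members are
   symmetric under x |-> - x, so that a form of even degree without the monomial
   x^d is automatically singular at (1 : 0 : 0). *)

Definition points10 : seq (Z * Z * nat) :=
  [:: (0, -2, 4%N); (0, -1, 3%N); (1, 0, 3%N); (-1, 0, 3%N); (4, 2, 3%N);
      (-4, 2, 3%N); (1, -3, 3%N); (-1, -3, 3%N); (4, 3, 3%N); (-4, 3, 3%N)].

Definition member10 : seq Z :=
  [:: 427024; 7089392; 39954816; 93179232; 37190928; -233041872; -403882912;
      -93662336; 328058880; 317777664; 89593344; 0; 0; 0; 0; 0; 0; 0; 0; 0; 0;
      -2700534; -32892776; -110563012; -45117352; 377123386; 541098336;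
      -135598032; -615717120; -280890720; 0; 0; 0; 0; 0; 0; 0; 0; 7039551;
      49846135; 36895849; -228718467; -263462832; 263486916; 305112096; 0; 0; 0;
      0; 0; 0; -8853364; -15706936; 66593172; 49066872; -125925408; 0; 0; 0; 0;
      4408812; -14614332; 12110688].

Definition points11 : seq (Z * Z * nat) :=
  [:: (0, -1, 2%N); (1, 0, 1%N); (-1, 0, 1%N); (2, 1, 1%N); (-2, 1, 1%N);
      (2, 0, 1%N); (-2, 0, 1%N); (1, 1, 1%N); (-1, 1, 1%N); (2, 2, 1%N);
      (-2, 2, 1%N)].

Definition member11 : seq Z :=
  [:: 4; 4; -4; -4; 0; 0; 0; 0; 0; -9; 9].

Definition points13 : seq (Z * Z * nat) :=
  [:: (0, 1, 1%N); (4, 1, 1%N); (-4, 1, 1%N); (1, -1, 1%N); (-1, -1, 1%N);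
      (2, 0, 1%N); (-2, 0, 1%N); (4, 2, 1%N); (-4, 2, 1%N); (3, 0, 1%N);
      (-3, 0, 1%N); (4, -2, 1%N); (-4, -2, 1%N)].

Definition member13 : seq Z :=
  [:: 5; -5; -4; 4; 0; 0; 0; 0; 0; -1; 1].

Local Close Scope Z_scope.

(** The matrix has size 66 = 10 + 9 * 6 + 2, the number of monomials of degree 10; for the two
    families of quartics it has size 15. *)
Lemma nodal_data10 : nodal_data 10 points10 member10 97.
Proof. by vm_compute. Qed.

Lemma nodal_data11 : nodal_data 4 points11 member11 97.
Proof. by vm_compute. Qed.

Lemma nodal_data13 : nodal_data 4 points13 member13 97.
Proof. by vm_compute. Qed.

(** * Assembly of the threshold *)

Section Threshold.
Variable R : realType.
Local Notation C := R[i].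

Lemma nodal_degree d pts F q r M : size pts = r -> nodal_data d pts F q ->
  sumn [seq x.2 | x <- pts] = M ->
  very_general (fun p : 'M[C]_(r, 3) => exists (D : curve p) x,
    [/\ ~ zero_divisor D, forall mu, degree mu D = mu * d%:R - M%:R & 2 <= mult_at D x]).
Proof.
move=> szp data ME; have d2 : (1 < d)%N by case/andP: data => /and5P[].
apply: very_general_mono (nodal_member_of_data R szp (fun=> erefl) data).
move=> p _ [D [[dD mD] [x xD]]]; exists D, x; split=> // [[d0 _]|mu].
  by rewrite -dD d0 in d2.
rewrite /degree dD -ME; congr (_ - _).
rewrite (eq_bigr (fun i : 'I_r => ((nth (0, 0, 0%N) pts i).2)%:Z)) => [|i _]; last exact: mD.
rewrite -(big_morph Posz PoszD (erefl _)) sumnE big_map.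
by rewrite (big_nth (0, 0, 0%N)) szp big_mkord.
Qed.

Lemma le_mult_sqrt (a s : R) (t : int) (t' : nat) : t'%:Z <= t -> 0 <= s ->
  a ^+ 2 <= t'%:R ^+ 2 * s -> a <= t%:~R * Num.sqrt s.
Proof.
move=> lett s0 h; have q0 : 0 <= Num.sqrt s by apply: sqrtr_ge0.
apply: (@le_trans _ _ (t'%:R * Num.sqrt s)); last first.
  by rewrite ler_wpM2r // -[t'%:R]/(t'%:Z%:~R) ler_int.
case: (leP a 0) => [a0|a0]; first by rewrite (le_trans a0) // mulr_ge0.
by rewrite -ler_sqr ?nnegrE ?mulr_ge0 ?(ltW a0) // exprMn sqr_sqrtr.
Qed.

(* As soon as mu ^+ 2 >= r + 1, the exceptional curves are submaximal. *)
Lemma threshold_of_curves r (p : 'M[C]_(r, 3)) : is_config p -> SHGH_at p -> (10 <= r)%N ->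
  Num.sqrt r%:R < threshold_value R r ->
  (forall mu, threshold_value R r <= mu -> mu ^+ 2 < r.+1%:R ->
    exists (D : curve p) x, ~ zero_divisor D /\
      degree mu D <= (mult_at D x)%:~R * Num.sqrt (mu ^+ 2 - r%:R)) ->
  submaximality_threshold p (threshold_value R r).
Proof.
move=> cp shgh r10 lt hD; split=> [|mu lemu ltmu|mu lemu]; first exact: ltW.
  exact: no_weakly_submaximal.
case: (ltP (mu ^+ 2) r.+1%:R) => [mu2|mu2].
  have [D [x [nz le]]] := hD mu lemu mu2.
  by apply: (weakly_submaximal_of_effective cp shgh r10 lt _ nz le); apply: ltW (lt_le_trans lt _).
have r0 : (0 < r)%N by lia.
by apply: (exceptional_weakly_submaximal (Ordinal r0) cp); rewrite lerBrDr addrC natr1.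
Qed.

Lemma sqrt_lt (a b : R) : 0 <= a -> 0 < b -> a < b ^+ 2 -> Num.sqrt a < b.
Proof.
move=> a0 b0 h; rewrite -(ltr_sqr _ (ltW b0 : b \is Num.nneg)) ?nnegrE ?sqrtr_ge0 //.
by rewrite sqr_sqrtr.
Qed.

End Threshold.

Theorem theorem4p1 (R : realType) (hSHGH : strong_SHGH R)
    (r : nat) (hr : (10 <= r)%N) :
  very_general (fun p : 'M[R[i]]_(r, 3) =>
    submaximality_threshold p (threshold_value R r)).
Proof.
have shgh : very_general (fun p : 'M[R[i]]_(r, 3) => SHGH_at p) := hSHGH r.
have s3 : Num.sqrt 3%:R ^+ 2 = 3%:R :> R by rewrite sqr_sqrtr ?ler0n.
have s13 : Num.sqrt 13%:R ^+ 2 = 13%:R :> R by rewrite sqr_sqrtr ?ler0n.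
have p3 : 0 <= Num.sqrt 3%:R :> R by apply: sqrtr_ge0.
have p13 : 0 <= Num.sqrt 13%:R :> R by apply: sqrtr_ge0.
have [E10|n10] := eqVneq r 10%N.
  subst r; have nodal := @nodal_degree R 10 points10 member10 97 10 31 erefl nodal_data10 erefl.
  apply: very_general_mono (very_general_and shgh nodal).
  move=> p cp [shp [D [x [nz degD xD]]]].
  apply: threshold_of_curves => //= [|mu le1 lt2]; first by apply: sqrt_lt; lra.
  case: (leP mu (13%:R / 4%:R)) => [le3|gt3].
    exists D, x; split=> //; rewrite degD.
    apply: (@le_mult_sqrt _ _ _ _ 2) => //; first by nra.
    (* The difference 4 (mu^2 - 10) - (10 mu - 31)^2 is 96 times this product. *)
    have := mulr_ge0 (_ : 0 <= mu - 77%:R / 24%:R) (_ : 0 <= 13%:R / 4%:R - mu).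
    by rewrite !subr_ge0 => /(_ le1 le3); lra.
  have [E [dE mE]] := exists_cubic p erefl.
  (* Multiplicity 1 is enough for the cubic, so any of its points will do. *)
  have [|y yE] := @exists_point _ _ p cp E; first by rewrite dE.
  exists E, y; split; first by case=> d0; rewrite d0 in dE.
  have -> : degree mu E = mu * 3%:R - 9%:R.
    rewrite /degree dE; congr (_ - _); rewrite (eq_bigr _ (fun i _ => mE i)).
    by rewrite !big_ord_recl big_ord0.
  apply: (@le_mult_sqrt _ _ _ _ 1) => //; first by nra.
  have lt4 : mu <= 7%:R / 2%:R by nra.
  have := mulr_ge0 (_ : 0 <= mu - 13%:R / 4%:R) (_ : 0 <= 7%:R / 2%:R - mu).
  by rewrite !subr_ge0 => /(_ (ltW gt3) lt4); lra.
have [E11|n11] := eqVneq r 11%N.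
  subst r; have nodal := @nodal_degree R 4 points11 member11 97 11 12 erefl nodal_data11 erefl.
  apply: very_general_mono (very_general_and shgh nodal).
  move=> p cp [shp [D [x [nz degD xD]]]].
  apply: threshold_of_curves => //= [|mu le1 lt2].
    by apply: sqrt_lt; nra.
  exists D, x; split=> //; rewrite degD.
  have lt4 : mu <= 4%:R by nra.
  (* This bound gives mu >= 10/3, whence mu^2 >= 11. *)
  have s3le : Num.sqrt 3%:R <= 2%:R :> R by nra.
  apply: (@le_mult_sqrt _ _ _ _ 2) => //; first by nra.
  have := mulr_ge0 (_ : 0 <= mu - (4%:R - Num.sqrt 3%:R / 3%:R)) (_ : 0 <= 4%:R + Num.sqrt 3%:R / 3%:R - mu).
  by rewrite !subr_ge0 => /(_ le1 ltac:(lra)); nra.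
have [E13|n13] := eqVneq r 13%N.
  subst r; have nodal := @nodal_degree R 4 points13 member13 97 13 13 erefl nodal_data13 erefl.
  apply: very_general_mono (very_general_and shgh nodal).
  move=> p cp [shp [D [x [nz degD xD]]]].
  have s13le : Num.sqrt 13%:R <= 37%:R / 10%:R :> R by nra.
  apply: threshold_of_curves => //= [|mu le1 lt2].
    by apply: sqrt_lt; nra.
  exists D, x; split=> //; rewrite degD.
  have lt4 : mu <= 4%:R by nra.
  apply: (@le_mult_sqrt _ _ _ _ 2) => //; first by nra.
  have := mulr_ge0 (_ : 0 <= mu - (26%:R - Num.sqrt 13%:R) / 6%:R) (_ : 0 <= (26%:R + Num.sqrt 13%:R) / 6%:R - mu).
  by rewrite !subr_ge0 => /(_ le1 ltac:(lra)); nra.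
have thE : threshold_value R r = Num.sqrt r.+1%:R.
  have [r14|lt14] := leqP 14 r; first exact: threshold_value_ge14.
  by have -> : r = 12%N by lia.
apply: very_general_mono shgh => p cp shp.
apply: threshold_of_curves => //; rewrite thE.
  by rewrite ltr_sqrt ?ltr0n // ltr_nat.
(* The threshold is sqrt (r + 1) itself, so no interval is left for further curves. *)
move=> mu le lt; have mu0 : 0 <= mu by apply: le_trans le; apply: sqrtr_ge0.
move: lt; rewrite ltNge => /negP[].
by rewrite -[X in X <= _]sqr_sqrtr ?ler0n // ler_sqr ?nnegrE ?sqrtr_ge0.
Qed.
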